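(* Let $\mathcal{H}$ and $\widetilde{\mathcal{H}}$ be separable complex Hilbert spaces, let $P=(P_t)_{t\ge0}$ be a contraction semigroup on $\mathcal{H}$ and $\widetilde{P}=(e^{-t\widetilde{\mathbf{A}}})_{t\ge0}$ a contraction semigroup on $\widetilde{\mathcal{H}}$, where $\widetilde{\mathbf{A}}$ is normal with spectral gap $\gamma_1>0$ and resolution of identity $\mathsf{E}$. Let $\Lambda:\widetilde{\mathcal{H}}\to\mathcal{H}$ and $\widetilde{\Lambda}:\mathcal{H}\to\widetilde{\mathcal{H}}$ be bounded linear operators with dense ranges such that, for all $t\ge0$, $$P_t\Lambda=\Lambda\widetilde{P}_t\quad\text{and}\quad\widetilde{P}_t\widetilde{\Lambda}=\widetilde{\Lambda}P_t,$$ and such that $\mathsf{E}_\Omega\big(\overline{\mathrm{Ran}(\Lambda^* )}\big)\subseteq\overline{\mathrm{Ran}(\Lambda^* )}$ for all Borel $\Omega\subseteq\mathbb{C}$. Put $\mathsf{F}_\Omega=\Lambda\mathsf{E}_\Omega\Lambda^\dagger$ on $\mathrm{Ran}(\Lambda)$. (i) If there exists $m\in L^\infty(\sigma(\widetilde{\mathbf{A}}))$ with $m(\widetilde{\mathbf{A}})=\widetilde{\Lambda}\Lambda$, then, with $\widehat{m}=m\,\big(\|\Lambda\|_{\widetilde{\mathcal{H}}\to\mathcal{H}}\|\widetilde{\Lambda}\|_{\mathcal{H}\to\widetilde{\mathcal{H}}}\big)^{-1}$, for all $(f,g)\in\mathrm{Ran}(\Lambda)\times\mathcal{H}$, $$\int_{\sigma(\widetilde{\mathbf{A}})}|\widehat{m}(\gamma)|\,d|\langle\mathsf{F}_\gamma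 f,g\rangle_{\mathcal{H}}|\le\|f\|_{\mathcal{H}}\|g\|_{\mathcal{H}}.$$ (ii) In particular, if $\widetilde{\mathbf{A}}$ has simple spectrum, then there exists $m\in L^\infty(\sigma(\widetilde{\mathbf{A}}))$ such that $m(\widetilde{\mathbf{A}})=\widetilde{\Lambda}\Lambda$. (iii) If $m\in L^\infty(\sigma(\widetilde{\mathbf{A}}))$ with $m(\widetilde{\mathbf{A}})=\widetilde{\Lambda}\Lambda$ also satisfies, for some constant $T_m>0$, that $\gamma\mapsto e^{-\gamma t}/m(\gamma)\in L^\infty(\sigma(\widetilde{\mathbf{A}}))$ for every $t>T_m$, then, with $\widehat{m}$ as in (i): for $t>T_m$ the operator $\int_{\sigma(\widetilde{\mathbf{A}})}e^{-\gamma t}d\mathsf{F}_\gamma$ extends to a bounded linear operator on $\mathcal{H}$; and, with $M_t^{(\gamma_1)}(\gamma)=\frac{e^{-\gamma t}}{\widehat{m}(\gamma)}\mathbf{1}_{\{\mathrm{Re}(\gamma)\ge\gamma_1\}}$, for all $f\in\mathcal{H}$ and $t>T_m$, $$\|P_tf-P_\infty f\|_{\mathcal{H}}\le\|M_t^{(\gamma_1)}\|_\infty\|f-P_\infty f\|_{\mathcal{H}};$$ and if $M_t^{(\gamma_1)}$ attains its supremum at $\gamma_1$ (that is, $\gamma_1\in\sigma(\widetilde{\mathbf{A}})$ and $|M_t^{(\gamma_1)}(\gamma_1)|=\|M_t^{(\gamma_1)}\|_\infty$), then for all $f\in\mathcal{H}$ and $t>T_m$, $\|P_tf-P_\infty f\|_{\mathcal{H}}\le\frac{1}{|\widehat{m}(\gamma_1)|}e^{-\gamma_1t}\|f-P_\infty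 f\|_{\mathcal{H}}$.
   Context: A contraction semigroup on a Hilbert space is a strongly continuous one-parameter semigroup $(P_t)_{t\ge0}$ of bounded operators with $P_0=I$ and $\|P_t\|\le1$; writing $P=(e^{-t\mathbf{A}})_{t\ge0}$ means that its generator is $-\mathbf{A}$. $P_\infty$ is the orthogonal projection onto $\{f\in\mathcal{H}:P_tf=f\ \forall t\ge0\}$. For a normal operator $\widetilde{\mathbf{A}}$, $\mathsf{E}$ is its unique projection-valued spectral measure on the Borel sets of $\mathbb{C}$, and $m(\widetilde{\mathbf{A}})=\int_{\sigma(\widetilde{\mathbf{A}})}m(\gamma)d\mathsf{E}_\gamma$ (Borel functional calculus). A normal $\widetilde{\mathbf{A}}$ with $\sigma(\widetilde{\mathbf{A}})\subseteq\{\mathrm{Re}(z)\ge0\}$ has spectral gap $\gamma_1$ if $$\gamma_1=\inf\{\mathrm{Re}(\gamma):\gamma\in\sigma(\widetilde{\mathbf{A}}),\ \mathrm{Re}(\gamma)>0\}=\inf\Big\{\tfrac{\mathrm{Re}\langle\widetilde{\mathbf{A}}f,f\rangle}{\|f\|^2}:0\ne f\in\mathcal{D}(\widetilde{\mathbf{A}}),\ f\perp\mathrm{Ker}(\widetilde{\mathbf{A}})\Big\}>0.$$ $\widetilde{\mathbf{A}}$ has simple spectrum if there is a vector $v\in\widetilde{\mathcal{H}}$ with $v\in\mathcal{D}((\widetilde{\mathbf{A}}^* )^k\widetilde{\mathbf{A}}^l)$ for all integers $k,l\ge0$ and such that $\widetilde{\mathcal{H}}$ is the closed linear span of $\{(\widetilde{\mathbf{A}}^*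 )^k\widetilde{\mathbf{A}}^lv:k,l\ge0\}$. $\Lambda^\dagger$ is the (Moore–Penrose) pseudo-inverse of $\Lambda$, with domain $\mathrm{Ran}(\Lambda)$: for $f\in\mathrm{Ran}(\Lambda)$, $\Lambda^\dagger f$ is the unique $h\in\mathrm{Ker}(\Lambda)^\perp$ with $\Lambda h=f$. For $(f,g)\in\mathrm{Ran}(\Lambda)\times\mathcal{H}$, $\Omega\mapsto\langle\mathsf{F}_\Omega f,g\rangle=\langle\mathsf{E}_\Omega\Lambda^\dagger f,\Lambda^*g\rangle$ is a complex measure, and $|\langle\mathsf{F}_\gamma f,g\rangle|$ denotes its total variation measure. For bounded Borel $\phi$, $\int\phi\,d\mathsf{F}_\gamma$ is the operator on $\mathrm{Ran}(\Lambda)$ with $\langle(\int\phi\,d\mathsf{F}_\gamma)f,g\rangle=\int\phi(\gamma)d\langle\mathsf{F}_\gamma f,g\rangle$. $L^\infty(\sigma(\widetilde{\mathbf{A}}))$ is the space of bounded complex-valued Borel functions on $\sigma(\widetilde{\mathbf{A}})$ with the uniform norm $\|\cdot\|_\infty$. *)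

(* Defs.v *)
From HB Require Import structures.
From mathcomp Require Import all_boot all_order all_algebra.
From mathcomp Require Import all_classical all_reals all_analysis.
From mathcomp Require Import complex.
Import numFieldNormedType.Exports.
Import Order.TTheory GRing.Theory Num.Theory.
Set Implicit Arguments.
Unset Strict Implicit.
Unset Printing Implicit Defensive.
Local Open Scope classical_set_scope.
Local Open Scope ring_scope.

(* The inner product is linear in its first argument and conjugate-linear in
   the second. *)
HB.mixin Record isHilbert (R : realType) H of CompleteNormedModule R[i] H := {
  hdot : {dot H for (Num.conj : R[i] -> R[i])};
  hdotE : forall x : H, hdot x x = `|x| ^+ 2 }.

#[short(type="hilbertType")]
HB.structure Definition Hilbert (R : realType) :=
  {H of CompleteNormedModule R[i] H & isHilbert R H}.

Definition separable_space (T : topologicalType) : Prop :=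
  exists2 S : set T, countable S & dense S.

(* The norm of a normed space over R[i] takes its values in R[i]; [rnorm] is
   the same number seen in R. It is also used for the modulus on R[i]. *)
Definition rnorm (R : realType) (V : normedZmodType R[i]) (x : V) : R :=
  complex.Re `|x|.

Definition lin_span (K : fieldType) (V : lmodType K) (S : set V) : set V :=
  [set x | exists (n : nat) (a : 'I_n -> K) (w : 'I_n -> V),
     (forall i, S (w i)) /\ x = \sum_(i < n) a i *: w i].

Section bounded_operators.
Variables (R : realType) (H K : hilbertType R).
Implicit Type T : {linear H -> K}.

Definition bounded_op T : Prop :=
  exists M : R, forall x, rnorm (T x) <= M * rnorm x.

Definition opnorm T : R :=
  sup [set rnorm (T x) | x in [set x | rnorm x <= 1]].

(* Moore-Penrose pseudo-inverse; only meaningful on [range T]. *)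
Definition pseudo_inverse T (f : K) : H :=
  xget 0 [set h | (forall k, T k = 0 -> hdot h k = 0) /\ T h = f].

End bounded_operators.

Definition orth_proj (R : realType) (H : hilbertType R) (V : set H) (f : H) : H :=
  xget 0 [set p | V p /\ forall v, V v -> hdot (f - p) v = 0].

(* A partially defined operator from H to K is represented by its graph, a
   subset of H * K; in [relation_scope], [B \; A] is the graph of
   x |-> B (A x) on its natural domain. *)
Section unbounded_operators.
Variables (R : realType) (H K : hilbertType R).
Implicit Type A : set (H * K).

Definition graph (T : H -> K) : set (H * K) := [set xy | xy.2 = T xy.1].

Definition op_dom A : set H := [set x | exists y, A (x, y)].

Definition op_ran A : set K := [set y | exists x, A (x, y)].

Definition op_ker A : set H := [set x | A (x, 0)].

Definition linear_op A : Prop :=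
  [/\ A (0, 0),
      forall (a : R[i]) x y x' y',
        A (x, y) -> A (x', y') -> A (a *: x + x', a *: y + y') &
      forall x y y', A (x, y) -> A (x, y') -> y = y'].

(* This is the graph of an operator when the domain of A is dense. *)
Definition adjoint A : set (K * H) :=
  [set yz | forall x w, A (x, w) -> hdot w yz.1 = hdot x yz.2].

End unbounded_operators.

Section operators_on_a_space.
Variables (R : realType) (H : hilbertType R).
Implicit Type A : set (H * H).

Definition op_pow A (k : nat) : set (H * H) :=
  iter k (fun B => A \; B)%relation (graph id).

Definition normal_op A : Prop :=
  [/\ linear_op A, dense (op_dom A), closed A &
      (adjoint A \; A)%relation = (A \; adjoint A)%relation].

Definition resolvent_set A : set R[i] :=
  [set z | exists S : {linear H -> H},
     [/\ bounded_op S,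
         forall x y, A (x, y) -> S (y - z *: x) = x &
         forall y, A (S y, y + z *: S y)]].

Definition spectrum A : set R[i] := ~` resolvent_set A.

(* Both infima are taken in the extended reals, where the infimum of the empty
   set is +oo. *)
Definition spectral_gap A (g : R) : Prop :=
  [/\ spectrum A `<=` [set z | 0 <= complex.Re z],
      0 < g,
      g%:E = ereal_inf [set (complex.Re z)%:E |
                        z in spectrum A `&` [set z | 0 < complex.Re z]] &
      g%:E = ereal_inf [set (complex.Re (hdot fy.2 fy.1) / rnorm fy.1 ^+ 2)%:E |
                        fy in A `&` [set fy | fy.1 <> 0 /\
                          forall k, op_ker A k -> hdot fy.1 k = 0]]].

Definition simple_spectrum A : Prop :=
  exists v : H,
    (forall k l,
      op_dom (op_pow (adjoint A) k \; op_pow A l)%relation v) /\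
    closure (lin_span
      [set w | exists k l,
         (op_pow (adjoint A) k \; op_pow A l)%relation (v, w)]) = setT.

End operators_on_a_space.

Section semigroups.
Variables (R : realType) (H : hilbertType R).
Implicit Type P : R -> {linear H -> H}.

(* Only the values [P t] for [0 <= t] matter. *)
Definition contraction_semigroup P : Prop :=
  [/\ forall x, P 0 x = x,
      forall s t x, 0 <= s -> 0 <= t -> P (s + t) x = P s (P t x),
      forall t x, 0 <= t -> rnorm (P t x) <= rnorm x &
      forall x, {within `[0, +oo[, continuous (fun t => P t x)}].

Definition semigroup_generator P : set (H * H) :=
  [set xy | (fun t : R => (t^-1)%:C%C *: (P t xy.1 - xy.1)) @ 0^'+ --> xy.2].

(* [exp_semigroup P A] : P is the semigroup (e^{-tA})_t, i.e., its generator
   is - A. *)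
Definition exp_semigroup P (A : set (H * H)) : Prop :=
  semigroup_generator P = [set xy | A (xy.1, - xy.2)].

Definition fixed_space P : set H := [set f | forall t, 0 <= t -> P t f = f].

Definition Pinf P : H -> H := orth_proj (fixed_space P).

End semigroups.

Notation borelC R := (g_sigma_algebraType (@open (R[i])^o)).

Section complex_measures.
Variable R : realType.
Implicit Types (mu : set (borelC R) -> R[i]) (nu : set (borelC R) -> R).
Implicit Type D : set (borelC R).

(* The supremum runs over the countable measurable partitions of D. *)
Definition cmeasure_variation mu D : \bar R :=
  ereal_sup [set (\sum_(0 <= i <oo) (rnorm (mu (B i)))%:E)%E |
    B in [set B : (set (borelC R))^nat |
      [/\ forall i, measurable (B i), trivIset setT B & \bigcup_i B i = D]]].

(* The positive part of the Jordan decomposition of a finite signed measure. *)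
Definition pos_variation nu D : \bar R :=
  ereal_sup [set (nu B)%:E | B in [set B | measurable B /\ B `<=` D]].

Definition signed_integral nu D (f : borelC R -> R) : R :=
  fine (\int[pos_variation nu]_(x in D) (f x)%:E)%E -
  fine (\int[pos_variation (fun B => - nu B)%R]_(x in D) (f x)%:E)%E.

Definition complex_integral mu D (phi : R[i] -> R[i]) : R[i] :=
  let mur := fun B => complex.Re (mu B) in
  let mui := fun B => complex.Im (mu B) in
  let phir := fun z => complex.Re (phi z) in
  let phii := fun z => complex.Im (phi z) in
  ((signed_integral mur D phir - signed_integral mui D phii) +i*
   (signed_integral mur D phii + signed_integral mui D phir))%C.

(* Bounded Borel functions on D, with no identification of almost everywhere
   equal functions; [supnorm] is the uniform norm. *)
Definition Linfty D (phi : R[i] -> R[i]) : Prop :=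
  measurable_fun D (phi : borelC R -> borelC R) /\
  exists M : R, forall z, D z -> rnorm (phi z) <= M.

Definition supnorm D (phi : R[i] -> R[i]) : R :=
  sup [set rnorm (phi z) | z in D].

Definition cexp (z : R[i]) : R[i] :=
  ((expR (complex.Re z) * cos (complex.Im z)) +i*
   (expR (complex.Re z) * sin (complex.Im z)))%C.

End complex_measures.

Section spectral_measures.
Variables (R : realType) (H : hilbertType R).

(* [op_integral F D phi f z] : z is the vector (\int_D phi dF) f, i.e.,
   <z, g> = \int_D phi d<F f, g> for all g. *)
Definition op_integral (F : set (borelC R) -> H -> H) (D : set (borelC R))
    (phi : R[i] -> R[i]) (f z : H) : Prop :=
  forall g, hdot z g = complex_integral (fun B => hdot (F B f) g) D phi.

Definition projection_valued_measure
    (E : set (borelC R) -> {linear H -> H}) : Prop :=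
  [/\ forall B x y, measurable B -> hdot (E B x) y = hdot x (E B y),
      forall B C x, measurable B -> measurable C ->
        E (B `&` C) x = E B (E C x),
      forall x, E setT x = x &
      forall (B : (set (borelC R))^nat) x,
        (forall i, measurable (B i)) -> trivIset setT B ->
        series (fun i => E (B i) x) @ \oo --> E (\bigcup_i B i) x].

(* A = \int z dE(z), with its natural domain. *)
Definition resolution_of_identity (A : set (H * H))
    (E : set (borelC R) -> {linear H -> H}) : Prop :=
  projection_valued_measure E /\
  forall x y, A (x, y) <->
    (\int[fun B => (complex.Re (hdot (E B x) x))%:E]_z
       (rnorm (z : R[i]) ^+ 2)%:E < +oo)%E /\
    op_integral (fun B => E B) setT id x y.

End spectral_measures.

Section intertwining.
Variables (R : realType) (H Ht : hilbertType R).
Variables (Lam : {linear Ht -> H}) (Lamt : {linear H -> Ht}).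

(* F_B = Lam E_B Lam^+, only meaningful on [range Lam]. *)
Definition intertwined_measure (E : set (borelC R) -> {linear Ht -> Ht})
    (B : set (borelC R)) (f : H) : H := Lam (E B (pseudo_inverse Lam f)).

(* m(A) = Lamt Lam *)
Definition multiplier_for (A : set (Ht * Ht))
    (E : set (borelC R) -> {linear Ht -> Ht}) (m : R[i] -> R[i]) : Prop :=
  forall x, op_integral (fun B => E B) (spectrum A) m x (Lamt (Lam x)).

Definition normalized (m : R[i] -> R[i]) (z : R[i]) : R[i] :=
  m z * ((opnorm Lam * opnorm Lamt)^-1)%:C%C.

Definition decay_multiplier (m : R[i] -> R[i]) (g t : R) (z : R[i]) : R[i] :=
  if g <= complex.Re z then cexp (- (t%:C%C * z)) / normalized m z else 0.

End intertwining.

(* Main.v *)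
Require Import Defs.
From HB Require Import structures.
From mathcomp Require Import all_boot all_order all_algebra.
From mathcomp Require Import all_classical all_reals all_analysis.
From mathcomp Require Import measurable_realfun complex ring lra.
Import numFieldNormedType.Exports.
Import Order.TTheory GRing.Theory Num.Theory.
Set Implicit Arguments.
Unset Strict Implicit.
Unset Printing Implicit Defensive.
Local Open Scope classical_set_scope.
Local Open Scope ring_scope.

(** Everything is reduced to local estimates for the spectral measure E. Say
    that y is the image of x under multiplication by phi on a Borel set D
    ([symbol]) when E B y is within r |E B x| of c E B x for every Borel B in D
    on which phi stays within r of a constant c. The pieces of a countable
    partition give orthogonal components, so such estimates may be checked on
    arbitrarily fine pieces ([pvm_local]); hence the relation determines E D y
    ([sym_uniq]) and composes ([sym_comp]). For bounded phi it is the weak formula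
    <y, k> = int phi d<E x, k> ([op_integral_sym], [sym_op_integral]), and
    representing functionals turns every bounded phi into a bounded operator
    ([op_integral_ex]). The graph of A is the relation with phi(z) = z on the
    whole plane ([op_sym]). From there on no unbounded integrand occurs: the
    resolvent set is the largest open E-null set ([ball_resolvent],
    [pvm_resolvent]), an operator commuting with the semigroup commutes with E
    ([fuglede]), and the semigroup is the relation with phi(z) = exp(- t z) on the
    spectrum ([sym_semigroup]), because it differs from the scalar exponential at
    x by at most t |A x - z x| ([semigroup_near_exp]).

    The first claim. Let f = Lam h and T = Lamt Lam = m(A). On disjoint pieces C i
    where m is close to constants c i, choose phases u i; the sum of the
    |c i| |<Lam (E (C i) h), k>| is <Lam w, k> with w the sum of the
    u i c i E (C i) h. There c i E (C i) h is close to E (C i) (T h) =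
    E (C i) (Lamt f), so that w is close to a contraction applied to Lamt f and the
    sum is at most |Lam| |Lamt| |f| |k| up to a small error ([variation_fine]).
    Refining partitions gives the bound for the integral of any simple function
    below |m| against the variation ([variation_sum], [variation_integral]).

    The second claim. T commutes with the semigroup, hence with E. If v is cyclic
    for A and its adjoint, the vectors E B v are total ([cyclic_total]). The
    complex measure <T (E B v), v> is dominated by |T| |E B v|^2, and its bounded
    density is the function of A equal to T ([commutant_multiplier]).

    The third claim. The quotient exp(- t z) / m defines a bounded operator N with
    P t = Lam N Lamt ([semigroup_factorization]). For f' = f - Pinf f the vector
    Lamt f' has no component in the kernel of A, since a contraction and its
    adjoint have the same fixed vectors ([kernel_component]); by the variational
    formula for the gap, E charges outside of the point 0 only the half-plane
    Re z >= gam1 ([pvm_high_spectrum]). So only the values of the quotient there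
    enter the norm of N (Lamt f') ([semigroup_decay]). *)

(** * Real-valued norms and inner products *)

Section norm.
Variable R : realType.
Implicit Types (a b c z w : R[i]).

Lemma norm_rnorm (V : normedZmodType R[i]) (x : V) : `|x| = (rnorm x)%:C%C.
Proof. by rewrite RRe_real// ger0_real. Qed.

Lemma rnorm_ge0 (V : normedZmodType R[i]) (x : V) : 0 <= rnorm x.
Proof. by rewrite -ler0c -norm_rnorm. Qed.

Lemma rnorm0 (V : normedZmodType R[i]) : rnorm (0 : V) = 0.
Proof. by rewrite /rnorm normr0. Qed.

Lemma rnorm_eq0 (V : normedZmodType R[i]) (x : V) : rnorm x = 0 -> x = 0.
Proof. by move=> x0; apply/eqP; rewrite -normr_eq0 norm_rnorm x0. Qed.

Lemma rnormD (V : normedZmodType R[i]) (x y : V) :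
  rnorm (x + y) <= rnorm x + rnorm y.
Proof. by rewrite -lecR rmorphD/= -!norm_rnorm ler_normD. Qed.

Lemma rnormN (V : normedZmodType R[i]) (x : V) : rnorm (- x) = rnorm x.
Proof. by rewrite /rnorm normrN. Qed.

Lemma rnormB (V : normedZmodType R[i]) (x y : V) :
  rnorm (x - y) <= rnorm x + rnorm y.
Proof. by rewrite -(rnormN y) rnormD. Qed.

Lemma rdistC (V : normedZmodType R[i]) (x y : V) : rnorm (x - y) = rnorm (y - x).
Proof. by rewrite -rnormN opprB. Qed.

Lemma rnorm_sum (V : normedZmodType R[i]) (I : Type) (r : seq I) (F : I -> V) :
  rnorm (\sum_(i <- r) F i) <= \sum_(i <- r) rnorm (F i).
Proof.
elim: r => [|i r IH]; first by rewrite !big_nil rnorm0.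
by rewrite !big_cons (le_trans (rnormD _ _))// lerD2l.
Qed.

Lemma rnormM a b : rnorm (a * b) = rnorm a * rnorm b.
Proof. by apply: complexI; rewrite rmorphM/= -!norm_rnorm normrM. Qed.

Lemma rnormV a : rnorm a^-1 = (rnorm a)^-1.
Proof. by apply: complexI; rewrite fmorphV/= -!norm_rnorm normfV. Qed.

Lemma rnormZ (V : normedModType R[i]) a (x : V) :
  rnorm (a *: x) = rnorm a * rnorm x.
Proof. by apply: complexI; rewrite rmorphM/= -!norm_rnorm normrZ. Qed.

Lemma rnorm_real (r : R) : rnorm (r%:C%C : R[i]) = `|r|.
Proof. by rewrite /rnorm normc_def/= expr0n/= addr0 sqrtr_sqr. Qed.

Lemma rnorm_sqr a : rnorm a ^+ 2 = complex.Re a ^+ 2 + complex.Im a ^+ 2.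
Proof.
by apply: complexI; rewrite rmorphXn/= -norm_rnorm -add_Re2_Im2.
Qed.

Lemma rnorm_conj a : rnorm (Num.conj a) = rnorm a.
Proof. by rewrite /rnorm norm_conjC. Qed.

Lemma Re_le_rnorm a : `|complex.Re a| <= rnorm a.
Proof.
rewrite -(ler_pXn2r (n := 2))// ?nnegrE ?rnorm_ge0//.
by rewrite rnorm_sqr real_normK ?num_real// lerDl sqr_ge0.
Qed.

Lemma Im_le_rnorm a : `|complex.Im a| <= rnorm a.
Proof.
rewrite -(ler_pXn2r (n := 2))// ?nnegrE ?rnorm_ge0//.
by rewrite rnorm_sqr real_normK ?num_real// lerDr sqr_ge0.
Qed.

Lemma rnorm_le_ReIm a : rnorm a <= `|complex.Re a| + `|complex.Im a|.
Proof.
rewrite -(ler_pXn2r (n := 2))// ?nnegrE ?rnorm_ge0 ?addr_ge0//.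
rewrite rnorm_sqr sqrrD !real_normK ?num_real// addrAC lerDl.
by rewrite mulrn_wge0// mulr_ge0.
Qed.

Lemma conjcE a : Num.conj a = (a^*)%C. Proof. by []. Qed.

Lemma mul_conj a : a * Num.conj a = (rnorm a ^+ 2)%:C%C.
Proof. by rewrite -normCK norm_rnorm rmorphXn. Qed.

Lemma phase_ex a : exists2 u : R[i], rnorm u <= 1 & u * a = (rnorm a)%:C%C.
Proof.
have [->|a0] := eqVneq a 0.
  by exists 0; rewrite ?mul0r rnorm0 ?ler01.
have na0 : (rnorm a)%:C%C != 0 :> R[i] by rewrite -norm_rnorm normr_eq0.
exists (Num.conj a / (rnorm a)%:C%C).
  rewrite rnormM rnormV rnorm_conj rnorm_real ger0_norm ?rnorm_ge0//.
  rewrite divff//; apply/eqP => /rnorm_eq0 a00; by rewrite a00 eqxx in a0.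
rewrite mulrAC [_ * a]mulrC mul_conj rmorphXn/= expr2 mulfK//.
Qed.

End norm.

Section hilbert.
Variables (R : realType) (H : hilbertType R).
Implicit Types (x y z : H) (a : R[i]).
Local Notation "<| x , y |>" := (hdot x y) (at level 0, x, y at level 99).

Lemma hdotDl x y z : <|x + y, z|> = <|x, z|> + <|y, z|>.
Proof. exact: linearDl. Qed.
Lemma hdotDr x y z : <|z, x + y|> = <|z, x|> + <|z, y|>.
Proof. exact: linearDr. Qed.
Lemma hdotBl x y z : <|x - y, z|> = <|x, z|> - <|y, z|>.
Proof. exact: linearBl. Qed.
Lemma hdotBr x y z : <|z, x - y|> = <|z, x|> - <|z, y|>.
Proof. exact: linearBr. Qed.
Lemma hdotNr x z : <|z, - x|> = - <|z, x|>.
Proof. exact: linearNr. Qed.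
Lemma hdot0l z : <|0, z|> = 0. Proof. exact: linear0l. Qed.
Lemma hdot0r z : <|z, 0|> = 0. Proof. exact: linear0r. Qed.
Lemma hdotZl a x z : <|a *: x, z|> = a * <|x, z|>.
Proof. exact: linearZl_LR. Qed.
Lemma hdotZr a x z : <|z, a *: x|> = Num.conj a * <|z, x|>.
Proof. exact: linearZr_LR. Qed.
Lemma hdotC x y : <|y, x|> = Num.conj <|x, y|>.
Proof. by rewrite hermC/= expr0 mul1r. Qed.

Lemma hdot_suml (I : Type) (r : seq I) (F : I -> H) z :
  <|\sum_(i <- r) F i, z|> = \sum_(i <- r) <|F i, z|>.
Proof.
elim: r => [|i r IH]; first by rewrite !big_nil hdot0l.
by rewrite !big_cons hdotDl IH.
Qed.

Lemma hdot_sqr x : <|x, x|> = (rnorm x ^+ 2)%:C%C.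
Proof. by rewrite hdotE norm_rnorm rmorphXn. Qed.

Lemma Re_hdotC x y : complex.Re <|x, y|> = complex.Re <|y, x|>.
Proof. by rewrite (hdotC y x) conjcE; case: (hdot y x). Qed.

Lemma hdotC0 x y : <|x, y|> = 0 -> <|y, x|> = 0.
Proof. by move=> xy; rewrite hdotC xy rmorph0. Qed.

Lemma rnormD_sqr x y :
  rnorm (x + y) ^+ 2 = rnorm x ^+ 2 + rnorm y ^+ 2 + 2 * complex.Re <|x, y|>.
Proof.
have : <|x + y, x + y|> = (rnorm (x + y) ^+ 2)%:C%C by rewrite hdot_sqr.
rewrite hdotDl !hdotDr !hdot_sqr => /(congr1 (@complex.Re R)).
have := Re_hdotC x y.
case: (hdot x y) (hdot y x) => [a b] [a' b'] /= <- <-; ring.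
Qed.

Lemma rnormB_sqr x y :
  rnorm (x - y) ^+ 2 = rnorm x ^+ 2 + rnorm y ^+ 2 - 2 * complex.Re <|x, y|>.
Proof.
rewrite rnormD_sqr rnormN hdotNr; case: (hdot x y) => a b /=; ring.
Qed.

Lemma pythagoras x y : <|x, y|> = 0 ->
  rnorm (x + y) ^+ 2 = rnorm x ^+ 2 + rnorm y ^+ 2.
Proof. by move=> xy; rewrite rnormD_sqr xy/= mulr0 addr0. Qed.

Lemma hdot_le x y : rnorm <|x, y|> <= rnorm x * rnorm y.
Proof.
have [->|y0] := eqVneq y 0; first by rewrite hdot0r !rnorm0 mulr0.
have ny0 : rnorm y != 0 by apply: contra_neq y0 => /rnorm_eq0.
have nyc : (rnorm y ^+ 2)%:C%C != 0 :> R[i].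
  by rewrite -(rmorph0 (real_complex R)) (inj_eq (@complexI R)) expf_neq0.
rewrite -(ler_pXn2r (n := 2))// ?nnegrE ?mulr_ge0 ?rnorm_ge0// exprMn.
pose a := <|x, y|> / (rnorm y ^+ 2)%:C%C.
have ay : <|x - a *: y, a *: y|> = 0.
  by rewrite hdotBl hdotZl !hdotZr hdot_sqr mulrCA /a divfK// subrr.
have := pythagoras ay; rewrite subrK => ->.
rewrite rnormZ /a rnormM rnormV rnorm_real ger0_norm ?sqr_ge0//.
set X := rnorm (x - _) ^+ 2; set N := rnorm (hdot _ _).
have -> : (X + (N / rnorm y ^+ 2 * rnorm y) ^+ 2) * rnorm y ^+ 2
    = X * rnorm y ^+ 2 + N ^+ 2 by field.
by rewrite lerDr mulr_ge0// sqr_ge0.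
Qed.

Lemma Re_hdot_le x y : complex.Re <|x, y|> <= rnorm x * rnorm y.
Proof.
apply: le_trans (hdot_le x y); exact: le_trans (ler_norm _) (Re_le_rnorm _).
Qed.

Lemma hdot_inj x y : (forall z, <|x, z|> = <|y, z|>) -> x = y.
Proof.
move=> xy; apply/eqP; rewrite -subr_eq0; apply/eqP/rnorm_eq0.
have : <|x - y, x - y|> = 0 by rewrite hdotBl xy subrr.
rewrite hdot_sqr => /(congr1 (@complex.Re R)) /= /eqP.
by rewrite sqrf_eq0 => /eqP.
Qed.

Lemma rnorm_le_hdot x (M : R) : 0 <= M ->
  (forall z, rnorm <|x, z|> <= M * rnorm z) -> rnorm x <= M.
Proof.
move=> M0 h; have := h x; rewrite hdot_sqr rnorm_real ger0_norm ?sqr_ge0//.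
rewrite expr2; have [x0|x0] := eqVneq (rnorm x) 0; first by rewrite x0.
by rewrite ler_pM2r// lt_neqAle rnorm_ge0 eq_sym x0.
Qed.

Lemma parallelogram x y :
  rnorm (x + y) ^+ 2 + rnorm (x - y) ^+ 2
  = 2 * rnorm x ^+ 2 + 2 * rnorm y ^+ 2.
Proof. rewrite rnormD_sqr rnormB_sqr; ring. Qed.

Lemma polarization x y : complex.Re <|x, y|>
  = rnorm (x + y) ^+ 2 / 4 - rnorm (x - y) ^+ 2 / 4.
Proof. rewrite rnormD_sqr rnormB_sqr; lra. Qed.

Lemma Im_hdot x y : complex.Im <|x, y|> = complex.Re <|x, 'i%C *: y|>.
Proof.
rewrite hdotZr conjcE; case: (hdot x y) => a b /=; ring.
Qed.

End hilbert.

Section limits.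
Variable R : realType.

Lemma rnorm_ball (V : normedModType R[i]) (x y : V) (e : R) :
  ball x e%:C%C y <-> rnorm (x - y) < e.
Proof. by rewrite -ball_normE/= norm_rnorm ltcR. Qed.

Lemma rcvgP (V : normedModType R[i]) (u : V^nat) (l : V) :
  u @ \oo --> l <-> (fun n => rnorm (u n - l)) @ \oo --> (0 : R).
Proof.
split.
  move=> /cvgrPdist_lt ul; apply/cvgrPdist_lt => e e0.
  have := ul e%:C%C; rewrite ltcR => /(_ e0); apply: filterS => n.
  by rewrite norm_rnorm ltcR sub0r normrN rdistC ger0_norm ?rnorm_ge0.
move=> /cvgrPdist_lt ul; apply/cvgrPdist_lt => e e0.
have eE : e = (complex.Re e)%:C%C by rewrite RRe_real// gtr0_real.
rewrite eE ltcR in e0 *.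
have := ul _ e0; apply: filterS => n.
by rewrite norm_rnorm ltcR sub0r normrN rdistC ger0_norm ?rnorm_ge0.
Qed.

Lemma closureP (V : normedModType R[i]) (S : set V) (x : V) :
  closure S x <-> forall e : R, 0 < e -> exists2 y, S y & rnorm (x - y) < e.
Proof.
split.
  move=> Sx e e0; have := Sx (ball x e%:C%C).
  case; first by apply: nbhsx_ballx; rewrite ltcR.
  by move=> y [Sy /rnorm_ball]; exists y.
move=> h B /nbhs_ballP[e /= e0 eB].
have eE : e = (complex.Re e)%:C%C by rewrite RRe_real// gtr0_real.
rewrite eE ltcR in e0; have [y Sy xy] := h _ e0.
by exists y; split => //; apply: eB; rewrite eE; apply/rnorm_ball.
Qed.

Lemma denseP (V : normedModType R[i]) (S : set V) :
  dense S -> forall (x : V) (e : R), 0 < e -> exists2 y, S y & rnorm (x - y) < e.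
Proof.
move=> dS x; apply/closureP; rewrite (_ : closure S = setT)//.
apply/seteqP; split => // y _ B By.
have [z [Bz Sz]] := dS B^° (ex_intro _ y By) (open_interior B).
by exists z; split => //; exact: interior_subset.
Qed.

Lemma hilbert_complete (H : hilbertType R) (u : nat -> H) :
  (forall e : R, 0 < e -> exists N, forall m n, (N <= m)%N -> (N <= n)%N ->
     rnorm (u m - u n) < e) ->
  exists l : H, u @ \oo --> l.
Proof.
move=> h; exists (lim (u @ \oo)); apply: cauchy_cvg; apply/cauchy_exP => e e0.
have eE : e = (complex.Re e)%:C%C by rewrite RRe_real// gtr0_real.
rewrite eE ltcR in e0; have [N hN] := h _ e0.
exists (u N); exists N => // n /= Nn.
by rewrite eE; apply/rnorm_ball; exact: hN.
Qed.

Lemma le_cst_lim (u : nat -> R) (l M : R) : u @ \oo --> l ->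
  (forall n, u n <= M) -> l <= M.
Proof.
move=> ul uM; rewrite -(cvg_lim _ ul)//; apply: limr_le; first by apply/cvg_ex; exists l.
exact: nearW.
Qed.

Lemma le_add_eps (a b : R) : (forall e : R, 0 < e -> a <= b + e) -> a <= b.
Proof. by move=> h; apply/ler_addgt0Pr. Qed.

(** The error may be a multiple of e, and e may be taken at most 1, which is the
    shape in which the estimates below lose precision. *)
Lemma le_add_epsM (a b c : R) : 0 <= c ->
  (forall e : R, 0 < e -> e <= 1 -> a <= b + e * c) -> a <= b.
Proof.
move=> c0 h; apply: le_add_eps => e e0.
have d0 : 0 < Num.min 1 (e / (c + 1)).
  by rewrite lt_min ltr01 divr_gt0// ltr_wpDl.
apply: le_trans (h _ d0 _) _; first by rewrite ge_min lexx.
rewrite lerD2l; apply: (@le_trans _ _ (e / (c + 1) * (c + 1))).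
  apply: ler_pM => //; first exact: ltW.
    by rewrite ge_min lexx orbT.
  by rewrite lerDl.
by rewrite divfK// gt_eqF// ltr_wpDl.
Qed.

End limits.

(** * Orthogonal projections and the Riesz representation *)

Section projection.
Variables (R : realType) (H : hilbertType R).
Implicit Types (V : set H) (x y z : H) (a : R[i]).

Definition subspace V :=
  V 0 /\ forall a x y, V x -> V y -> V (a *: x + y).

(** A minimizing sequence for the distance to V is Cauchy by the parallelogram
    identity; its limit p minimizes, and moving p along a vector v of V that is
    not orthogonal to f - p would decrease the distance. *)
Lemma projection_ex V : subspace V -> closure V `<=` V -> forall f,
  exists p, V p /\ forall v, V v -> hdot (f - p) v = 0.
Proof.
move=> [V0 VD] cV f.
pose S := [set rnorm (f - v) ^+ 2 | v in V].
have S0 : S !=set0 by exists (rnorm (f - 0) ^+ 2), 0.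
have lbS : has_lbound S by exists 0 => _ [v _ <-]; exact: sqr_ge0.
pose d := inf S.
have dS v : V v -> d <= rnorm (f - v) ^+ 2.
  by move=> Vv; apply: ge_inf => //; exists v.
have minS (n : nat) : exists2 v, V v & rnorm (f - v) ^+ 2 < d + n.+1%:R^-1.
  have [_ [v Vv <-] h] := @inf_adherent _ S n.+1%:R^-1 (ltac:(by rewrite invr_gt0)) (conj S0 lbS).
  by exists v.
pose u n := s2val (cid2 (minS n)).
have uV n : V (u n) by exact: s2valP.
have ud n : rnorm (f - u n) ^+ 2 < d + n.+1%:R^-1 by exact: (s2valP' (cid2 (minS n))).
have uu m n : rnorm (u m - u n) ^+ 2 <= 2 * m.+1%:R^-1 + 2 * n.+1%:R^-1.
  have := parallelogram (f - u m) (f - u n).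
  have -> : f - u m - (f - u n) = u n - u m.
    by rewrite opprB addrC addrA subrK.
  (* the midpoint of u m and u n lies in V, hence not closer to f than d *)
  have -> : f - u m + (f - u n) = 2%:R *: (f - 2%:R^-1 *: (u m + u n)).
    rewrite scalerBr scalerA divff ?pnatr_eq0// scale1r scaler_nat mulr2n opprD.
    by rewrite addrACA.
  have /dS h : V (2%:R^-1 *: (u m + u n)).
    rewrite -[X in V X]addr0; apply: (VD) => //.
    by rewrite -[u m]scale1r; apply: (VD).
  rewrite rnormZ exprMn.
  have -> : rnorm (2%:R : R[i]) = 2.
    by rewrite -(rmorph_nat (real_complex R)) rnorm_real ger0_norm.
  rewrite (rdistC (u n)); have := ud m; have := ud n; move: h.
  move=> h1 h2 h3 h4; move: (n.+1%:R^-1) (m.+1%:R^-1) h2 h3 => b c h2 h3; lra.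
have [p up] : exists p : H, u @ \oo --> p.
  apply: (@hilbert_complete _ _ u) => e e0.
  have e4 : 0 < e ^+ 2 / 4 by rewrite divr_gt0// exprn_gt0.
  have [N _ hN] := near_infty_natSinv_lt (PosNum e4).
  exists N => m n Nm Nn.
  rewrite -(ltr_pXn2r (n := 2))// ?nnegrE ?rnorm_ge0 ?(ltW e0)//.
  apply: le_lt_trans (uu m n) _.
  have /= := hN _ Nm; have /= := hN _ Nn.
  by move: (n.+1%:R^-1) (m.+1%:R^-1) => b c h2 h3; lra.
have Vp : V p.
  apply: cV; apply/closureP => e e0.
  move/rcvgP/cvgrPdist_lt : up => /(_ _ e0)[N _ /(_ N (leqnn _))]/=.
  by rewrite sub0r normrN ger0_norm ?rnorm_ge0// rdistC => h; exists (u N).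
exists p; split => // v Vv.
have pmin : rnorm (f - p) ^+ 2 <= d.
  have d0 : 0 <= d by apply: lb_le_inf => // _ [v' _ <-]; exact: sqr_ge0.
  apply: (@le_add_epsM _ _ _ (2 * d + 6)) => [|e e0 e1].
    by rewrite addr_ge0// mulr_ge0.
  move/rcvgP/cvgrPdist_lt : up => /(_ _ e0)[N1 _ hN1].
  have [N2 _ hN2] := near_infty_natSinv_lt (PosNum e0).
  have /= := hN1 _ (leq_maxl N1 N2); have /= := hN2 _ (leq_maxr N1 N2).
  rewrite sub0r normrN ger0_norm ?rnorm_ge0//; move: (maxn _ _) => n ne une.
  have := ud n; have := rnormD (f - u n) (u n - p); rewrite addrA subrK.
  have := rnorm_ge0 (f - p); have := rnorm_ge0 (f - u n).
  set D := rnorm (f - p); set X := rnorm (f - u n) => X0 D0 DX Xd.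
  have {}DX : D <= X + e by lra.
  have : D ^+ 2 <= (X + e) ^+ 2 by rewrite ler_pXn2r ?nnegrE// addr_ge0// ltW.
  have : e * X <= e * (d + 2) by rewrite ler_pM2l//; move: (n.+1%:R^-1) ne Xd => b ne Xd; nra.
  have : e * e <= e by rewrite ler_piMr// ltW.
  by move: (n.+1%:R^-1) ne Xd => b ne Xd; nra.
set w := f - p; pose c := hdot w v.
(* The step s c along v lowers the squared distance as soon as s |v|^2 <= 1. *)
pose s : R := (rnorm v ^+ 2 + 1)^-1.
have s0 : 0 < s by rewrite invr_gt0 ltr_wpDl// sqr_ge0.
have : d <= rnorm (w - (s%:C%C * c) *: v) ^+ 2.
  rewrite /w -addrA -opprD; apply: dS.
  by rewrite addrC; apply: (VD).
rewrite rnormB_sqr hdotZr rmorphM/= -/c.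
have -> : complex.Re (Num.conj (s%:C%C : R[i]) * Num.conj c * c) = s * rnorm c ^+ 2.
  rewrite -mulrA [_ * c]mulrC mul_conj conjcE conjc_real -rmorphM//.
rewrite rnormZ rnormM rnorm_real (ger0_norm (ltW s0)) => h.
have sv : s * (rnorm v ^+ 2) <= 1.
  by rewrite /s mulrC ler_pdivrMr ?mul1r ?lerDl// ltr_wpDl// sqr_ge0.
have c0 : s * rnorm c ^+ 2 <= 0.
  have : s * rnorm c ^+ 2 * (s * rnorm v ^+ 2) <= s * rnorm c ^+ 2.
    by rewrite ler_piMr// mulr_ge0 ?(ltW s0)// sqr_ge0.
  rewrite -/w in pmin; rewrite !exprMn in h; lra.
apply: rnorm_eq0; apply/eqP; rewrite -sqrf_eq0 eq_le sqr_ge0 andbT.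
by rewrite pmulr_rle0 in c0.
Qed.

End projection.

Section riesz.
Variables (R : realType) (H K : hilbertType R).

(** The kernel of a nonzero bounded functional has a one-dimensional
    complement, spanned by the orthogonal component w of any vector outside of
    it; the representing vector is the multiple of w with the right value. *)
Lemma riesz_representation (l : H -> R[i]) (M : R) :
  (forall a x y, l (a *: x + y) = a * l x + l y) ->
  (forall x, rnorm (l x) <= M * rnorm x) ->
  exists y, forall x, l x = hdot x y.
Proof.
move=> lD lM.
have l0 : l 0 = 0.
  by apply/rnorm_eq0/eqP; rewrite eq_le rnorm_ge0 andbT (le_trans (lM _))// rnorm0 mulr0.
have [kl|] := pselect (forall x, l x = 0).
  by exists 0 => x; rewrite hdot0r kl.
move=> /existsNP[x0 /eqP lx0].
pose V := [set x | l x = 0].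
have sV : subspace V.
  by split => // a x y; rewrite /V/= lD => -> ->; rewrite mulr0 addr0.
have lB x y : l (x - y) = l x - l y.
  by rewrite -scaleN1r addrC lD mulN1r addrC.
have cV : closure V `<=` V.
  move=> x /closureP Vx; apply/rnorm_eq0/eqP; rewrite eq_le rnorm_ge0 andbT.
  apply: (@le_add_epsM _ _ _ `|M|) => // e e0 _; rewrite add0r.
  have [y Vy xy] := Vx _ e0.
  have -> : l x = l (x - y) by rewrite lB Vy subr0.
  apply: le_trans (lM _) _; rewrite mulrC.
  apply: (@le_trans _ _ (rnorm (x - y) * `|M|)).
    by rewrite ler_wpM2l ?rnorm_ge0 ?ler_norm.
  by rewrite ler_wpM2r// ltW.
have [p [Vp pV]] := projection_ex sV cV x0.
pose w := x0 - p.
have lw : l w = l x0 by rewrite lB Vp subr0.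
have lw0 : l w != 0 by rewrite lw.
have w0 : rnorm w != 0.
  by apply: contra_neq lw0 => /rnorm_eq0 ->.
have wc0 : (rnorm w ^+ 2)%:C%C != 0 :> R[i].
  by rewrite -(rmorph0 (real_complex R)) (inj_eq (@complexI R)) expf_neq0.
exists ((Num.conj (l w) / (rnorm w ^+ 2)%:C%C) *: w) => x.
have Vz : V (- (l x / l w) *: w + x).
  by rewrite /V/= lD mulNr divfK// addNr.
have := pV _ Vz; rewrite -/w => /hdotC0; rewrite hdotDl hdotZl hdot_sqr mulNr.
rewrite addrC => /eqP; rewrite subr_eq0 => /eqP xw.
rewrite hdotZr xw rmorphM/= conjCK fmorphV/=.
have -> : Num.conj (rnorm w ^+ 2)%:C%C = (rnorm w ^+ 2)%:C%C :> R[i].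
  exact: conjc_real.
by rewrite mulrC -!mulrA (mulrCA _ (l w)) divff// mulr1 mulVf// mulr1.
Qed.

Lemma bounded_op_ge0 (T : {linear H -> K}) : bounded_op T ->
  exists2 M, 0 <= M & forall x, rnorm (T x) <= M * rnorm x.
Proof.
move=> [M TM]; exists `|M| => // x; apply: le_trans (TM _) _.
by rewrite ler_wpM2r ?rnorm_ge0// ler_norm.
Qed.

Lemma opnorm_ub (T : {linear H -> K}) : bounded_op T ->
  forall x, rnorm (T x) <= opnorm T * rnorm x.
Proof.
move=> /bounded_op_ge0[M M0 TM] x.
have [->|x0] := eqVneq x 0; first by rewrite linear0 !rnorm0 mulr0.
have nx : 0 < rnorm x.
  by rewrite lt_neqAle rnorm_ge0 andbT eq_sym; apply: contra_neq x0 => /rnorm_eq0.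
rewrite -ler_pdivrMr//.
have -> : rnorm (T x) / rnorm x = rnorm (T ((rnorm x)^-1%:C%C *: x)).
  by rewrite linearZ rnormZ rnorm_real gtr0_norm ?invr_gt0// mulrC.
apply: ub_le_sup.
  exists M => _ [y /= y1 <-]; apply: le_trans (TM _) _.
  by rewrite ler_piMr.
exists ((rnorm x)^-1%:C%C *: x) => //=.
by rewrite rnormZ rnorm_real gtr0_norm ?invr_gt0// mulVf// gt_eqF.
Qed.

Lemma opnorm_ge0 (T : {linear H -> K}) : bounded_op T -> 0 <= opnorm T.
Proof.
move=> /bounded_op_ge0[M M0 TM]; apply: ub_le_sup.
  exists M => _ [y /= y1 <-]; apply: le_trans (TM _) _.
  by rewrite ler_piMr.
by exists 0; rewrite /= ?linear0 rnorm0.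
Qed.

Lemma adjoint_ex (T : {linear H -> K}) : bounded_op T ->
  forall g, exists h, forall x, hdot (T x) g = hdot x h.
Proof.
move=> /bounded_op_ge0[M M0 TM] g.
apply: (@riesz_representation (fun x => hdot (T x) g) (M * rnorm g)).
  by move=> a x y; rewrite linearP hdotDl hdotZl.
move=> x; apply: le_trans (hdot_le _ _) _.
by rewrite mulrAC ler_wpM2r ?rnorm_ge0.
Qed.

Lemma bounded_cvg (T : {linear H -> K}) (u : nat -> H) (l : H) :
  bounded_op T -> u @ \oo --> l -> T \o u @ \oo --> T l.
Proof.
move=> /bounded_op_ge0[M M0 TM] /rcvgP ul; apply/rcvgP.
apply: (@squeeze_cvgr _ _ _ _ (cst 0) (fun n => M * rnorm (u n - l))).
- by apply: nearW => n /=; rewrite rnorm_ge0 -linearB TM.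
- exact: cvg_cst.
- by rewrite -(mulr0 M); apply: cvgMr.
Qed.

Lemma pseudo_inverseK (T : {linear H -> K}) : bounded_op T ->
  forall f, range T f -> T (pseudo_inverse T f) = f.
Proof.
move=> /bounded_op_ge0[M M0 TM] f [x _ Tx].
pose V := [set k | T k = 0].
have sV : subspace V.
  split; first by rewrite /V/= linear0.
  by move=> a y z; rewrite /V/= linearP => -> ->; rewrite scaler0 addr0.
have cV : closure V `<=` V.
  move=> y /closureP Vy; apply/rnorm_eq0/eqP; rewrite eq_le rnorm_ge0 andbT.
  apply: (@le_add_epsM _ _ _ M) => // e e0 _; rewrite add0r.
  have [z Vz yz] := Vy _ e0.
  have -> : T y = T (y - z) by rewrite linearB Vz subr0.
  by apply: le_trans (TM _) _; rewrite mulrC ler_wpM2r// ltW.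
have [p [Vp pV]] := projection_ex sV cV x.
rewrite /pseudo_inverse; case: xgetP => [_ _ []//|/(_ (x - p))[]].
by split => [k Vk|]; [exact: pV | rewrite linearB Vp subr0].
Qed.

End riesz.

Section fixed_space.
Variables (R : realType) (H : hilbertType R) (P : R -> {linear H -> H}).
Hypothesis cP : contraction_semigroup P.

Lemma Pinf_spec (f : H) :
  fixed_space P (Pinf P f) /\ forall v, fixed_space P v -> hdot (f - Pinf P f) v = 0.
Proof.
have [_ _ contr _] := cP.
have sV : subspace (fixed_space P).
  split=> [t t0|a x y fx fy t t0]; first by rewrite linear0.
  by rewrite linearP fx// fy.
have cV : closure (fixed_space P) `<=` fixed_space P.
  move=> y /closureP Vy t t0; apply/eqP; rewrite -subr_eq0; apply/eqP.
  apply/rnorm_eq0/eqP; rewrite eq_le rnorm_ge0 andbT.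
  apply: (@le_add_epsM _ _ _ 2) => // e e0 _; rewrite add0r.
  have [z Vz yz] := Vy _ e0.
  have -> : P t y - y = P t (y - z) - (y - z).
    by rewrite linearB Vz// opprB addrA subrK.
  apply: le_trans (rnormB _ _) _; have := contr t (y - z) t0; lra.
rewrite /Pinf /orth_proj; case: xgetP => [p _ //|].
by have [p pV] := projection_ex sV cV f => /(_ p).
Qed.

End fixed_space.

(** * Projection-valued measures *)

Section pvm.
Variables (R : realType) (H : hilbertType R).
Variable E : set (borelC R) -> {linear H -> H}.
Hypothesis pE : projection_valued_measure E.
Implicit Types (B C D : set (borelC R)) (x y : H).

Lemma pvm_adj B x y : measurable B -> hdot (E B x) y = hdot x (E B y).
Proof. by case: pE => h _ _ _; exact: h. Qed.

Lemma pvmI B C x : measurable B -> measurable C ->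
  E (B `&` C) x = E B (E C x).
Proof. by case: pE => _ h _ _; exact: h. Qed.

Lemma pvmT x : E setT x = x.
Proof. by case: pE => _ _ h _; exact: h. Qed.

Lemma pvm_series (B : (set (borelC R))^nat) x :
  (forall i, measurable (B i)) -> trivIset setT B ->
  series (fun i => E (B i) x) @ \oo --> E (\bigcup_i B i) x.
Proof. by case: pE => _ _ _ h; exact: h. Qed.

Lemma pvm_idem B x : measurable B -> E B (E B x) = E B x.
Proof. by move=> mB; rewrite -pvmI// setIid. Qed.

Lemma pvmC B C x : measurable B -> measurable C -> E B (E C x) = E C (E B x).
Proof. by move=> mB mC; rewrite -!pvmI// setIC. Qed.

Lemma pvm_sub B C x : measurable B -> measurable C -> B `<=` C ->
  E B (E C x) = E B x.
Proof. by move=> mB mC BC; rewrite -pvmI// setIidl. Qed.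

Lemma pvm0 x : E set0 x = 0.
Proof.
have tB : trivIset setT (fun _ : nat => set0 : set (borelC R)).
  by apply/trivIsetP => i j _ _ _; rewrite setI0.
have h := @pvm_series _ x (fun=> measurable0) tB.
have /cvg_series_cvg_0 : cvgn (series (fun i : nat => E set0 x)).
  by apply/cvg_ex; exists (E (\bigcup_(_ in [set: nat]) set0) x).
by move/(cvg_lim (@norm_hausdorff _ _)) => <-; rewrite lim_cst//; exact: norm_hausdorff.
Qed.

Lemma pvmU B C x : measurable B -> measurable C -> B `&` C = set0 ->
  E (B `|` C) x = E B x + E C x.
Proof.
move=> mB mC BC.
have mBC i : measurable (bigcup2 B C i) by case: i => [|[|i]]//=; exact: measurable0.
have tBC : trivIset setT (bigcup2 B C) by rewrite -trivIset_bigcup2.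
have := @pvm_series _ x mBC tBC; rewrite bigcup2E.
move/(cvg_lim (@norm_hausdorff _ _)) => <-.
apply: (cvg_lim (@norm_hausdorff _ _)).
rewrite -(cvg_shiftn 2)/=; apply: cvg_near_cst; apply: nearW => n.
rewrite /series/= addnC big_mkord !big_ord_recl/= addrA big1 ?addr0// => i _.
by rewrite pvm0.
Qed.

Lemma pvm_setC B x : measurable B -> E (~` B) x = x - E B x.
Proof.
move=> mB; rewrite -[in X in X - _](pvmT x) -(setUv B) pvmU//.
- by rewrite addrC addKr.
- exact: measurableC.
- exact: setICr.
Qed.

Lemma hdot_pvm B C x y : measurable B -> measurable C ->
  hdot (E B x) (E C y) = hdot (E (B `&` C) x) y.
Proof. by move=> mB mC; rewrite -pvm_adj// -pvmI// setIC. Qed.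

Lemma hdot_pvm1 B x y : measurable B -> hdot (E B x) y = hdot (E B x) (E B y).
Proof. by move=> mB; rewrite hdot_pvm// setIid. Qed.

Lemma pvm_orth B C x y : measurable B -> measurable C -> B `&` C = set0 ->
  hdot (E B x) (E C y) = 0.
Proof. by move=> mB mC BC; rewrite hdot_pvm// BC pvm0 hdot0l. Qed.

Lemma rnorm_pvm_sqr B x : measurable B ->
  rnorm (E B x) ^+ 2 = complex.Re (hdot (E B x) x).
Proof. by move=> mB; rewrite hdot_pvm1// hdot_sqr. Qed.

Lemma rnorm_pvm_le B x : measurable B -> rnorm (E B x) <= rnorm x.
Proof.
move=> mB; rewrite -(ler_pXn2r (n := 2))// ?nnegrE ?rnorm_ge0//.
have := @pythagoras _ _ (E B x) (E (~` B) x).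
rewrite pvm_orth//; [|exact: measurableC|exact: setICr].
rewrite pvm_setC// addrCA subrr addr0 => /(_ erefl) ->.
by rewrite lerDl sqr_ge0.
Qed.

Lemma rnorm_pvmS B C x : measurable B -> measurable C -> B `<=` C ->
  rnorm (E B x) <= rnorm (E C x).
Proof.
by move=> mB mC BC; rewrite -(pvm_sub x mB mC BC); exact: rnorm_pvm_le.
Qed.

Lemma rnorm_pvm_hdot B x y : measurable B ->
  rnorm (hdot (E B x) y) <= rnorm (E B x) * rnorm (E B y).
Proof. by move=> mB; rewrite hdot_pvm1//; exact: hdot_le. Qed.

Lemma pvm_series_sqr (B : (set (borelC R))^nat) x :
  (forall i, measurable (B i)) -> trivIset setT B ->
  (fun n => \sum_(0 <= i < n) rnorm (E (B i) x) ^+ 2) @ \oo -->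
  rnorm (E (\bigcup_i B i) x) ^+ 2.
Proof.
move=> mB tB; have /rcvgP := @pvm_series _ x mB tB.
set l := E _ x; set u := series _ => ul.
have mU : measurable (\bigcup_i B i) by exact: bigcup_measurable.
have uE n : \sum_(0 <= i < n) rnorm (E (B i) x) ^+ 2 = complex.Re (hdot (u n) x).
  rewrite /u /series/= hdot_suml raddf_sum/=.
  by apply: eq_bigr => i _; rewrite rnorm_pvm_sqr.
rewrite rnorm_pvm_sqr// -/l.
apply/subr_cvg0; apply/cvgr0Pnorm_lt => e e0.
have xp : 0 < rnorm x + 1 by rewrite ltr_wpDl// rnorm_ge0.
move/cvgrPdist_lt : ul => /(_ (e / (rnorm x + 1)) (divr_gt0 e0 xp)).
apply: filterS => n; rewrite sub0r normrN ger0_norm ?rnorm_ge0//.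
rewrite ltr_pdivlMr// => h; apply: le_lt_trans h.
rewrite uE -raddfB/= -hdotBl.
apply: le_trans (Re_le_rnorm _) _; apply: le_trans (hdot_le _ _) _.
by rewrite ler_wpM2l ?rnorm_ge0// lerDl.
Qed.

Lemma pvm_series_sqr_le (B : (set (borelC R))^nat) x n :
  (forall i, measurable (B i)) -> trivIset setT B ->
  \sum_(0 <= i < n) rnorm (E (B i) x) ^+ 2 <= rnorm (E (\bigcup_i B i) x) ^+ 2.
Proof.
move=> mB tB; have h := @pvm_series_sqr _ x mB tB; rewrite -(cvg_lim _ h)//.
apply: (@nondecreasing_cvgn_le _ (fun n => \sum_(0 <= i < n) rnorm (E (B i) x) ^+ 2)).
  apply/nondecreasing_seqP => k; rewrite big_nat_recr//= lerDl sqr_ge0//.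
by apply/cvg_ex; eexists; exact: h.
Qed.

(** A bound that holds on each piece of a countable partition holds on the
    union, since the pieces give orthogonal components. *)
Lemma pvm_local_le (B : (set (borelC R))^nat) x y (r : R) :
  (forall i, measurable (B i)) -> trivIset setT B -> 0 <= r ->
  (forall i, rnorm (E (B i) x) <= r * rnorm (E (B i) y)) ->
  rnorm (E (\bigcup_i B i) x) <= r * rnorm (E (\bigcup_i B i) y).
Proof.
move=> mB tB r0 h.
rewrite -(ler_pXn2r (n := 2))// ?nnegrE ?mulr_ge0 ?rnorm_ge0// exprMn.
apply: (le_cst_lim (@pvm_series_sqr _ x mB tB)) => n.
apply: (@le_trans _ _ (r ^+ 2 * \sum_(0 <= i < n) rnorm (E (B i) y) ^+ 2)).
  rewrite mulr_sumr; apply: ler_sum => i _.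
  by rewrite -exprMn ler_pXn2r// nnegrE ?mulr_ge0 ?rnorm_ge0.
by rewrite ler_wpM2l ?sqr_ge0//; exact: pvm_series_sqr_le.
Qed.

(** The finite measure B |-> |E B x|^2. It is set to 0 on the sets that are not
    measurable, where E is arbitrary; the proof argument is what the measure
    structure below is inferred from. *)
Definition pvm_measure & projection_valued_measure E := fun x (B : set (borelC R)) =>
  if pselect (measurable B) then (rnorm (E B x) ^+ 2)%:E else 0%E : \bar R.

Lemma pvm_measureE x B : measurable B -> pvm_measure pE x B = (rnorm (E B x) ^+ 2)%:E.
Proof. by rewrite /pvm_measure; case: pselect. Qed.

Section measure.
Variable x : H.

Let pvm_measure0 : pvm_measure pE x set0 = 0%E.
Proof. by rewrite pvm_measureE// pvm0 rnorm0 expr0n. Qed.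

Let pvm_measure_ge0 B : (0 <= pvm_measure pE x B)%E.
Proof.
rewrite /pvm_measure; case: (pselect _) => [mB|nmB] /=; last exact: lexx.
by rewrite lee_fin sqr_ge0.
Qed.

Let pvm_measure_sigma_additive : semi_sigma_additive (pvm_measure pE x).
Proof.
move=> B mB tB mU; rewrite pvm_measureE//.
rewrite (_ : (fun n => _) = EFin \o (fun n => \sum_(0 <= i < n) rnorm (E (B i) x) ^+ 2)).
  by apply: cvg_comp; [exact: pvm_series_sqr | exact: cvg_id].
apply/funext => n /=; rewrite -sumEFin.
by apply: eq_bigr => i _; rewrite pvm_measureE.
Qed.

HB.instance Definition _ := isMeasure.Build _ _ _ (pvm_measure pE x)
  pvm_measure0 pvm_measure_ge0 pvm_measure_sigma_additive.

Let pvm_measure_fin : fin_num_fun (pvm_measure pE x).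
Proof. by move=> B mB; rewrite pvm_measureE. Qed.

HB.instance Definition _ := Measure_isFinite.Build _ _ _ (pvm_measure pE x)
  pvm_measure_fin.

End measure.

End pvm.

(** * Integrals against signed and complex measures *)

Section raw_integral.
Context d (T : measurableType d) (R : realType).
Local Open Scope ereal_scope.
Import HBNNSimple.

(** Integrals only see the values of the set function on measurable sets, also
    when it is not known to be a measure. *)
Lemma eq_raw_integral (m1 m2 : set T -> \bar R) (D : set T) (f : T -> \bar R) :
  (forall A, measurable A -> m1 A = m2 A) ->
  \int[m1]_(x in D) f x = \int[m2]_(x in D) f x.
Proof.
move=> m12; rewrite /integral.
have sE (h : {nnsfun T >-> R}) : sintegral m1 h = sintegral m2 h.
  by apply: eq_fsbigr => r _; rewrite m12.
congr (ereal_sup _ - ereal_sup _); rewrite eqEsubset;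
  by split => _ [h hf <-]; exists h.
Qed.

End raw_integral.

Section measure_add_measure.
Context d (T : measurableType d) (R : realType).
Variables m1 m2 : {measure set T -> \bar R}.

HB.instance Definition _ := Measure.copy (measure_add m1 m2)
  (msum (fun n => if n is 0%N then m1 else m2) 2).

End measure_add_measure.

Section finite_measure_add.
Context d (T : measurableType d) (R : realType).
Variables m1 m2 : {finite_measure set T -> \bar R}.


Let measure_add_fin : fin_num_fun (measure_add m1 m2).
Proof. by move=> B mB; rewrite measure_addE fin_numD !fin_num_measure. Qed.

HB.instance Definition _ := Measure_isFinite.Build _ _ _ (measure_add m1 m2)
  measure_add_fin.

End finite_measure_add.

Section bounded_integral.
Context d (T : measurableType d) (R : realType).
Implicit Types (m : {finite_measure set T -> \bar R}) (D : set T) (f g : T -> R).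

Definition bounded_on D f := measurable_fun D f /\ exists M, forall x, D x -> `|f x| <= M.

Lemma bounded_integrable m D f : measurable D -> bounded_on D f ->
  m.-integrable D (EFin \o f).
Proof.
move=> mD [mf [M fM]]; apply: measurable_bounded_integrable => //.
  by rewrite -ge0_fin_numE ?fin_num_measure.
exists M; split; first exact: num_real.
by move=> y My x /= Dx; apply: le_trans (fM x Dx) _; exact: ltW.
Qed.

Lemma Rintegral_measure_add m1 m2 D f : measurable D -> bounded_on D f ->
  \int[measure_add m1 m2]_(x in D) f x
  = \int[m1]_(x in D) f x + \int[m2]_(x in D) f x.
Proof.
move=> mD bf.
have i1 := bounded_integrable m1 mD bf; have i2 := bounded_integrable m2 mD bf.

rewrite /Rintegral (integral_measure_add mD i1 i2).
by rewrite fineD//; apply: integrable_fin_num => //; exact: bounded_integrable.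
Qed.

Lemma Rintegral_mscale (k : {nonneg R}) m D f : measurable D -> bounded_on D f ->
  \int[mscale k m]_(x in D) f x = k%:num * \int[m]_(x in D) f x.
Proof.
move=> mD bf; have intf := bounded_integrable m mD bf.
have mf := measurable_int _ intf.
have ip := integrable_pos_fin_num mD intf.
have iN := integrable_neg_fin_num mD intf.
rewrite /Rintegral integralE [in RHS]integralE.
rewrite ge0_integral_mscale//; last exact: measurable_funepos.
rewrite ge0_integral_mscale//; last exact: measurable_funeneg.
rewrite fineB ?fin_numM// [in RHS]fineB//.
by rewrite fineM// fineM// mulrBr.
Qed.

Lemma Rintegral_le_norm m D f (r : R) : measurable D -> measurable_fun D f ->
  (forall x, D x -> `|f x| <= r) ->
  `|\int[m]_(x in D) f x| <= r * fine (m D).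
Proof.
move=> mD mf fr; have bf : bounded_on D f by split => //; exists r.
apply: le_trans (le_normr_Rintegral mD (bounded_integrable _ mD bf)) _.
rewrite -Rintegral_cst//; apply: le_Rintegral => //.
- by apply: integrable_norm; exact: bounded_integrable.
- by apply: bounded_integrable => //; split => //; exists `|r|.
Qed.

End bounded_integral.

Section signed_integral.
Variable R : realType.
Local Notation mC := {finite_measure set (borelC R) -> \bar R}.
Implicit Types (nu : set (borelC R) -> R) (m : mC) (D : set (borelC R))
  (f : borelC R -> R).

Definition represents nu (m1 m2 : mC) :=
  forall B, measurable B -> nu B = fine (m1 B) - fine (m2 B).

Lemma pos_variation_ub nu (m1 m2 : mC) D : represents nu m1 m2 -> measurable D ->
  (pos_variation nu D <= m1 D)%E.
Proof.
move=> nuE mD; apply: ge_ereal_sup => _ [B [mB BD] <-].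
rewrite nuE//; apply: (@le_trans _ _ (m1 B)).
  by rewrite -[leRHS]fineK ?fin_num_measure// lee_fin gerBl// fine_ge0.
by apply: le_measure => //; rewrite inE.
Qed.

Lemma charge_ex nu (m1 m2 : mC) : represents nu m1 m2 ->
  exists c : {charge set (borelC R) -> \bar R},
    forall B, measurable B -> c B = (nu B)%:E.
Proof.
move=> nuE.
pose c1 : {charge set (borelC R) -> \bar R} := charge_of_finite_measure m1.
pose c2 : {charge set (borelC R) -> \bar R} := charge_of_finite_measure m2.
pose c : {charge set (borelC R) -> \bar R} := cadd c1 (cscale (-1) c2).
exists c => B mB; rewrite nuE// EFinB !fineK ?fin_num_measure//.
have -> : c B = (m1 B + cscale (-1) c2 B)%E by [].
by rewrite cscaleN1.
Qed.

(** The supremum defining the positive variation is attained on the positive set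
    of a Hahn decomposition, so that it is the positive part of the Jordan
    decomposition. *)
Lemma jordan_ex nu (m1 m2 : mC) : represents nu m1 m2 ->
  exists Jp Jn : mC, [/\ represents nu Jp Jn,
    forall B, measurable B -> pos_variation nu B = Jp B &
    forall B, measurable B -> pos_variation (fun B => - nu B) B = Jn B].
Proof.
move=> nuE.
have [c cE] := charge_ex nuE.
have [P [N PN]] := Hahn_decomposition c.
have [[mP _] [mN _] _ _] := PN.
pose Jp : mC := jordan_pos PN; pose Jn : mC := jordan_neg PN.
have nuJ : represents nu Jp Jn.
  move=> B mB; apply: EFin_inj; rewrite -cE// EFinB !fineK ?fin_num_measure//.
  have -> : c B = (Jp B + cscale (-1) Jn B)%E by exact: jordan_decomp.
  by rewrite cscaleN1.
have nuJN : represents (fun B => - nu B) Jn Jp.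
  by move=> B mB; rewrite nuJ// opprB.
exists Jp, Jn; split => // B mB; apply/eqP; rewrite eq_le.
- rewrite (pos_variation_ub nuJ)//=; apply: ereal_sup_ubound.
  exists (B `&` P); first by split; [exact: measurableI|exact: subIsetl].
  rewrite -cE; last exact: measurableI.
  by rewrite /Jp jordan_posE cjordan_posE /crestr0 mem_set.
- rewrite (pos_variation_ub nuJN)//=; apply: ereal_sup_ubound.
  exists (B `&` N); first by split; [exact: measurableI|exact: subIsetl].
  rewrite EFinN -cE; last exact: measurableI.
  by rewrite /Jn jordan_negE cjordan_negE /crestr0 mem_set.
Qed.

(** All representations of a signed measure as a difference of two finite
    measures, the Jordan decomposition included, give the same integral. *)
Lemma signed_integralE nu (m1 m2 : mC) D f : represents nu m1 m2 ->
  measurable D -> bounded_on D f ->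
  signed_integral nu D f = \int[m1]_(x in D) f x - \int[m2]_(x in D) f x.
Proof.
move=> nuE mD bf; have [Jp [Jn [nuJ Jp_ Jn_]]] := jordan_ex nuE.
rewrite /signed_integral (eq_raw_integral _ _ Jp_) (eq_raw_integral _ _ Jn_).
rewrite -/(Rintegral Jp D f) -/(Rintegral Jn D f).
have : \int[measure_add Jp m2]_(x in D) f x = \int[measure_add Jn m1]_(x in D) f x.
  congr fine; apply: eq_measure_integral => B mB _. rewrite [LHS]measure_addE [RHS]measure_addE.
  rewrite -[LHS]fineK ?fin_numD ?fin_num_measure//.
  rewrite -[RHS]fineK ?fin_numD ?fin_num_measure//.
  rewrite !fineD ?fin_num_measure//; congr EFin.
  have := nuE _ mB; rewrite (nuJ _ mB); lra.
rewrite !Rintegral_measure_add//; lra.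
Qed.

Lemma eq_signed_integral nu nu' D f :
  (forall B, measurable B -> nu B = nu' B) ->
  signed_integral nu D f = signed_integral nu' D f.
Proof.
move=> h; rewrite /signed_integral; congr (fine _ - fine _);
  apply: eq_raw_integral => A _; congr ereal_sup; rewrite eqEsubset;
  by split => _ [B [mB BA] <-]; exists B => //; rewrite h.
Qed.

(** Both parts of the Jordan decomposition have mass at most K on D, being suprema
    of values of nu and of - nu on subsets. *)
Lemma signed_integral_le nu (m1 m2 : mC) D f (r K : R) : represents nu m1 m2 ->
  measurable D -> measurable_fun D f -> 0 <= r ->
  (forall x, D x -> `|f x| <= r) ->
  (forall B, measurable B -> B `<=` D -> `|nu B| <= K) ->
  `|signed_integral nu D f| <= 2 * r * K.
Proof.
move=> nuE mD mf r0 fr nuK; have [Jp [Jn [nuJ Jp_ Jn_]]] := jordan_ex nuE.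
have bf : bounded_on D f by split => //; exists r.
rewrite (signed_integralE nuJ)//.
have JK (J : mC) (nu' : set (borelC R) -> R) : (pos_variation nu' D = J D) ->
    (forall B, measurable B -> B `<=` D -> nu' B <= K) -> fine (J D) <= K.
  move=> JD h; rewrite -lee_fin fineK ?fin_num_measure// -JD.
  by apply: ge_ereal_sup => _ [B [mB BD] <-]; rewrite lee_fin h.
have KJp : fine (Jp D) <= K.
  apply: (JK _ nu) => [|B mB BD]; first exact: Jp_.
  by apply: le_trans (nuK _ mB BD); exact: ler_norm.
have KJn : fine (Jn D) <= K.
  apply: (JK _ (fun B => - nu B)) => [|B mB BD]; first exact: Jn_.
  by apply: le_trans (nuK _ mB BD); rewrite -normrN; exact: ler_norm.
apply: le_trans (ler_normB _ _) _.
have := Rintegral_le_norm Jp mD mf fr; have := Rintegral_le_norm Jn mD mf fr.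
have := ler_wpM2l r0 KJp; have := ler_wpM2l r0 KJn; lra.
Qed.

Lemma signed_integral_comb nu1 nu2 m1 m1' m2 m2' D f (a : R) :
  represents nu1 m1 m1' -> represents nu2 m2 m2' ->
  measurable D -> bounded_on D f ->
  (exists m m', represents (fun B => a * nu1 B + nu2 B) m m') /\
  signed_integral (fun B => a * nu1 B + nu2 B) D f
  = a * signed_integral nu1 D f + signed_integral nu2 D f.
Proof.
move=> h1 h2 mD bf.
pose k : {nonneg R} := NngNum (normr_ge0 a).
have kE (m : mC) B : measurable B -> fine (mscale k m B) = `|a| * fine (m B).
  by move=> mB; rewrite /mscale fineM// fin_num_measure.
have addE (m m' : mC) B : measurable B ->
    fine (measure_add m m' B) = fine (m B) + fine (m' B).
  by move=> mB; rewrite [measure_add _ _ _]measure_addE fineD// fin_num_measure.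
have [a0|a0] := leP 0 a.
  have rep : represents (fun B => a * nu1 B + nu2 B)
      (measure_add (mscale k m1) m2) (measure_add (mscale k m1') m2').
    move=> B mB; rewrite h1// h2// !addE//.
    rewrite !kE// ger0_norm//; lra.
  split; first by eexists; eexists; exact: rep.
  rewrite (signed_integralE rep)// (signed_integralE h1)// (signed_integralE h2)//.
  rewrite !Rintegral_measure_add// !Rintegral_mscale//= ger0_norm//; lra.
have rep : represents (fun B => a * nu1 B + nu2 B)
    (measure_add (mscale k m1') m2) (measure_add (mscale k m1) m2').
  move=> B mB; rewrite h1// h2// !addE//.
  rewrite !kE// ltr0_norm//; lra.
split; first by eexists; eexists; exact: rep.
rewrite (signed_integralE rep)// (signed_integralE h1)// (signed_integralE h2)//.
rewrite !Rintegral_measure_add// !Rintegral_mscale//= ltr0_norm//; lra.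
Qed.

End signed_integral.

(** * Borel sets and functions of the complex plane *)

Section borel_complex.
Variable R : realType.
Implicit Types (z w c : R[i]).

Lemma open_rnormP (O : set (R[i])^o) : open O <->
  forall z, O z -> exists2 e : R, 0 < e & forall w, rnorm (z - w) < e -> O w.
Proof.
split.
  rewrite openE => oO z /oO /nbhs_ballP[e /= e0 eO].
  have eE : e = (complex.Re e)%:C%C by rewrite RRe_real// gtr0_real.
  rewrite eE ltcR in e0; exists (complex.Re e) => // w zw.
  by apply: eO; rewrite eE; apply/rnorm_ball.
move=> h; rewrite openE => z /h[e e0 eO]; apply/nbhs_ballP.
exists e%:C%C; first by rewrite /= ltcR.
by move=> w /rnorm_ball /eO.
Qed.

Lemma open_measurableC (O : set (borelC R)) : open (O : set (R[i])^o) -> measurable O.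
Proof. by move=> oO; exact: sub_sigma_algebra. Qed.

Definition rball c (r : R) : set (borelC R) := [set z : R[i] | rnorm (z - c) < r].

Lemma open_rball c r : open (rball c r : set (R[i])^o).
Proof.
apply/open_rnormP => z zr; exists (r - rnorm (z - c)); first by rewrite subr_gt0.
move=> w zw; rewrite /rball/=; have := rnormD (w - z) (z - c).
rewrite addrA subrK (rdistC w z); move: zr zw; rewrite /rball/=.
move: (rnorm (w - c)) (rnorm (z - w)) (rnorm (z - c)) => a b d; lra.
Qed.

Lemma measurable_rball c r : measurable (rball c r).
Proof. by apply: open_measurableC; exact: open_rball. Qed.

Definition dense_seq (n : nat) : R[i] :=
  if unpickle n is Some pq then (ratr pq.1 +i* ratr (pq.2 : rat))%C else 0.

Lemma dense_seqP z (e : R) : 0 < e -> exists n, rnorm (z - dense_seq n) < e.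
Proof.
move=> e0; have e2 : 0 < e / 2 by rewrite divr_gt0.
have [p] := @rat_in_itvoo R (complex.Re z - e / 2) (complex.Re z + e / 2) (ltac:(lra)).
have [q] := @rat_in_itvoo R (complex.Im z - e / 2) (complex.Im z + e / 2) (ltac:(lra)).
rewrite !in_itv/= => /andP[q1 q2] /andP[p1 p2].
exists (pickle (p, q)); rewrite /dense_seq pickleK/=.
apply: le_lt_trans (rnorm_le_ReIm _) _; case: z q1 q2 p1 p2 => a b /= q1 q2 p1 p2.
have : `|a - ratr p| < e / 2 by rewrite ltr_norml; apply/andP; split; lra.
have : `|b - ratr q| < e / 2 by rewrite ltr_norml; apply/andP; split; lra.
lra.
Qed.

Lemma continuous_measurableC (f : R[i] -> R) :
  (forall z w, `|f z - f w| <= rnorm (z - w)) ->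
  measurable_fun setT (f : borelC R -> R).
Proof.
move=> fl; apply: (measurability _ (RGenOInfty.measurableE R)) => _ [_ [a ->] <-].
rewrite setTI; apply: open_measurableC; apply/open_rnormP => z /=.
rewrite in_itv/= andbT => az; exists (f z - a); first by rewrite subr_gt0.
move=> w zw; rewrite in_itv/= andbT.
by have := fl z w; have := ler_norm (f z - f w); lra.
Qed.

Lemma measurable_Re : measurable_fun setT (@complex.Re R : borelC R -> R).
Proof. by apply: continuous_measurableC => z w; rewrite -raddfB; exact: Re_le_rnorm. Qed.

Lemma measurable_Im : measurable_fun setT (@complex.Im R : borelC R -> R).
Proof. by apply: continuous_measurableC => z w; rewrite -raddfB; exact: Im_le_rnorm. Qed.

(** An open set is a countable union of balls with centers in a countable dense
    set, and the preimage of a ball is given by an inequality between the real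
    and imaginary parts. *)
Lemma measurable_funC d (T : measurableType d) (D : set T) (f : T -> borelC R) :
  measurable_fun D (fun x => complex.Re (f x)) ->
  measurable_fun D (fun x => complex.Im (f x)) ->
  measurable_fun D f.
Proof.
move=> mRe mIm mD.
have mball c r : measurable (D `&` f @^-1` rball c r).
  have -> : D `&` f @^-1` rball c r = D `&`
      (fun x => (complex.Re (f x) - complex.Re c) ^+ 2 +
                (complex.Im (f x) - complex.Im c) ^+ 2) @^-1` `]-oo, (Num.max 0 r ^+ 2)[.
    apply/seteqP; split => x [Dx]; rewrite /rball/= in_itv/= => h; split => //;
      move: h; rewrite -!raddfB/= -rnorm_sqr ltr_pXn2r ?nnegrE ?rnorm_ge0 ?le_max ?lexx//
        lt_max ltNge rnorm_ge0//.
  have : measurable_fun D (fun x => (complex.Re (f x) - complex.Re c) ^+ 2 +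
                (complex.Im (f x) - complex.Im c) ^+ 2).
    apply: measurable_funD; apply: measurable_funX; apply: measurable_funB => //;
      exact: measurable_cst.
  by move/(_ mD); apply; exact: measurable_itv.
apply: (@measurability _ _ T (borelC R) D f (@open (R[i])^o) erefl) => // _ [ O oO <-].
pose B (n k : nat) : set (borelC R) :=
  if pselect (rball (dense_seq n) k.+1%:R^-1 `<=` O) then rball (dense_seq n) k.+1%:R^-1
  else set0.
have -> : O = \bigcup_n \bigcup_k B n k.
  apply/seteqP; split => [z Oz|z [n _ [k _]]]; last first.
    by rewrite /B; case: (pselect _) => [h /h|].
  move/open_rnormP : oO => /(_ _ Oz)[e e0 eO].
  have e2 : 0 < e / 2 by rewrite divr_gt0.
  have [k _ hk] := near_infty_natSinv_lt (PosNum e2).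
  have := hk k (leqnn _) => /= ke.
  have [n zn] := @dense_seqP z k.+1%:R^-1 (ltac:(by rewrite invr_gt0)).
  exists n => //; exists k => //; rewrite /B; case: (pselect _) => [?|[]].
    by rewrite /rball/=.
  move=> w; rewrite /rball/= => wn; apply: eO.
  have := rnormB (z - dense_seq n) (w - dense_seq n).
  rewrite opprB addrA subrK; move: (k.+1%:R^-1) ke zn wn => b; lra.
rewrite preimage_bigcup setI_bigcupr; apply: bigcup_measurable => n _.
rewrite preimage_bigcup setI_bigcupr; apply: bigcup_measurable => k _.
rewrite /B; case: (pselect _) => [?|?]; first exact: mball.
by rewrite preimage_set0 setI0.
Qed.

Lemma measurable_fun_rball d (T : measurableType d) (D : set T) (f : T -> borelC R) c r :
  measurable D -> measurable_fun D f -> measurable (D `&` f @^-1` rball c r).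
Proof. by move=> mD mf; apply: mf => //; exact: measurable_rball. Qed.

(** Every measurable set splits into countably many measurable pieces on which
    a given measurable function oscillates by less than e. *)
Lemma small_partition (D B : set (borelC R)) (phi : R[i] -> R[i]) (e : R) :
  measurable B -> B `<=` D -> measurable D ->
  measurable_fun D (phi : borelC R -> borelC R) -> 0 < e ->
  exists F : (set (borelC R))^nat, [/\ forall i, measurable (F i), trivIset setT F,
    \bigcup_i F i = B &
    forall i z w, F i z -> F i w -> rnorm (phi z - phi w) < e].
Proof.
move=> mB BD mD mphi e0; have e2 : 0 < e / 2 by rewrite divr_gt0.
pose G n := B `&` phi @^-1` rball (dense_seq n) (e / 2).
have mG n : measurable (G n).
  apply: measurable_fun_rball => //.
  exact: measurable_funS mphi.
exists (seqDU G); split.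
- by move=> i; apply: measurableD => //; exact: bigsetU_measurable.
- exact: trivIset_seqDU.
- rewrite -seqDU_bigcup_eq; apply/seteqP; split => [z [n _ []]//|z Bz].
  by have [n hn] := dense_seqP (phi z) e2; exists n.
- move=> i z w Fz Fw.
  have [_ hz] := subset_seqDU Fz; have [_ hw] := subset_seqDU Fw.
  have := rnormB (phi z - dense_seq i) (phi w - dense_seq i).
  move: hz hw; rewrite opprB addrA subrK /rball/=; lra.
Qed.

End borel_complex.

(** * Linearity and bounds for complex integrals *)

Section complex_integral.
Variable R : realType.
Local Notation mC := {finite_measure set (borelC R) -> \bar R}.
Implicit Types (nu : set (borelC R) -> R) (mu : set (borelC R) -> R[i])
  (D B : set (borelC R)) (f : borelC R -> R) (phi : R[i] -> R[i]).

Definition representable nu := exists m1 m2 : mC, represents nu m1 m2.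

Definition crepresentable mu :=
  representable (fun B => complex.Re (mu B)) /\
  representable (fun B => complex.Im (mu B)).

Lemma Linfty_Re D phi : measurable D -> Linfty D phi ->
  bounded_on D (fun z => complex.Re (phi z) : R).
Proof.
move=> mD [mphi [M phiM]]; split.
  exact: (measurableT_comp (@measurable_Re R) mphi).
by exists M => z /phiM; apply: le_trans; exact: Re_le_rnorm.
Qed.

Lemma Linfty_Im D phi : measurable D -> Linfty D phi ->
  bounded_on D (fun z => complex.Im (phi z) : R).
Proof.
move=> mD [mphi [M phiM]]; split.
  exact: (measurableT_comp (@measurable_Im R) mphi).
by exists M => z /phiM; apply: le_trans; exact: Im_le_rnorm.
Qed.

Lemma complex_integral_comb mu1 mu2 (a : R[i]) D phi :
  crepresentable mu1 -> crepresentable mu2 -> measurable D -> Linfty D phi ->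
  complex_integral (fun B => a * mu1 B + mu2 B) D phi
  = a * complex_integral mu1 D phi + complex_integral mu2 D phi.
Proof.
move=> [[m1 [m1' h1]] [m2 [m2' h2]]] [[m3 [m3' h3]] [m4 [m4' h4]]] mD Lphi.
have bRe := Linfty_Re mD Lphi; have bIm := Linfty_Im mD Lphi.
case: a => a b; rewrite /complex_integral.
have ReE : (fun B => complex.Re ((a +i* b)%C * mu1 B + mu2 B)) =
    (fun B => a * complex.Re (mu1 B) + (- b * complex.Im (mu1 B) + complex.Re (mu2 B))).
  by apply/funext => B; case: (mu1 B) (mu2 B) => [p q] [p' q'] /=; lra.
have ImE : (fun B => complex.Im ((a +i* b)%C * mu1 B + mu2 B)) =
    (fun B => a * complex.Im (mu1 B) + (b * complex.Re (mu1 B) + complex.Im (mu2 B))).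
  by apply/funext => B; case: (mu1 B) (mu2 B) => [p q] [p' q'] /=; lra.
rewrite ReE ImE.
have comb f : bounded_on D f ->
    signed_integral (fun B => a * complex.Re (mu1 B) + (- b * complex.Im (mu1 B) + complex.Re (mu2 B))) D f
    = a * signed_integral (fun B => complex.Re (mu1 B)) D f +
      (- b * signed_integral (fun B => complex.Im (mu1 B)) D f +
       signed_integral (fun B => complex.Re (mu2 B)) D f).
  move=> bf; have [[n [n' rn]] e1] := signed_integral_comb (- b) h2 h3 mD bf.
  by have [_ ->] := signed_integral_comb a h1 rn mD bf; rewrite e1.
have comb' f : bounded_on D f ->
    signed_integral (fun B => a * complex.Im (mu1 B) + (b * complex.Re (mu1 B) + complex.Im (mu2 B))) D f
    = a * signed_integral (fun B => complex.Im (mu1 B)) D f +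
      (b * signed_integral (fun B => complex.Re (mu1 B)) D f +
       signed_integral (fun B => complex.Im (mu2 B)) D f).
  move=> bf; have [[n [n' rn]] e1] := signed_integral_comb b h1 h4 mD bf.
  by have [_ ->] := signed_integral_comb a h2 rn mD bf; rewrite e1.
rewrite !comb// !comb'//; apply/eqP; rewrite eq_complex/=.
by apply/andP; split; apply/eqP; ring.
Qed.

Lemma eq_complex_integral mu mu' D phi :
  (forall B, measurable B -> mu B = mu' B) ->
  complex_integral mu D phi = complex_integral mu' D phi.
Proof.
move=> h; rewrite /complex_integral; congr (_ +i* _)%C;
  by congr (_ + _); [|try congr (- _)]; apply: eq_signed_integral => B mB; rewrite h.
Qed.

Lemma signed_integral_subcst nu D f (k : R) : representable nu ->
  measurable D -> bounded_on D f ->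
  signed_integral nu D (fun x => f x - k) = signed_integral nu D f - k * nu D.
Proof.
move=> [m1 [m2 nuE]] mD bf.
have bk : bounded_on D (cst k) by split; [exact: measurable_cst|exists `|k|].
have bfk : bounded_on D (fun x => f x - k).
  case: bf => mf [M fM]; split; first exact: measurable_funB.
  by exists (M + `|k|) => x Dx; rewrite (le_trans (ler_normB _ _))// lerD2r fM.
rewrite !(signed_integralE nuE)// !RintegralB//; try exact: bounded_integrable.
by rewrite !Rintegral_cst// nuE//; lra.
Qed.

Lemma complex_integral_subcst mu D phi (c : R[i]) : crepresentable mu ->
  measurable D -> Linfty D phi ->
  complex_integral mu D (fun z => phi z - c) = complex_integral mu D phi - c * mu D.
Proof.
move=> [rRe rIm] mD Lphi.
have bRe := Linfty_Re mD Lphi; have bIm := Linfty_Im mD Lphi.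
rewrite /complex_integral.
have -> : (fun z => complex.Re (phi z - c)) = (fun z => complex.Re (phi z) - complex.Re c).
  by apply/funext => z; rewrite raddfB.
have -> : (fun z => complex.Im (phi z - c)) = (fun z => complex.Im (phi z) - complex.Im c).
  by apply/funext => z; rewrite raddfB.
rewrite !signed_integral_subcst//; apply/eqP; rewrite eq_complex/=.
by case: c (mu D) => [p q] [p' q'] /=; apply/andP; split; apply/eqP; ring.
Qed.

Lemma complex_integral_le mu D phi (r K : R) : crepresentable mu ->
  measurable D -> measurable_fun D (phi : borelC R -> borelC R) -> 0 <= r ->
  (forall z, D z -> rnorm (phi z) <= r) ->
  (forall B, measurable B -> B `<=` D -> rnorm (mu B) <= K) ->
  rnorm (complex_integral mu D phi) <= 8 * r * K.
Proof.
move=> [[m1 [m1' h1]] [m2 [m2' h2]]] mD mphi r0 phir muK.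
have Lphi : Linfty D phi by split => //; exists r.
have [mRe _] := Linfty_Re mD Lphi; have [mIm _] := Linfty_Im mD Lphi.
have Rer z : D z -> `|complex.Re (phi z)| <= r.
  by move=> Dz; apply: le_trans (Re_le_rnorm _) (phir _ Dz).
have Imr z : D z -> `|complex.Im (phi z)| <= r.
  by move=> Dz; apply: le_trans (Im_le_rnorm _) (phir _ Dz).
have ReK B : measurable B -> B `<=` D -> `|complex.Re (mu B)| <= K.
  by move=> mB BD; apply: le_trans (Re_le_rnorm _) (muK _ mB BD).
have ImK B : measurable B -> B `<=` D -> `|complex.Im (mu B)| <= K.
  by move=> mB BD; apply: le_trans (Im_le_rnorm _) (muK _ mB BD).
apply: le_trans (rnorm_le_ReIm _) _; rewrite /complex_integral/=.
apply: le_trans (lerD (ler_normB _ _) (ler_normD _ _)) _.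
have := signed_integral_le h1 mD mRe r0 Rer ReK.
have := signed_integral_le h1 mD mIm r0 Imr ReK.
have := signed_integral_le h2 mD mRe r0 Rer ImK.
have := signed_integral_le h2 mD mIm r0 Imr ImK.
lra.
Qed.

(** A signed measure concentrated on B is integrated over B only; the integrand
    may be unbounded elsewhere. *)
Lemma signed_integral_restr nu nu' D B f : representable nu' ->
  representable nu ->
  (forall C, measurable C -> nu' C = nu (C `&` B)) ->
  measurable D -> measurable B -> measurable_fun D f -> bounded_on (D `&` B) f ->
  signed_integral nu' D f = signed_integral nu (D `&` B) f.
Proof.
move=> [m1 [m1' h1]] [m2 [m2' h2]] nuE mD mB mf bf.
have [Jp' [Jn' [_ Jp'_ Jn'_]]] := jordan_ex h1.
have [Jp [Jn [_ Jp_ Jn_]]] := jordan_ex h2.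
have mDB : measurable (D `&` B) by exact: measurableI.
rewrite /signed_integral (eq_raw_integral _ _ Jp'_) (eq_raw_integral _ _ Jn'_).
rewrite (eq_raw_integral _ _ Jp_) (eq_raw_integral _ _ Jn_).
have key (J' J : mC) (n n' : set (borelC R) -> R) :
    (forall C, measurable C -> n' C = n (C `&` B)) ->
    (forall C, measurable C -> pos_variation n' C = J' C) ->
    (forall C, measurable C -> pos_variation n C = J C) ->
    (\int[J']_(x in D) (f x)%:E = \int[J]_(x in D `&` B) (f x)%:E)%E.
  move=> nE J'_ J_.
  have JE C : measurable C -> J' C = J (C `&` B).
    move=> mC; rewrite -J'_// -J_//; last exact: measurableI.
    congr ereal_sup; rewrite eqEsubset; split => _ [A [mA AC] <-].
      exists (A `&` B); last by rewrite nE.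
      by split; [exact: measurableI|move=> z [/AC]].
    exists A; first by split => // z /AC[].
    by rewrite nE//; congr (n _)%:E; rewrite setIidl// => z /AC[].
  have mN : measurable (D `\` B) by exact: measurableD.
  have N0 : J' (D `\` B) = 0%E by rewrite JE// setDE -setIA setICl setI0 measure0.
  have DN : D `\` (D `\` B) = D `&` B by rewrite setDD.
  have i' : J'.-integrable D (EFin \o f).
    apply/(negligible_integrable mN) => //.
    - by apply/measurable_EFinP.
    - by rewrite DN; exact: bounded_integrable.
  rewrite (negligible_integral mN)// DN.
  apply: eq_measure_integral => A mA ADB.
  by rewrite [LHS]JE// setIidl// => z /ADB[].
congr (fine _ - fine _); first exact: key Jp'_ Jp_.
by apply: key Jn'_ Jn_ => C mC; rewrite nuE.
Qed.

End complex_integral.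

(** * Integrals against the spectral measure *)

Section pvm.
Variables (R : realType) (H : hilbertType R).
Variable E : set (borelC R) -> {linear H -> H}.
Hypothesis pE : projection_valued_measure E.
Implicit Types (B C D : set (borelC R)) (x y : H).

(** By polarization; multiplying g by i exchanges real and imaginary parts. *)
Lemma pvm_crepresentable x g : crepresentable (fun B => hdot (E B x) g).
Proof.
have q0 : 0 <= (4^-1 : R) by rewrite invr_ge0.
pose q := NngNum q0.
have rep u v : representable (fun B => complex.Re (hdot (E B u) v)).
  exists (mscale q (pvm_measure pE (u + v))), (mscale q (pvm_measure pE (u - v))).
  have mE w B : measurable B -> fine (mscale q (pvm_measure pE w) B) = 4^-1 * rnorm (E B w) ^+ 2.
    move=> mB; transitivity (fine (4^-1%:E * pvm_measure pE w B)%E) => //.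
    by rewrite pvm_measureE.
  move=> B mB; rewrite !mE// (hdot_pvm1 pE)// polarization.
  by rewrite linearD linearB ![4^-1 * _]mulrC.
split; first exact: rep.
have [m1 [m2 h]] := rep x ('i%C *: g).
by exists m1, m2 => B mB; rewrite -h// Im_hdot.
Qed.

Local Notation pint x g D phi :=
  (complex_integral (fun B => hdot (E B x) g) D phi).

Lemma pint_lel x y (a : R[i]) g D phi : measurable D -> Linfty D phi ->
  pint (a *: x + y) g D phi = a * pint x g D phi + pint y g D phi.
Proof.
move=> mD Lphi; rewrite -complex_integral_comb//; try exact: pvm_crepresentable.
by apply: eq_complex_integral => B mB; rewrite linearP hdotDl hdotZl.
Qed.

Lemma pint_linr x y (a : R[i]) g D phi : measurable D -> Linfty D phi ->
  pint g (a *: x + y) D phi = Num.conj a * pint g x D phi + pint g y D phi.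
Proof.
move=> mD Lphi; rewrite -complex_integral_comb//; try exact: pvm_crepresentable.
by apply: eq_complex_integral => B mB; rewrite hdotDr hdotZr.
Qed.

Lemma pint_le x g D phi (r : R) : measurable D ->
  measurable_fun D (phi : borelC R -> borelC R) -> 0 <= r ->
  (forall z, D z -> rnorm (phi z) <= r) ->
  rnorm (pint x g D phi) <= 8 * r * (rnorm (E D x) * rnorm (E D g)).
Proof.
move=> mD mphi r0 phir; apply: complex_integral_le => //.
  exact: pvm_crepresentable.
move=> B mB BD; apply: le_trans (rnorm_pvm_hdot pE _ _ mB) _.
by apply: ler_pM; rewrite ?rnorm_ge0//; exact: (rnorm_pvmS pE).
Qed.

Lemma pint_restr x g x' g' D B phi :
  (forall C, measurable C -> hdot (E C x') g' = hdot (E (C `&` B) x) g) ->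
  measurable D -> measurable B ->
  measurable_fun D (phi : borelC R -> borelC R) -> Linfty (D `&` B) phi ->
  pint x' g' D phi = pint x g (D `&` B) phi.
Proof.
move=> h mD mB mphi Lphi; have mDB : measurable (D `&` B) by exact: measurableI.
have bRe := Linfty_Re mDB Lphi; have bIm := Linfty_Im mDB Lphi.
have mRe := measurableT_comp (@measurable_Re R) mphi.
have mIm := measurableT_comp (@measurable_Im R) mphi.
have [rRe rIm] := pvm_crepresentable x g; have [rRe' rIm'] := pvm_crepresentable x' g'.
have hRe C : measurable C -> complex.Re (hdot (E C x') g') = complex.Re (hdot (E (C `&` B) x) g).
  by move=> mC; rewrite h.
have hIm C : measurable C -> complex.Im (hdot (E C x') g') = complex.Im (hdot (E (C `&` B) x) g).
  by move=> mC; rewrite h.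
rewrite /complex_integral.
rewrite (signed_integral_restr rRe' rRe hRe mD mB mRe bRe).
rewrite (signed_integral_restr rRe' rRe hRe mD mB mIm bIm).
rewrite (signed_integral_restr rIm' rIm hIm mD mB mRe bRe).
by rewrite (signed_integral_restr rIm' rIm hIm mD mB mIm bIm).
Qed.

Lemma LinftyS D B phi : measurable D -> B `<=` D -> Linfty D phi -> Linfty B phi.
Proof.
move=> mD BD [mphi [M phiM]]; split; first exact: measurable_funS mphi.
by exists M => z /BD /phiM.
Qed.

(** The constant 8 counts the four signed integrals and their two Jordan parts;
    it disappears when B is cut into small pieces, see [op_integral_sym]. *)
Lemma op_integral_le D phi x y : measurable D -> Linfty D phi ->
  op_integral (fun B => E B) D phi x y ->
  forall B c r, measurable B -> B `<=` D -> 0 <= r ->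
  (forall z, B z -> rnorm (phi z - c) <= r) ->
  rnorm (E B y - c *: E B x) <= 8 * r * rnorm (E B x).
Proof.
move=> mD Lphi yE B c r mB BD r0 phic.
have LB := LinftyS mD BD Lphi.
apply: rnorm_le_hdot => [|g]; first by rewrite !mulr_ge0// rnorm_ge0.
have -> : hdot (E B y - c *: E B x) g = pint x g B (fun z => phi z - c).
  rewrite complex_integral_subcst//; last exact: pvm_crepresentable.
  rewrite hdotBl hdotZl; congr (_ - _).
  rewrite (pvm_adj pE)// yE (pint_restr (x := x) (g := g) (B := B)) ?setIidr//.
  - by move=> C mC; rewrite -(pvm_adj pE)// -(pvmI pE)// setIC.
  - by case: Lphi.
apply: le_trans (pint_le x g mB _ r0 phic) _.
  have [mphi _] := LB; have : measurable_fun B (fun z : borelC R => phi z - c : borelC R).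
    apply: measurable_funC.
      under eq_fun do rewrite raddfB/=.
      apply: measurable_funB; last exact: measurable_cst.
      exact: (measurableT_comp (@measurable_Re R) mphi).
    under eq_fun do rewrite raddfB/=.
    apply: measurable_funB; last exact: measurable_cst.
    exact: (measurableT_comp (@measurable_Im R) mphi).
  by [].
rewrite mulrA ler_wpM2l//; last exact: (rnorm_pvm_le pE).
by rewrite !mulr_ge0// rnorm_ge0.
Qed.

End pvm.

(** * Multiplication by a function as a local relation *)

Section pvm.
Variables (R : realType) (H : hilbertType R).
Variable E : set (borelC R) -> {linear H -> H}.
Hypothesis pE : projection_valued_measure E.
Implicit Types (B C D : set (borelC R)) (x y : H).

Local Notation pint x g D phi :=
  (complex_integral (fun B => hdot (E B x) g) D phi).

(** An estimate that holds up to an error e K on pieces where phi oscillates by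
    less than e holds without error on the whole set. *)
Lemma pvm_local D B (phi : R[i] -> R[i]) (u w : H) (r K : R) :
  measurable D -> measurable_fun D (phi : borelC R -> borelC R) ->
  measurable B -> B `<=` D -> 0 <= r -> 0 <= K ->
  (forall e F z, 0 < e -> e <= 1 -> measurable F -> F `<=` B -> F z ->
    (forall v, F v -> rnorm (phi v - phi z) <= e) ->
    rnorm (E F u) <= (r + e * K) * rnorm (E F w)) ->
  rnorm (E B u) <= r * rnorm (E B w).
Proof.
move=> mD mphi mB BD r0 K0 h.
apply: (@le_add_epsM _ _ _ (K * rnorm (E B w))) => [|e e0 e1].
  by rewrite mulr_ge0// rnorm_ge0.
rewrite mulrA -mulrDl.
have [F [mF tF FB Fe]] := small_partition mB BD mD mphi e0.
rewrite -FB; apply: (pvm_local_le pE) => // [|i].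
  by rewrite addr_ge0// mulr_ge0// ltW.
have [->|/set0P[z Fz]] := eqVneq (F i) set0.
  by rewrite !(pvm0 pE) rnorm0 mulr0.
apply: (h _ _ z) => //; first by rewrite -FB; exact: bigcup_sup.
by move=> v Fv; apply/ltW/(Fe i).
Qed.

(** [symbol phi D x y]: the vector y is the image of x under multiplication by phi
    on the spectral subspace of D. It is stated by local estimates, without
    integrals, so that it makes sense for unbounded phi. *)
Definition symbol (phi : R[i] -> R[i]) D x y :=
  forall B, measurable B -> B `<=` D -> forall (c : R[i]) (r : R), 0 <= r ->
    (forall z, B z -> rnorm (phi z - c) <= r) ->
    rnorm (E B y - c *: E B x) <= r * rnorm (E B x).

Lemma sym_le phi D x y (r : R) : measurable D -> symbol phi D x y -> 0 <= r ->
  (forall z, D z -> rnorm (phi z) <= r) -> rnorm (E D y) <= r * rnorm (E D x).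
Proof.
move=> mD xy r0 h; have := @xy D mD (@subset_refl _ D) 0 r r0.
by rewrite scale0r subr0; apply => z Dz; rewrite subr0 h.
Qed.

Lemma sym_pvm phi D x y C : measurable C -> measurable D ->
  symbol phi D x y -> symbol phi D (E C x) (E C y).
Proof.
move=> mC mD xy B mB BD c r r0 h; rewrite -!(pvmI pE)//.
apply: xy => //; first exact: measurableI.
  by move=> z [/BD].
by move=> z [/h].
Qed.

Lemma symS phi D B x y : B `<=` D -> symbol phi D x y -> symbol phi B x y.
Proof. by move=> BD xy C mC CB; apply: xy => // z /CB /BD. Qed.

Lemma sym_ext phi psi D x y : (forall z, D z -> phi z = psi z) ->
  symbol phi D x y -> symbol psi D x y.
Proof.
move=> e xy B mB BD c r r0 h; apply: xy => // z Bz.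
by rewrite e ?h//; exact: BD.
Qed.

Lemma sym_shift phi D x y (k : R[i]) :
  symbol phi D x y -> symbol (fun z => phi z - k) D x (y - k *: x).
Proof.
move=> xy B mB BD c r r0 h.
rewrite linearB linearZ/= -addrA -opprD -scalerDl; apply: xy => // z /h.
by rewrite -addrA -opprD.
Qed.

Lemma sym_cst D x (k : R[i]) : measurable D -> symbol (cst k) D x (k *: x).
Proof.
move=> mD B mB BD c r r0 h.
have [->|/set0P[z /h kr]] := eqVneq B set0.
  by rewrite !(pvm0 pE) scaler0 subr0 !rnorm0 mulr0.
by rewrite linearZ/= -scalerBl rnormZ ler_wpM2r// rnorm_ge0.
Qed.

Lemma sym_uniq phi D x y y' : measurable D ->
  measurable_fun D (phi : borelC R -> borelC R) ->
  symbol phi D x y -> symbol phi D x y' -> E D y = E D y'.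
Proof.
move=> mD mphi xy xy'; apply/eqP; rewrite -subr_eq0 -linearB; apply/eqP/rnorm_eq0.
apply/eqP; rewrite eq_le rnorm_ge0 andbT -(mul0r (rnorm (E D x))).
apply: (pvm_local mD mphi mD _ _ (ler0n _ 2)) => // e F z e0 e1 mF FD Fz Fe.
have h := xy F mF FD _ _ (ltW e0) Fe; have h' := xy' F mF FD _ _ (ltW e0) Fe.
rewrite linearB add0r.
have -> : E F y - E F y' = (E F y - phi z *: E F x) - (E F y' - phi z *: E F x).
  by rewrite opprB addrA subrK.
apply: le_trans (rnormB _ _) _; lra.
Qed.

(** On a piece where phi and psi are close to a and b, the vector w is close to
    b y and y is close to a x. Boundedness keeps the cross terms of order e. *)
Lemma sym_comp phi psi D x y w : measurable D -> Linfty D phi -> Linfty D psi ->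
  symbol phi D x y -> symbol psi D y w -> symbol (fun z => phi z * psi z) D x w.
Proof.
move=> mD [mphi [M phiM]] [mpsi [N psiN]] xy yw B mB BD c r r0 h.
rewrite -linearZ -linearB/=.
apply: (pvm_local (K := 2 * `|N|) mD mphi) => //.
move=> e F z e0 e1 mF FB Fz Fe.
have FD : F `<=` D by apply: subset_trans BD.
have re0 : 0 <= r + e * (2 * `|N|) by rewrite addr_ge0// !mulr_ge0// ltW.
apply: (pvm_local (K := `|M| + 2) mD mpsi) => //.
move=> e' G v e'0 e'1 mG GF Gv Ge.
have GD : G `<=` D by apply: subset_trans FD.
have Dv := GD _ Gv.
have hab : rnorm (phi v * psi v - c) <= r by apply/h/FB/GF.
have hw := yw G mG GD _ _ (ltW e'0) Ge.
have e20 : 0 <= 2 * e by rewrite mulr_ge0// ltW.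
(* The base point v is taken in the finer piece G, which doubles the oscillation
   of phi allowed by the coarser piece F. *)
have hy : rnorm (E G y - phi v *: E G x) <= 2 * e * rnorm (E G x).
  apply: xy => // u Gu.
  have := rnormB (phi u - phi z) (phi v - phi z).
  rewrite opprB addrA subrK; have := Fe _ (GF _ Gu); have := Fe _ (GF _ Gv); lra.
have hy2 : rnorm (E G y) <= (`|M| + 2) * rnorm (E G x).
  have := rnormD (E G y - phi v *: E G x) (phi v *: E G x).
  rewrite subrK rnormZ.
  have : rnorm (phi v) * rnorm (E G x) <= `|M| * rnorm (E G x).
    rewrite ler_wpM2r ?rnorm_ge0//; apply: le_trans (phiM _ Dv) _; exact: ler_norm.
  have : 2 * e * rnorm (E G x) <= 2 * rnorm (E G x).
    by rewrite ler_wpM2r ?rnorm_ge0//; lra.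
  lra.
rewrite linearB linearZ/=.
have -> : E G w - c *: E G x = (E G w - psi v *: E G y)
    + psi v *: (E G y - phi v *: E G x) + (phi v * psi v - c) *: E G x.
  by rewrite scalerBr scalerA scalerBl [psi v * _]mulrC (addrA (E G w - _)) subrK addrA subrK.
apply: le_trans (rnormD _ _) _; rewrite rnormZ.
apply: le_trans (lerD (rnormD _ _) (lexx _)) _; rewrite rnormZ.
have h1 : e' * rnorm (E G y) <= e' * ((`|M| + 2) * rnorm (E G x)).
  by rewrite ler_wpM2l// ltW.
have h2 : rnorm (psi v) * rnorm (E G y - phi v *: E G x)
    <= `|N| * (2 * e * rnorm (E G x)).
  apply: ler_pM => //; rewrite ?rnorm_ge0//; apply: le_trans (psiN _ Dv) _; exact: ler_norm.
have h3 : rnorm (phi v * psi v - c) * rnorm (E G x) <= r * rnorm (E G x).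
  by rewrite ler_wpM2r ?rnorm_ge0.
rewrite 2!mulrDl -!mulrA; lra.
Qed.

Lemma sym_cover phi (D : (set (borelC R))^nat) x y :
  (forall n, measurable (D n)) -> (forall n, symbol phi (D n) x y) ->
  symbol phi (\bigcup_n D n) x y.
Proof.
move=> mD h B mB BD c r r0 phic.
have BE : B = \bigcup_n seqDU (fun n => B `&` D n) n.
  by rewrite -seqDU_bigcup_eq -setI_bigcupr setIidl.
have mBD n : measurable (B `&` D n) by exact: measurableI.
rewrite -linearZ -linearB/= BE; apply: (pvm_local_le pE) => //.
  by move=> i; apply: measurableD => //; exact: bigsetU_measurable.
move=> i; rewrite linearB linearZ/=; apply: (h i) => //.
- by apply: measurableD => //; exact: bigsetU_measurable.
- by apply: subset_trans (@subset_seqDU _ _ _) _; exact: subIsetr.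
- by move=> z Gz; have [/phic] := subset_seqDU Gz.
Qed.

Lemma sym_null phi D C x y : measurable D -> measurable C ->
  (forall u, E C u = 0) -> symbol phi D x y -> symbol phi (D `|` C) x y.
Proof.
move=> mD mC C0 h.
have -> : D `|` C = \bigcup_n (if n is 0%N then D else C).
  apply/seteqP; split => [z [Dz|Cz]|z [[|n] _]]; [by exists 0%N|by exists 1%N| |].
    by left.
  by right.
apply: sym_cover => -[|n]//; move=> B mB BC c r r0 _.
have B0 u : E B u = 0 by rewrite -(setIidl BC) (pvmI pE)// C0 linear0.
by rewrite !B0 scaler0 subr0 !rnorm0 mulr0.
Qed.

(** The rough constant of [op_integral_le] multiplies the oscillation only, and
    the oscillation tends to 0 under refinement. *)
Lemma op_integral_sym D phi x y : measurable D -> Linfty D phi ->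
  op_integral (fun B => E B) D phi x y -> symbol phi D x y.
Proof.
move=> mD Lphi xy B mB BD c r r0 h; rewrite -linearZ -linearB/=.
have [mphi _] := Lphi; apply: (pvm_local (K := 8) mD mphi mB BD) => //.
move=> e F z e0 e1 mF FB Fz Fe; rewrite linearB linearZ/=.
have := op_integral_le pE mD Lphi xy mF (subset_trans FB BD) (ltW e0) Fe.
move=> h1; have -> : E F y - c *: E F x = (E F y - phi z *: E F x) + (phi z - c) *: E F x.
  by rewrite scalerBl addrA subrK.
apply: le_trans (rnormD _ _) _; rewrite rnormZ.
have : rnorm (phi z - c) * rnorm (E F x) <= r * rnorm (E F x).
  by rewrite ler_wpM2r ?rnorm_ge0//; exact/h/FB.
by move: h1; move: (rnorm (E F x)) => N; lra.
Qed.

Lemma op_integral_pvm D phi x y : measurable D -> Linfty D phi ->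
  op_integral (fun B => E B) D phi x y -> E D y = y.
Proof.
move=> mD Lphi xy; apply: hdot_inj => g; rewrite (pvm_adj pE)// !xy.
rewrite (pint_restr pE (x := x) (g := g) (B := D)) ?setIid//.
  by move=> C mC; rewrite -(pvm_adj pE)// -(pvmI pE)// setIC.
by case: Lphi.
Qed.

(** For fixed x the integral is a bounded conjugate-linear functional of the
    second vector; its Riesz representative depends linearly on x. *)
Lemma op_integral_ex D phi : measurable D -> Linfty D phi ->
  exists2 T : {linear H -> H}, bounded_op T &
    forall x, op_integral (fun B => E B) D phi x (T x).
Proof.
move=> mD Lphi; have [mphi [M phiM]] := Lphi.
have phiM' z : D z -> rnorm (phi z) <= `|M|.
  by move=> /phiM h; apply: le_trans h _; exact: ler_norm.
have /choice[T TE] x : exists y, op_integral (fun B => E B) D phi x y.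
  have [||y yE] := @riesz_representation _ _ (fun g => Num.conj (pint x g D phi))
      (8 * `|M| * rnorm x).
  - by move=> a g g'; rewrite (pint_linr pE)// rmorphD rmorphM/= conjCK.
  - move=> g; rewrite rnorm_conj.
    apply: le_trans (pint_le pE x g mD mphi (normr_ge0 M) phiM') _.
    rewrite -(mulrA (8 * `|M|)) ler_wpM2l ?mulr_ge0//.
    by apply: ler_pM; rewrite ?rnorm_ge0//; exact: (rnorm_pvm_le pE).
  by exists y => g; rewrite hdotC -yE conjCK.
have Tlin : linear T.
  move=> a x y; apply: hdot_inj => g.
  by rewrite hdotDl hdotZl !TE (pint_lel pE).
pose TL : {linear H -> H} := HB.pack T (GRing.isLinear.Build _ _ _ _ T Tlin).
exists TL; last exact: TE.
exists `|M| => x /=; rewrite -(op_integral_pvm mD Lphi (TE x)).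
apply: le_trans (sym_le mD (op_integral_sym mD Lphi (TE x)) (normr_ge0 M) phiM') _.
by rewrite ler_wpM2l//; exact: (rnorm_pvm_le pE).
Qed.

(** The operator of [op_integral_ex] satisfies both descriptions, and the local
    one determines the image. *)
Lemma sym_op_integral D phi x y : measurable D -> Linfty D phi ->
  symbol phi D x y -> op_integral (fun B => E B) D phi x (E D y).
Proof.
move=> mD Lphi xy; have [T _ TE] := op_integral_ex mD Lphi.
rewrite (sym_uniq mD _ xy (op_integral_sym mD Lphi (TE x))); last by case: Lphi.
by rewrite (op_integral_pvm mD Lphi (TE x)).
Qed.

End pvm.

(** * Localization in the plane *)

Section lipschitz.
Variable R : realType.

Lemma lipschitz_measurable (D : set (borelC R)) (f : R[i] -> R[i]) (L : R) :
  measurable D -> 0 < L ->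
  (forall z w, D z -> D w -> rnorm (f z - f w) <= L * rnorm (z - w)) ->
  measurable_fun D (f : borelC R -> borelC R).
Proof.
move=> mD L0 fl; apply: (@measurability _ _ _ (borelC R) D f (@open (R[i])^o) erefl) => // _ [ O oO <-].
pose U := [set w : R[i] | exists2 z, D z & exists2 e : R, 0 < e &
  (forall v, rnorm (f z - v) < e -> O v) /\ rnorm (z - w) < e / L].
have oU : open (U : set (R[i])^o).
  apply/open_rnormP => w [z Dz [e e0 [eO zw]]].
  exists (e / L - rnorm (z - w)); first by rewrite subr_gt0.
  move=> v wv; exists z => //; exists e => //; split => //.
  have := rnormD (z - w) (w - v); rewrite addrA subrK; lra.
have -> : D `&` f @^-1` O = D `&` U.
  apply/seteqP; split => [w [Dw Ow]|w [Dw [z Dz [e e0 [eO zw]]]]]; split => //.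
    have [e e0 eO] := (open_rnormP O).1 oO _ Ow.
    exists w => //; exists e => //; split => //.
    by rewrite subrr rnorm0 divr_gt0.
  apply: eO; apply: le_lt_trans (fl _ _ Dz Dw) _.
  by rewrite mulrC -ltr_pdivlMr.
by apply: measurableI => //; exact: open_measurableC.
Qed.

End lipschitz.

Section pvm.
Variables (R : realType) (H : hilbertType R).
Variable E : set (borelC R) -> {linear H -> H}.
Hypothesis pE : projection_valued_measure E.
Implicit Types (B C D : set (borelC R)) (x y : H).

(** A family of sets stable under subsets that contains a neighbourhood of each
    point of O contains the pieces of a countable partition of O. *)
Lemma small_cover (O : set (borelC R)) (P : set (borelC R) -> Prop) :
  measurable O -> (forall B C, B `<=` C -> P C -> P B) ->
  (forall z, O z -> exists2 e : R, 0 < e & P (rball z e `&` O)) ->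
  exists F : (set (borelC R))^nat, [/\ forall i, measurable (F i), trivIset setT F,
    \bigcup_i F i = O & forall i, O !=set0 -> P (F i)].
Proof.
move=> mO sP hP.
pose b n k : set (borelC R) := rball (dense_seq R n) k.+1%:R^-1 `&` O.
pose G n : set (borelC R) := if unpickle n is Some (i, j) then
    (if pselect (P (b i j)) then b i j else set0) else set0.
have mb i j : measurable (b i j) by apply: measurableI => //; exact: measurable_rball.
have mG n : measurable (G n).
  rewrite /G; case: unpickle => [[i j]|]; last exact: measurable0.
  by case: (pselect _) => ? /=; [exact: mb|exact: measurable0].
exists (seqDU G); split.
- by move=> i; apply: measurableD => //; exact: bigsetU_measurable.
- exact: trivIset_seqDU.
- rewrite -seqDU_bigcup_eq; apply/seteqP; split => [z [n _]|z Oz].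
    rewrite /G; case: unpickle => [[i j]|]//.
    by case: (pselect _) => // ? [].
  have [e e0 eP] := hP _ Oz; have e2 : 0 < e / 2 by rewrite divr_gt0.
  have [k _ hk] := near_infty_natSinv_lt (PosNum e2).
  have := hk k (leqnn _) => /= ke.
  have [n zn] := @dense_seqP _ z k.+1%:R^-1 (ltac:(by rewrite invr_gt0)).
  exists (pickle (n, k)) => //; rewrite /G pickleK.
  case: (pselect _) => [?|[]] /=; first by split.
  apply: sP eP => w [wn Ow]; split => //; move: wn; rewrite /rball/= => wn.
  have := rnormB (w - dense_seq R n) (z - dense_seq R n).
  rewrite opprB addrA subrK; move: (k.+1%:R^-1) ke zn wn => c; lra.
- move=> i [z Oz]; have [e e0 eP] := hP _ Oz.
  have P0 : P set0 by apply: sP eP.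
  apply: (sP _ (G i)); first exact: subset_seqDU.
  rewrite /G; case: unpickle => [[j k]|]//.
  by case: (pselect _).
Qed.

(** Vanishing near every point of O is enough: O is covered by countably many of
    the neighbourhoods, and W is continuous. *)
Lemma pvm_local_zero (K : hilbertType R) (W : {linear H -> K}) (O : set (borelC R)) x :
  bounded_op W -> measurable O ->
  (forall z, O z -> exists2 e : R, 0 < e &
    forall B, measurable B -> B `<=` rball z e -> B `<=` O -> W (E B x) = 0) ->
  W (E O x) = 0.
Proof.
move=> bW mO h.
have [->|/set0P O0] := eqVneq O set0; first by rewrite (pvm0 pE) linear0.
pose P (B : set (borelC R)) := forall C, measurable C -> C `<=` B -> W (E C x) = 0.
have [||F [mF tF FO PF]] := @small_cover O P mO.
- by move=> B C BC PC D mD DB; apply: PC => //; exact: subset_trans BC.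
- move=> z /h[e e0 eh]; exists e => // B mB BO; apply: eh => //.
    by move=> w /BO[].
  by move=> w /BO[].
have Fx := @pvm_series _ _ _ pE _ x mF tF; rewrite FO in Fx.
have := bounded_cvg bW Fx.
have -> : W \o series (fun i => E (F i) x) = cst 0.
  apply/funext => n; rewrite /= /series/= linear_sum big1// => i _.
  exact: (PF i O0 (F i) (mF i) (@subset_refl _ _)).
move=> W0; have c0 : (cst 0 : nat -> K) @ \oo --> (0 : K) by exact: cvg_cst.
exact: (cvg_unique (@norm_hausdorff _ _) W0 c0).
Qed.

End pvm.

(** * The graph of a normal operator *)

Section normal_operator.
Variables (R : realType) (H : hilbertType R).
Variables (A : set (H * H)) (E : set (borelC R) -> {linear H -> H}).
Hypothesis nA : normal_op A.
Hypothesis resE : resolution_of_identity A E.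
Implicit Types (B C D : set (borelC R)) (x y : H).

Let pE : projection_valued_measure E := resE.1.

Definition disc (n : nat) : set (borelC R) := rball 0 n.+1%:R.

Lemma measurable_disc n : measurable (disc n).
Proof. exact: measurable_rball. Qed.

Lemma bigcup_disc : \bigcup_n disc n = [set: borelC R].
Proof.
apply/seteqP; split => // z _; exists (Num.bound (rnorm (z : R[i]))) => //.
rewrite /disc /rball/= subr0; apply: lt_trans (archi_boundP (rnorm_ge0 _)) _.
by rewrite ltr_nat.
Qed.

Lemma bigcup_setI_disc D : \bigcup_n (D `&` disc n) = D.
Proof. by rewrite -setI_bigcupr bigcup_disc setIT. Qed.

Lemma measurable_id : measurable_fun setT (id : borelC R -> borelC R).
Proof. exact: measurable_id. Qed.

Lemma Linfty_id B (r : R) : measurable B -> (forall z, B z -> rnorm (z : R[i]) <= r) ->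
  Linfty B (id : R[i] -> R[i]).
Proof.
by move=> mB Br; split; [exact: measurable_funS measurable_id|exists r].
Qed.

Lemma rnorm_disc n (z : R[i]) : disc n z -> rnorm z <= n.+1%:R.
Proof. by rewrite /disc /rball/= subr0; exact: ltW. Qed.

(** The measures at E B x are concentrated on B, so that the integrals over the
    whole plane defining the graph of A are integrals of a bounded function. *)
Lemma sym_id_op B (r : R) x y : measurable B ->
  (forall z, B z -> rnorm (z : R[i]) <= r) ->
  symbol E id B x y -> A (E B x, E B y).
Proof.
move=> mB Br xy; have LB := Linfty_id mB Br; apply/resE.2; split; last first.
  move=> g; rewrite (sym_op_integral pE mB LB xy).
  rewrite (pint_restr pE (x := x) (g := g) (x' := E B x) (D := setT) (B := B)) ?setTI//.
  by move=> C mC; rewrite -(pvmI pE).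
have r0 : 0 <= `|r| by [].
have mf : measurable_fun setT (fun z : borelC R => (rnorm (z : R[i]) ^+ 2)%:E).
  apply/measurable_EFinP; apply: measurable_funX; apply: continuous_measurableC => z w.
  have := rnormD (z - w) w; have := rnormD (w - z) z; rewrite !subrK (rdistC w z).
  rewrite ler_norml; lra.
pose m := pvm_measure pE (E B x).
have -> : (\int[fun C => (complex.Re (hdot (E C (E B x)) (E B x)))%:E]_z
     (rnorm (z : R[i]) ^+ 2)%:E = \int[m]_z (rnorm (z : R[i]) ^+ 2)%:E)%E.
  apply: eq_raw_integral => C mC; rewrite /m pvm_measureE// rnorm_pvm_sqr//.
rewrite (@ge0_negligible_integral _ _ _ m setT (~` B))//.
- rewrite setTD setCK; apply: (@le_lt_trans _ _ (\int[m]_(z in B) (`|r| ^+ 2)%:E)%E).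
    apply: ge0_le_integral => //.
    + by move=> z _; rewrite lee_fin sqr_ge0.
    + exact: measurable_funTS mf.
    + move=> z Bz; rewrite lee_fin ler_pXn2r ?nnegrE ?rnorm_ge0//.
      by apply: le_trans (Br _ Bz) _; exact: ler_norm.
  by rewrite integral_cst// lte_mul_pinfty// -ge0_fin_numE// fin_num_measure.
- exact: measurableC.
- by move=> z _; rewrite lee_fin sqr_ge0.
- rewrite /m [LHS]pvm_measureE//; last exact: measurableC.
  by rewrite -(pvmI pE)//; [rewrite setICl (pvm0 pE) rnorm0 expr0n|exact: measurableC].
Qed.

Lemma op_bounded_dom B (r : R) x : measurable B ->
  (forall z, B z -> rnorm (z : R[i]) <= r) ->
  exists y, symbol E id B x y /\ A (E B x, E B y).
Proof.
move=> mB Br; have LB := Linfty_id mB Br.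
have [T _ TE] := op_integral_ex pE mB LB.
have h := op_integral_sym pE mB LB (TE x).
by exists (T x); split => //; exact: sym_id_op Br h.
Qed.

(** On the graph of A the defining integral of z against the spectral measure
    amounts to the local estimates, which never mention unbounded integrands. *)
Lemma op_sym x y : A (x, y) <-> symbol E id setT x y.
Proof.
split.
  move=> Axy; have [_ xy] := (resE.2 x y).1 Axy.
  rewrite -bigcup_disc; apply: (sym_cover pE) => [n|n]; first exact: measurable_disc.
  have mn := measurable_disc n.
  have Ln := Linfty_id mn (@rnorm_disc n).
  have : symbol E id (disc n) x (E (disc n) y).
    apply: (op_integral_sym pE mn Ln) => g; rewrite (pvm_adj pE)// xy.
    rewrite (pint_restr pE (x := x) (g := g) (B := disc n)) ?setTI//.
    by move=> C mC; rewrite -(pvm_adj pE)// -(pvmI pE)// setIC.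
  move=> h B mB Bn c r r0 /(h B mB Bn c r r0).
  by rewrite (pvm_sub pE).
(* Conversely the truncations of x to the shells of a partition into bounded
   sets lie in the domain, and the graph is closed. *)
move=> xy; have [[A0 AD _] _ cA _] := nA.
pose F := seqDU disc.
have mF i : measurable (F i).
  by apply: measurableD; [|apply: bigsetU_measurable => ? _]; exact: measurable_disc.
have tF : trivIset setT F by exact: trivIset_seqDU.
have FT : \bigcup_i F i = setT by rewrite -seqDU_bigcup_eq bigcup_disc.
have AF i : A (E (F i) x, E (F i) y).
  apply: (@sym_id_op _ i.+1%:R) => //; last exact: symS xy.
  by move=> z Fz; apply: rnorm_disc; exact: subset_seqDU Fz.
have Fx := @pvm_series _ _ _ pE _ x mF tF; rewrite FT (pvmT pE) in Fx.
have Fy := @pvm_series _ _ _ pE _ y mF tF; rewrite FT (pvmT pE) in Fy.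
have Fxy := cvg_pair Fx Fy.
apply: (@closed_cvg nat (H * H)%type \oo _ (fun n => (series (fun i => E (F i) x) n,
  series (fun i => E (F i) y) n)) A cA _ (x, y) (Fxy _ _ _)); apply: nearW => n.
rewrite /series/=; elim: n => [|n IH]; first by rewrite !big_nil.
rewrite !big_nat_recr//= -[X in X + _]scale1r -[X in (_, X + _)]scale1r.
exact: AD.
Qed.

End normal_operator.

(** * The spectrum carries the spectral measure *)

Section normal_operator.
Variables (R : realType) (H : hilbertType R).
Variables (A : set (H * H)) (E : set (borelC R) -> {linear H -> H}).
Hypothesis nA : normal_op A.
Hypothesis resE : resolution_of_identity A E.
Implicit Types (B C D : set (borelC R)) (x y : H).

Let pE : projection_valued_measure E := resE.1.

Lemma rball_bounded (z : R[i]) (e : R) B : B `<=` rball z e ->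
  forall w, B w -> rnorm (w : R[i]) <= rnorm z + `|e|.
Proof.
move=> Be w /Be; rewrite /rball/= => h.
have := rnormD (w - z) z; rewrite subrK; have := ler_norm e; lra.
Qed.

Lemma op_near (z : R[i]) (e : R) B x : measurable B -> B `<=` rball z e -> 0 <= e ->
  exists y, A (E B x, E B y) /\ rnorm (E B y - z *: E B x) <= e * rnorm (E B x).
Proof.
move=> mB Be e0; have [y [sy Ay]] := op_bounded_dom resE x mB (rball_bounded Be).
by exists y; split => //; apply: sy => // w /Be /ltW.
Qed.

(** On the spectral subspace of a small ball around z the operator A - z is
    smaller than the inverse of its bounded inverse allows, unless the subspace
    is 0. *)
Lemma resolvent_ball (z : R[i]) : resolvent_set A z ->
  exists2 e : R, 0 < e & forall B, measurable B -> B `<=` rball z e ->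
    forall x, E B x = 0.
Proof.
move=> [S [/bounded_op_ge0[M M0 SM] SA _]].
have M1 : 0 < (M + 1) by rewrite ltr_wpDl.
exists (M + 1)^-1; first by rewrite invr_gt0.
move=> B mB Be x; have e0 : 0 <= (M + 1)^-1 by rewrite invr_ge0 ltW.
have [y [Ay hy]] := op_near x mB Be e0.
apply: rnorm_eq0; apply/eqP; rewrite eq_le rnorm_ge0 andbT.
have := SM (E B y - z *: E B x); rewrite SA// => h.
have {}h : rnorm (E B x) <= M * ((M + 1)^-1 * rnorm (E B x)).
  by apply: le_trans h _; rewrite ler_wpM2l.
move: h; rewrite mulrA -subr_le0 -{1}[rnorm _]mul1r -mulrBl pmulr_rle0//.
by rewrite subr_gt0 ltr_pdivrMr// mul1r ltrDl.
Qed.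

(** The inverse is the bounded function 1 / (w - z) of A on the complement of the
    ball. Products with the unbounded w - z are computed on the bounded parts
    [Dn] of that complement. *)
Lemma ball_resolvent (z : R[i]) (e : R) : 0 < e ->
  (forall x, E (rball z e) x = 0) -> resolvent_set A z.
Proof.
move=> e0 Ez0.
have mr := measurable_rball z e.
pose D := ~` rball z e; have mD : measurable D by exact: measurableC.
have ED x : E D x = x by rewrite (pvm_setC pE)// Ez0 subr0.
have De w : D w -> e <= rnorm (w - z) by rewrite /D/= /rball/= => /negP; rewrite -leNgt.
have Dz w : D w -> w - z != 0.
  by move=> /De; apply: contraTneq => ->; rewrite rnorm0 -ltNge.
pose phi (w : R[i]) := (w - z)^-1.
have mphi : measurable_fun D (phi : borelC R -> borelC R).
  apply: (@lipschitz_measurable _ _ _ (e ^- 2)) => //; first by rewrite invr_gt0 exprn_gt0.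
  move=> v w Dv Dw; have -> : phi v - phi w = (w - v) * (phi v * phi w).
    by rewrite /phi; field; rewrite !Dz.
  rewrite !rnormM !rnormV rdistC mulrC ler_wpM2r ?rnorm_ge0//.
  rewrite -invfM lef_pV2 ?posrE ?exprn_gt0 ?mulr_gt0//; last 2 first.
  - by apply: lt_le_trans (De _ Dv).
  - by apply: lt_le_trans (De _ Dw).
  by rewrite expr2 ler_pM ?De// ltW.
have Lphi : Linfty D phi.
  split => //; exists e^-1 => w Dw; rewrite rnormV lef_pV2 ?posrE ?De//.
  exact: lt_le_trans (De _ Dw).
have [S bS SE] := op_integral_ex pE mD Lphi.
have sS x : symbol E phi D x (S x) by exact: op_integral_sym (SE x).
pose Dn n := D `&` @disc R n.
have mDn n : measurable (Dn n) by apply: measurableI => //; exact: measurable_disc.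
have DDn : \bigcup_n Dn n = D by exact: bigcup_setI_disc.
have LphiD n : Linfty (Dn n) phi by apply: LinftyS mD _ Lphi; exact: subIsetl.
pose psi (w : R[i]) := w - z.
have LpsiD n : Linfty (Dn n) psi.
  split.
    apply: (@lipschitz_measurable _ _ _ 1) => // v w _ _.
    by rewrite /psi opprB addrA subrK mul1r.
  exists (n.+1%:R + rnorm z) => w [_ /rnorm_disc h].
  by apply: le_trans (rnormB _ _) _; rewrite lerD2r.
have mc n : measurable_fun (Dn n) (cst 1 : borelC R -> borelC R) by exact: measurable_cst.
exists S; split => //.
  move=> x y /(op_sym nA resE) /(sym_shift (k := z)) sxy.
  have s1 : symbol E (cst 1) D x (S (y - z *: x)).
    rewrite -DDn; apply: (sym_cover pE) => // n.
    have := sym_comp pE (mDn n) (LpsiD n) (LphiD n) (symS _ sxy)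
      (symS (@subIsetl _ _ _) (sS (y - z *: x))).
    move=> /(_ (@subsetT _ _)); apply: sym_ext => w [Dw _].
    by rewrite /psi /phi mulfV// Dz.
  have := sym_uniq pE mD (measurable_cst _) s1 (@sym_cst _ _ _ pE D x 1 mD).
  by rewrite !ED scale1r.
move=> y; apply/(op_sym nA resE).
have s2 : symbol E psi D (S y) y.
  rewrite -DDn; apply: (sym_cover pE) => // n.
  have [T _ TE] := op_integral_ex pE (mDn n) (LpsiD n).
  have sT := op_integral_sym pE (mDn n) (LpsiD n) (TE (S y)).
  have s3 : symbol E (cst 1) (Dn n) y (T (S y)).
    have := sym_comp pE (mDn n) (LphiD n) (LpsiD n) (symS (@subIsetl _ _ _) (sS y)) sT.
    by apply: sym_ext => w [Dw _]; rewrite /psi /phi mulVf// Dz.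
  have := sym_uniq pE (mDn n) (mc n) s3 (@sym_cst _ _ _ pE (Dn n) y 1 (mDn n)).
  rewrite scale1r => ETy B mB Bn c r r0 h.
  rewrite -[E B y](pvm_sub pE _ mB (mDn n) Bn) -ETy (pvm_sub pE)//.
  exact: sT.
have := sym_null pE mD mr Ez0 s2.
have -> : D `|` rball z e = setT by rewrite setUC setUv.
move=> /(sym_shift (k := - z)); rewrite scaleNr !opprK.
by apply: sym_ext => w _; rewrite /psi subrK.
Qed.

Lemma open_resolvent : open (resolvent_set A : set (R[i])^o).
Proof.
apply/open_rnormP => z /resolvent_ball[e e0 Ez].
have e2 : 0 < e / 2 by rewrite divr_gt0.
exists (e / 2) => // w zw; apply: (ball_resolvent e2) => x.
apply: Ez; first exact: measurable_rball.
move=> v; rewrite /rball/= => vw; have := rnormD (v - w) (w - z).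
rewrite addrA subrK (rdistC w z); lra.
Qed.

Lemma measurable_spectrum : measurable (spectrum A : set (borelC R)).
Proof. by apply: measurableC; apply: open_measurableC; exact: open_resolvent. Qed.

Lemma pvm_resolvent x : E (resolvent_set A) x = 0.
Proof.
have mr : measurable (resolvent_set A : set (borelC R)).
  by apply: open_measurableC; exact: open_resolvent.
apply: (pvm_local_zero pE (W := idfun)) => //.
  by exists 1 => y; rewrite mul1r.
by move=> z /resolvent_ball[e e0 h]; exists e => // B mB Be _; exact: h.
Qed.

Lemma pvm_spectrum x : E (spectrum A) x = x.
Proof.
have mr : measurable (resolvent_set A : set (borelC R)).
  by apply: open_measurableC; exact: open_resolvent.
by rewrite (pvm_setC pE)// pvm_resolvent subr0.
Qed.

End normal_operator.

(** * Operators commuting with the semigroup commute with E *)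

Section normal_operator.
Variables (R : realType) (H : hilbertType R).
Variables (A : set (H * H)) (E : set (borelC R) -> {linear H -> H}).
Hypothesis nA : normal_op A.
Hypothesis resE : resolution_of_identity A E.
Implicit Types (B C D : set (borelC R)) (x y : H).

Let pE : projection_valued_measure E := resE.1.

(** Pieces where phi oscillates by less than e s / 2 lose a factor 1 - e / 2, and
    (1 - e / 2) (1 + e) >= 1. *)
Lemma sym_ge phi D x y (s : R) : measurable D ->
  measurable_fun D (phi : borelC R -> borelC R) -> symbol E phi D x y -> 0 < s ->
  (forall z, D z -> s <= rnorm (phi z)) -> s * rnorm (E D x) <= rnorm (E D y).
Proof.
move=> mD mphi xy s0 h.
apply: (@le_add_epsM _ _ _ (rnorm (E D y))) => [|e e0 e1]; first exact: rnorm_ge0.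
have es : 0 < e * s / 2 by rewrite divr_gt0// mulr_gt0.
have [F [mF tF FD Fe]] := small_partition mD (@subset_refl _ D) mD mphi es.
have -> : rnorm (E D y) + e * rnorm (E D y) = (1 + e) * rnorm (E D y) by lra.
have -> : s * rnorm (E D x) = rnorm (E D (s%:C%C *: x)).
  by rewrite linearZ rnormZ rnorm_real gtr0_norm.
rewrite -FD; apply: (pvm_local_le pE) => // [|i]; first by rewrite addr_ge0// ltW.
have [->|/set0P[z Fz]] := eqVneq (F i) set0.
  by rewrite !(pvm0 pE) rnorm0 mulr0.
have FiD : F i `<=` D by rewrite -FD; exact: bigcup_sup.
have h1 : rnorm (E (F i) y - phi z *: E (F i) x) <= e * s / 2 * rnorm (E (F i) x).
  by apply: xy => // [|v Fv]; [exact: ltW|apply/ltW/(Fe i)].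
rewrite linearZ rnormZ rnorm_real gtr0_norm//.
have h2 := rnormB (E (F i) y) (E (F i) y - phi z *: E (F i) x).
rewrite opprB addrCA subrr addr0 rnormZ in h2.
have h3 : s * rnorm (E (F i) x) <= rnorm (phi z) * rnorm (E (F i) x).
  by rewrite ler_wpM2r ?rnorm_ge0//; exact/h/FiD.
have Y0 := rnorm_ge0 (E (F i) y); have X0 := rnorm_ge0 (E (F i) x).
move: h1 h2 h3 Y0 X0; set Y := rnorm (E (F i) y); set X := rnorm (E (F i) x).
move=> h1 h2 h3 Y0 X0.
have h4 : s * X * (1 - e / 2) <= Y by lra.
have h5 : s * X * (1 - e / 2) * (1 + e) <= Y * (1 + e).
  by rewrite ler_wpM2r// addr_ge0// ltW.
have h6 : 0 <= s * X * (e * (1 - e)) by rewrite !mulr_ge0//; lra.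
lra.
Qed.

Lemma ge_cst_lim (u : nat -> R) (l M : R) : u @ \oo --> l ->
  (forall n, M <= u n) -> M <= l.
Proof.
move=> ul uM; rewrite -(cvg_lim _ ul)//; apply: limr_ge; first by apply/cvg_ex; exists l.
exact: nearW.
Qed.

Section commutation.
Variable T : {linear H -> H}.
Hypothesis bT : bounded_op T.
Hypothesis TA : forall x y, A (x, y) -> A (T x, T y).

(** On the spectral subspace of a ball of radius r the powers of A - z grow at
    most like r^n, while away from the ball of radius s they grow at least like
    s^n. Since T intertwines the powers, it cannot move a vector from the first
    subspace to the second one when r < s. *)
Lemma commuting_ball (z : R[i]) (r s : R) F x : 0 < r -> r < s ->
  measurable F -> F `<=` rball z r -> E (~` rball z s) (T (E F x)) = 0.
Proof.
move=> r0 rs mF Fr; have s0 : 0 < s by exact: lt_trans rs.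
have mQ : measurable (~` rball z s) by apply: measurableC; exact: measurable_rball.
have /choice[g gE] y : exists y', A (E F y, E F y' + z *: E F y) /\
    rnorm (E F y') <= r * rnorm (E F y).
  have [w [Aw hw]] := op_near resE y mF Fr (ltW r0).
  exists (w - z *: y); rewrite linearB linearZ/= subrK; split => //.
pose u n := iter n (fun y => E F (g y)) (E F x).
have uF n : E F (u n) = u n by case: n => [|n]; rewrite /u/= (pvm_idem pE).
have Au n : A (u n, u n.+1 + z *: u n).
  by have [+ _] := gE (u n); rewrite uF.
have un n : rnorm (u n) <= r ^+ n * rnorm (u 0%N).
  elim: n => [|n IH]; first by rewrite mul1r.
  have [_] := gE (u n); rewrite uF => h; apply: le_trans h _.
  by rewrite exprS -mulrA ler_wpM2l// ltW.
pose q n := rnorm (E (~` rball z s) (T (u n))).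
have qS n : s * q n <= q n.+1.
  have /(op_sym nA resE) /(sym_shift (k := z)) := TA (Au n).
  rewrite linearD linearZ/= addrK => h.
  apply: (sym_ge mQ _ (symS (@subsetT _ _) h) s0) => [|v].
    apply: (@lipschitz_measurable _ _ _ 1) => // v w _ _.
    by rewrite opprB addrA subrK mul1r.
  by rewrite /rball/= => /negP; rewrite -leNgt.
have sq n : s ^+ n * q 0%N <= q n.
  elim: n => [|n IH]; first by rewrite mul1r.
  by apply: le_trans (qS n); rewrite exprS -mulrA ler_wpM2l// ltW.
have [M M0 TM] := bounded_op_ge0 bT.
have qle n : q 0%N <= (M * rnorm (u 0%N)) * (r / s) ^+ n.
  rewrite expr_div_n mulrA ler_pdivlMr ?exprn_gt0// mulrC; apply: le_trans (sq n) _.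
  apply: le_trans (rnorm_pvm_le pE _ mQ) _; apply: le_trans (TM _) _.
  by rewrite -mulrA ler_wpM2l// mulrC.
apply: rnorm_eq0; apply/eqP; rewrite eq_le rnorm_ge0 andbT.
have c0 : (fun n => (M * rnorm (u 0%N)) * (r / s) ^+ n) @ \oo --> (0 : R).
  rewrite -[X in _ --> X](mulr0 (M * rnorm (u 0%N))); apply: cvgMr; apply: cvg_expr.
  by rewrite ger0_norm ?divr_ge0 ?ltW// ltr_pdivrMr// mul1r.
exact: (ge_cst_lim c0 qle).
Qed.

Lemma bounded_op_comp (K L : hilbertType R) (S : {linear H -> K}) (V : {linear K -> L}) :
  bounded_op S -> bounded_op V -> bounded_op (V \o S : {linear H -> L}).
Proof.
move=> /bounded_op_ge0[M M0 SM] /bounded_op_ge0[N N0 VN].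
exists (N * M) => x /=; apply: le_trans (VN _) _.
by rewrite -mulrA ler_wpM2l.
Qed.

Lemma bounded_pvm B : measurable B -> bounded_op (E B).
Proof. by move=> mB; exists 1 => x; rewrite mul1r; exact: (rnorm_pvm_le pE). Qed.

(** The open ball is exhausted by smaller balls, on which [commuting_ball]
    applies. *)
Lemma commuting_rball (z : R[i]) (r : R) x : 0 < r ->
  E (~` rball z r) (T (E (rball z r) x)) = 0.
Proof.
move=> r0; have mr := measurable_rball z r; have mQ := measurableC mr.
apply: (pvm_local_zero pE (W := E (~` rball z r) \o T)) => //.
  by apply: bounded_op_comp => //; exact: bounded_pvm.
move=> w wr; rewrite /rball/= in wr.
pose t := (rnorm (w - z) + r) / 2; have wz := rnorm_ge0 (w - z).
exists ((r - rnorm (w - z)) / 2); first by lra.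
move=> B mB Bw _ /=; apply: (@commuting_ball _ t) => //; rewrite /t; try lra.
move=> v /Bw; rewrite /rball/= => vw; have := rnormD (v - w) (w - z).
rewrite addrA subrK; lra.
Qed.

(** T maps the subspace of a small ball inside O into itself, hence into the
    subspace of O. *)
Lemma commuting_open (O : set (borelC R)) x : open (O : set (R[i])^o) ->
  E (~` O) (T (E O x)) = 0.
Proof.
move=> oO; have mO := open_measurableC oO; have mQ := measurableC mO.
apply: (pvm_local_zero pE (W := E (~` O) \o T)) => //.
  by apply: bounded_op_comp => //; exact: bounded_pvm.
move=> w /((open_rnormP O).1 oO)[e e0 eO]; exists e => // B mB Bw _ /=.
have mr := measurable_rball w e; have mrC := measurableC mr.
have rO : rball w e `<=` O by move=> v; rewrite /rball/= rdistC; exact: eO.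
rewrite -[E B x](pvm_sub pE x mB mr Bw) (pvmC pE)//.
set y := E B x; rewrite -[T _](pvmT pE) -(setUv (rball w e)) (pvmU pE)//; last exact: setICr.
rewrite commuting_rball// addr0 -(pvmI pE)//.
have -> : ~` O `&` rball w e = set0 by apply/seteqP; split => // v [nO /rO].
by rewrite (pvm0 pE).
Qed.

(** A small closed ball inside O is the complement of an open set [O'] containing
    the complement of O, so that [commuting_open] for [O'] applies. *)
Lemma commuting_closed (O : set (borelC R)) x : open (O : set (R[i])^o) ->
  E O (T (E (~` O) x)) = 0.
Proof.
move=> oO; have mO := open_measurableC oO; have mQ := measurableC mO.
apply: (pvm_local_zero pE (W := idfun)) => //; first by exists 1 => y; rewrite mul1r.
move=> w /((open_rnormP O).1 oO)[e e0 eO]; have e2 : 0 < e / 2 by lra.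
exists (e / 2) => // B mB Bw _ /=.
pose O' : set (borelC R) := [set v : R[i] | e / 2 < rnorm (v - w)].
have oO' : open (O' : set (R[i])^o).
  apply/open_rnormP => v; rewrite /O'/= => ev; exists (rnorm (v - w) - e / 2); first by lra.
  move=> t vt; have := rnormD (v - t) (t - w); rewrite addrA subrK; lra.
have mO' := open_measurableC oO'; have mQ' := measurableC mO'.
have BO' : B `<=` ~` O'.
  by move=> v /Bw; rewrite /rball/O'/= => h; apply/negP; rewrite -leNgt ltW.
have OO' : ~` O `<=` O'.
  move=> v nO; rewrite /O'/= ltNge; apply/negP => h; apply: nO; apply: eO.
  by rewrite rdistC; lra.
rewrite -(pvm_sub pE (T _) mB mQ' BO') -[E (~` O) x](pvm_sub pE x mQ mO' OO').
by rewrite (pvmC pE _ mQ mO') commuting_open// linear0.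
Qed.

(** This is the theorem of Fuglede for the spectral measure of A: T preserves the
    spectral subspaces of open sets and of their complements, and the sets B
    with T (E B x) = E B (T x) form a sigma-algebra. *)
Theorem fuglede B x : measurable B -> T (E B x) = E B (T x).
Proof.
pose G B := measurable B /\ forall x, T (E B x) = E B (T x).
suff : measurable `<=` G by move=> h /h[].
have GI C D : G C -> G D -> G (C `&` D).
  move=> [mC TC] [mD TD]; split; first exact: measurableI.
  by move=> y; rewrite !(pvmI pE)// TC TD.
have GC C : G C -> G (~` C).
  move=> [mC TC]; split; first exact: measurableC.
  by move=> y; rewrite !(pvm_setC pE)// linearB TC.
have GU (C : (set (borelC R))^nat) n : (forall i, G (C i)) -> G (\big[setU/set0]_(i < n) C i).
  move=> GF; elim: n => [|n IH].
    by rewrite big_ord0; split => // y; rewrite !(pvm0 pE) linear0.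
  rewrite big_ord_recr/= -[X in G X]setCK setCU; apply: (GC); apply: (GI); exact: (GC).
apply: smallest_sub; last first.
  move=> O oO; split; first exact: open_measurableC.
  have mO := open_measurableC oO; have mQ := measurableC mO.
  move=> y; rewrite -[LHS](pvmT pE) -(setUv O) (pvmU pE)//; last exact: setICr.
  rewrite commuting_open// addr0 -[in RHS](pvmT pE y) -[in RHS](setUv O) (pvmU pE)//; last exact: setICr.
  by rewrite !linearD/= commuting_closed// addr0.
split.
- by split => // y; rewrite !(pvm0 pE) linear0.
- by move=> C GF; rewrite setTD; exact: (GC).
- move=> F0 GF0; pose F : (set (borelC R))^nat := F0.
  have GF i : G (F i) by exact: GF0.
  change (G (\bigcup_i F i)).
  have GS i : G (seqDU F i) by rewrite /seqDU setDE; apply: (GI) => //; apply: (GC); exact: (GU).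
  rewrite seqDU_bigcup_eq; split.
    by apply: bigcup_measurable => i _; case: (GS i).
  move=> y; have mS i : measurable (seqDU F i) by case: (GS i).
  have h1 := bounded_cvg bT (@pvm_series _ _ _ pE _ y mS (@trivIset_seqDU _ F)).
  have h2 := @pvm_series _ _ _ pE _ (T y) mS (@trivIset_seqDU _ F).
  apply: (cvg_unique (@norm_hausdorff _ _) h1).
  have -> : T \o series (fun i => E (seqDU F i) y) = series (fun i => E (seqDU F i) (T y)).
    apply/funext => n; rewrite /series/= linear_sum; apply: eq_bigr => i _.
    by case: (GS i).
  exact: h2.
Qed.

End commutation.

End normal_operator.

(** * Semigroups and the scalar exponential *)

Section complex_exponential.
Variable R : realType.
Implicit Types z w : R[i].

Lemma cexp0 : cexp (0 : R[i]) = 1.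
Proof. by rewrite /cexp/= expR0 cos0 sin0 mulr1 mulr0. Qed.

Lemma Re_mul_real (r : R) z : complex.Re (r%:C%C * z) = r * complex.Re z.
Proof. by case: z => a b /=; rewrite mul0r subr0. Qed.

Lemma Im_mul_real (r : R) z : complex.Im (r%:C%C * z) = r * complex.Im z.
Proof. by case: z => a b /=; rewrite mul0r addr0. Qed.

Lemma Re_opp z : complex.Re (- z) = - complex.Re z.
Proof. by case: z. Qed.

Lemma Im_opp z : complex.Im (- z) = - complex.Im z.
Proof. by case: z. Qed.

Lemma cexpD z w : cexp (z + w) = cexp z * cexp w.
Proof.
case: z w => [a b] [c d]; rewrite /cexp/= expRD cosD sinD.
by apply/eqP; rewrite eq_complex/=; apply/andP; split; apply/eqP; ring.
Qed.

Lemma rnorm_cexp z : rnorm (cexp z) = expR (complex.Re z).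
Proof.
apply/eqP; rewrite -(eqrXn2 (n := 2))// ?rnorm_ge0 ?expR_ge0//; apply/eqP.
rewrite rnorm_sqr /cexp/= !exprMn -mulrDr cos2Dsin2 mulr1//.
Qed.

Lemma right_nbhsP (P : R -> Prop) : (\forall h \near (0 : R)^'+, P h) <->
  exists2 d : R, 0 < d & forall h, 0 < h -> h < d -> P h.
Proof.
split.
  move=> /nbhs_ballP[d /= d0 h]; exists d => // t t0 td; apply: h => //.
  by rewrite /ball/= sub0r normrN gtr0_norm.
move=> [d d0 h]; apply/nbhs_ballP; exists d => //= t; rewrite /ball/= sub0r normrN.
by move=> td t0; apply: h => //; apply: le_lt_trans td; exact: ler_norm.
Qed.

Lemma is_derive_right (f : R -> R) df : is_derive (0 : R) (1 : R) f df ->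
  forall e : R, 0 < e -> exists2 d : R, 0 < d & forall h, 0 < h -> h < d ->
    `|h^-1 * (f h - f 0) - df| < e.
Proof.
move=> [fd fE] e e0; rewrite -fE.
have /cvgrPdist_lt/(_ e e0) : (fun h => h^-1 *: ((f \o shift 0) (h *: 1) - f 0)) @ (0 : R)^'
  --> 'D_1 f 0 by exact: fd.
move=> /nbhs_ballP[d /= d0 h]; exists d => // t t0 td.
have := h t; rewrite /ball/= sub0r normrN gtr0_norm// => /(_ td).
rewrite gt_eqF// => /(_ isT) /=.
by rewrite distrC addr0 [_ *: 1]mulr1.
Qed.

Lemma cexp_derive z (e : R) : 0 < e -> exists2 d : R, 0 < d & forall h : R, 0 < h -> h < d ->
    rnorm ((h^-1)%:C%C * (cexp (- (h%:C%C * z)) - 1) + z) < e.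
Proof.
move=> e0; have e2 : 0 < e / 2 by lra.
case: z => a b.
pose f (h : R) := expR (- a * h) * cos (- b * h).
pose g (h : R) := expR (- a * h) * sin (- b * h).
have lin (k : R) : is_derive (0 : R) (1 : R) (fun h : R => k * h) k.
  have := @is_deriveZ _ _ _ (id : R -> R) k 0 1 1 (is_derive_id _ _).
  by rewrite [k *: 1]mulr1.
have de : is_derive (0 : R) (1 : R) (fun h => expR (- a * h)) (- a).
  have := @is_derive1_comp _ expR (fun h => - a * h) 0 _ _ (is_derive_expR _) (lin _).
  by rewrite mulr0 expR0 mul1r.
have dc : is_derive (0 : R) (1 : R) (fun h => cos (- b * h)) 0.
  have := @is_derive1_comp _ (@cos R) (fun h => - b * h) 0 _ _ (is_derive_cos _) (lin _).
  by rewrite mulr0 sin0 oppr0 mul0r.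
have ds : is_derive (0 : R) (1 : R) (fun h => sin (- b * h)) (- b).
  have := @is_derive1_comp _ (@sin R) (fun h => - b * h) 0 _ _ (is_derive_sin _) (lin _).
  by rewrite mulr0 cos0 mul1r.
have df : is_derive (0 : R) (1 : R) f (- a).
  have := is_deriveM de dc.
  by rewrite !mulr0 expR0 cos0 /GRing.scale/= mulr0 add0r mul1r.
have dg : is_derive (0 : R) (1 : R) g (- b).
  have := is_deriveM de ds.
  by rewrite !mulr0 expR0 sin0 /GRing.scale/= mul0r addr0 mul1r.
have [d1 d10 h1] := is_derive_right df e2.
have [d2 d20 h2] := is_derive_right dg e2.
exists (Num.min d1 d2); first by rewrite lt_min d10.
move=> h h0; rewrite lt_min => /andP[hd1 hd2].
have := h1 h h0 hd1; have := h2 h h0 hd2.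
rewrite /f /g !mulr0 expR0 cos0 sin0 !opprK mulr1 mulr0 subr0 => k2 k1.
apply: le_lt_trans (rnorm_le_ReIm _) _; rewrite /cexp/=.
rewrite !mul0r !subr0 !addr0.
have -> : - (h * a) = - a * h by lra.
have -> : - (h * b) = - b * h by lra.
move: k1 k2; lra.
Qed.

End complex_exponential.

Section semigroup.
Variables (R : realType) (H : hilbertType R) (P : R -> {linear H -> H}).
Variables (A : set (H * H)).
Hypothesis cP : contraction_semigroup P.
Hypothesis gP : exp_semigroup P A.

Lemma generatorP x y : A (x, y) <->
  forall e : R, 0 < e -> exists2 d : R, 0 < d & forall h : R, 0 < h -> h < d ->
    rnorm ((h^-1)%:C%C *: (P h x - x) + y) < e.
Proof.
have -> : A (x, y) = semigroup_generator P (x, - y) by rewrite gP/= opprK.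
rewrite /semigroup_generator/=; split.
  move=> /cvgrPdist_lt h e e0; have := h e%:C%C; rewrite ltcR => /(_ e0).
  move=> /right_nbhsP[d d0 hd]; exists d => // t t0 td.
  by have := hd t t0 td; rewrite norm_rnorm ltcR -opprD rnormN addrC.
move=> h; apply/cvgrPdist_lt => e e0.
have eE : e = (complex.Re e)%:C%C by rewrite RRe_real// gtr0_real.
rewrite eE ltcR in e0 *; have [d d0 hd] := h _ e0.
apply/right_nbhsP; exists d => // t t0 td; have := hd t t0 td.
by rewrite norm_rnorm ltcR -opprD rnormN addrC.
Qed.

(** T can be moved through the difference quotients and their limit. *)
Lemma commuting_generator (T : {linear H -> H}) : bounded_op T ->
  (forall t x, 0 <= t -> T (P t x) = P t (T x)) ->
  forall x y, A (x, y) -> A (T x, T y).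
Proof.
move=> /bounded_op_ge0[M M0 TM] TP x y /generatorP h; apply/generatorP => e e0.
have M1 : 0 < M + 1 by rewrite ltr_wpDl.
have [d d0 hd] := h _ (divr_gt0 e0 M1); exists d => // t t0 td.
rewrite -TP ?(ltW t0)// -linearB -linearZ -linearD.
apply: le_lt_trans (TM _) _; have := hd t t0 td; rewrite ltr_pdivlMr//.
apply: le_lt_trans; rewrite mulrC ler_wpM2l ?rnorm_ge0// lerDl//.
Qed.

(** On approximate eigenvectors of the generator the semigroup is close to the
    scalar exponential: compare the n-th powers of P_(t/n) and of the scalar
    step; each of the n steps costs at most the one-step error, by
    contractivity. *)
Lemma semigroup_near_exp x y (z : R[i]) (t : R) : A (x, y) ->
  0 <= complex.Re z -> 0 <= t ->
  rnorm (P t x - cexp (- (t%:C%C * z)) *: x) <= t * rnorm (y - z *: x).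
Proof.
have [P0 PD Pc _] := cP.
move=> Axy z0; rewrite le_eqVlt => /predU1P[<-|t0].
  by rewrite mul0r oppr0 cexp0 scale1r P0 subrr rnorm0 mul0r.
have step n (h : R) : 0 <= h ->
    rnorm (P (n%:R * h) x - cexp (- ((n%:R * h)%:C%C * z)) *: x)
    <= n%:R * rnorm (P h x - cexp (- (h%:C%C * z)) *: x).
  move=> h0; elim: n => [|n IH].
    by rewrite !mul0r oppr0 cexp0 scale1r P0 subrr rnorm0.
  have nh : 0 <= n%:R * h by rewrite mulr_ge0.
  have -> : n.+1%:R * h = h + n%:R * h by rewrite -natr1 mulrDl mul1r addrC.
  rewrite PD// rmorphD/= mulrDl opprD cexpD.
  set q := cexp (- (_ * z)); set qn := cexp (- ((n%:R * h)%:C%C * z)).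
  have -> : P h (P (n%:R * h) x) - q * qn *: x =
      P h (P (n%:R * h) x - qn *: x) + qn *: (P h x - q *: x).
    rewrite [P h (_ - _)]linearB [P h (_ *: _)]linearZ/= scalerBr scalerA.
    by rewrite [qn * q]mulrC addrA subrK.
  apply: le_trans (rnormD _ _) _; rewrite -natr1 mulrDl mul1r.
  apply: lerD; first by apply: le_trans IH; exact: Pc.
  rewrite rnormZ ler_piMl ?rnorm_ge0// rnorm_cexp -[leRHS]expR0 ler_expR.
  by rewrite Re_opp Re_mul_real oppr_le0 mulr_ge0.
have c0 : 0 <= t * (1 + rnorm x) by rewrite mulr_ge0 ?(ltW t0)// addr_ge0// rnorm_ge0.
apply: (le_add_epsM c0) => e e0 _.
have [d1 d10 h1] := (generatorP x y).1 Axy _ e0.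
have [d2 d20 h2] := cexp_derive z e0.
have [n nd] : exists n : nat, t / n.+1%:R < Num.min d1 d2.
  have dd : 0 < Num.min d1 d2 / t by rewrite divr_gt0// lt_min d10.
  have [n _ hn] := near_infty_natSinv_lt (PosNum dd).
  exists n; have := hn n (leqnn _) => /=; rewrite ltr_pdivlMr// mulrC//.
pose h := t / n.+1%:R; have h0 : 0 < h by rewrite divr_gt0.
have tE : t = n.+1%:R * h by rewrite /h mulrC divfK.
move: nd; rewrite -/h lt_min => /andP[hd1 hd2].
have := step n.+1 h (ltW h0); rewrite -tE => H1; apply: le_trans H1 _.
have hC : h%:C%C * (h^-1)%:C%C = 1 :> R[i] by rewrite -rmorphM/= divff ?gt_eqF.
have -> : P h x - cexp (- (h%:C%C * z)) *: x = h%:C%C *: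
   (((h^-1)%:C%C *: (P h x - x) + y) - (y - z *: x)
    - ((h^-1)%:C%C * (cexp (- (h%:C%C * z)) - 1) + z) *: x).
  rewrite opprB (addrACA _ y) subrr addr0 scalerDl opprD addrACA subrr addr0.
  rewrite -scalerA -scalerBr scalerA hC scale1r.
  by rewrite scalerBl scale1r opprB addrA subrK.
rewrite rnormZ rnorm_real gtr0_norm// mulrA -tE [e * _]mulrCA -mulrDr ler_wpM2l ?(ltW t0)//.
apply: le_trans (rnormB _ _) _; rewrite rnormZ.
apply: le_trans (lerD (rnormB _ _) (lexx _)) _.
have := h1 h h0 hd1; have := h2 h h0 hd2.
set X := rnorm (_ * _ + z); set Y := rnorm (_ *: _ + y) => k1 k2.
have := ler_wpM2r (rnorm_ge0 x) (ltW k1); lra.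
Qed.

End semigroup.

(** * The spectral gap *)

Section normal_semigroup.
Variables (R : realType) (H : hilbertType R).
Variables (A : set (H * H)) (E : set (borelC R) -> {linear H -> H}).
Variables (P : R -> {linear H -> H}) (g : R).
Hypothesis nA : normal_op A.
Hypothesis resE : resolution_of_identity A E.
Hypothesis cP : contraction_semigroup P.
Hypothesis gP : exp_semigroup P A.
Hypothesis gapA : spectral_gap A g.
Implicit Types (B C D : set (borelC R)) (x y : H).

Let pE : projection_valued_measure E := resE.1.
Let mS : measurable (spectrum A : set (borelC R)) := measurable_spectrum nA resE.

Lemma spectrum_Re_ge0 (z : R[i]) : spectrum A z -> 0 <= complex.Re z.
Proof. by case: gapA => h _ _ _; exact: h. Qed.

Lemma commuting_pvm (T : {linear H -> H}) : bounded_op T ->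
  (forall t x, 0 <= t -> T (P t x) = P t (T x)) ->
  forall B x, measurable B -> T (E B x) = E B (T x).
Proof.
move=> bT TP B x mB; apply: (fuglede nA resE bT) => //.
exact: (commuting_generator gP bT TP).
Qed.

Lemma semigroup_bounded t : 0 <= t -> bounded_op (P t).
Proof. by case: cP => _ _ h _ t0; exists 1 => x; rewrite mul1r h. Qed.

Lemma semigroup_pvm t B x : 0 <= t -> measurable B -> P t (E B x) = E B (P t x).
Proof.
move=> t0 mB; apply: commuting_pvm => //; first exact: semigroup_bounded.
move=> s y s0; case: cP => _ PD _ _.
by rewrite -!PD// addrC.
Qed.

(** [semigroup_near_exp] compares the semigroup on a small piece of the spectrum
    around z with exp(- t z); the semigroup commutes with E, so that the estimate
    passes to E F (P t x). *)
Lemma sym_semigroup t x : 0 <= t ->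
  symbol E (fun z => cexp (- (t%:C%C * z))) (spectrum A) x (P t x).
Proof.
move=> t0 B mB BS c r r0 h; rewrite -linearZ -linearB/=.
have mid : measurable_fun (spectrum A : set (borelC R)) (id : borelC R -> borelC R).
  by apply: measurable_funTS; exact: measurable_id.
have t20 : 0 <= 2 * t by rewrite mulr_ge0.
apply: (pvm_local pE mS mid mB BS r0 t20) => e F z e0 e1 mF FB Fz Fe.
rewrite linearB linearZ/= -semigroup_pvm//.
have Fr : F `<=` rball z (2 * e).
  by move=> v /Fe; rewrite /rball/=; lra.
have e20 : 0 <= 2 * e by rewrite mulr_ge0// ltW.
have [y [Ay hy]] := op_near resE x mF Fr e20.
have k1 := semigroup_near_exp cP gP Ay (spectrum_Re_ge0 (BS _ (FB _ Fz))) t0.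
set q := cexp _ in k1.
have -> : P t (E F x) - c *: E F x = (P t (E F x) - q *: E F x) + (q - c) *: E F x.
  by rewrite scalerBl addrA subrK.
apply: le_trans (rnormD _ _) _; rewrite rnormZ.
have k2 : rnorm (q - c) * rnorm (E F x) <= r * rnorm (E F x).
  by rewrite ler_wpM2r ?rnorm_ge0//; exact/h/FB.
have k3 := ler_wpM2l t0 hy.
move: k1 k2 k3; set X := rnorm (E F x); set Y := rnorm (_ - z *: _); lra.
Qed.

Lemma Linfty_exp t : 0 <= t ->
  Linfty (spectrum A) (fun z => cexp (- (t%:C%C * z))).
Proof.
move=> t0; split; last first.
  exists 1 => z Sz; rewrite rnorm_cexp -[leRHS]expR0 ler_expR.
  by rewrite Re_opp Re_mul_real oppr_le0 mulr_ge0// spectrum_Re_ge0.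
apply: measurable_funTS.
have mRe : measurable_fun setT (fun z : borelC R => - (t * complex.Re z)).
  apply: measurableT_comp => //; apply: measurable_funM; first exact: measurable_cst.
  exact: measurable_Re.
have mIm : measurable_fun setT (fun z : borelC R => - (t * complex.Im z)).
  apply: measurableT_comp => //; apply: measurable_funM; first exact: measurable_cst.
  exact: measurable_Im.
have mexp : measurable_fun setT (fun z : borelC R => expR (- (t * complex.Re z))).
  by apply: measurableT_comp mRe; exact: measurable_expR.
apply: measurable_funC.
  have -> : (fun z : borelC R => complex.Re (cexp (- (t%:C%C * z)))) =
    (fun z : borelC R => expR (- (t * complex.Re z)) * cos (- (t * complex.Im z))).
    by apply/funext => z; rewrite /cexp/= !Re_opp !Im_opp Re_mul_real Im_mul_real.
  apply: measurable_funM => //; apply: measurableT_comp mIm.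
  by apply: continuous_measurable_fun; exact: continuous_cos.
have -> : (fun z : borelC R => complex.Im (cexp (- (t%:C%C * z)))) =
  (fun z : borelC R => expR (- (t * complex.Re z)) * sin (- (t * complex.Im z))).
  by apply/funext => z; rewrite /cexp/= !Re_opp !Im_opp Re_mul_real Im_mul_real.
apply: measurable_funM => //; apply: measurableT_comp mIm.
by apply: continuous_measurable_fun; exact: continuous_sin.
Qed.

Lemma open_neq0 : open ([set z : R[i] | z != 0] : set (R[i])^o).
Proof.
apply/open_rnormP => z z0; exists (rnorm z).
  by rewrite lt_neqAle rnorm_ge0 andbT eq_sym; apply: contra_neq z0 => /rnorm_eq0.
by move=> w; apply: contraTneq => ->; rewrite subr0 ltxx.
Qed.

Lemma measurable_set0C : measurable ([set 0 : R[i]] : set (borelC R)).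
Proof.
have -> : [set 0 : R[i]] = ~` [set z : R[i] | z != 0].
  by apply/seteqP; split => z /=; [move=> ->; rewrite eqxx|move/negP; rewrite negbK => /eqP].
by apply: measurableC; apply: open_measurableC; exact: open_neq0.
Qed.

Lemma measurable_Re_lt : measurable ([set z : R[i] | complex.Re z < g] : set (borelC R)).
Proof.
have := @measurable_Re R measurableT _ (measurable_itv `]-oo, g[).
by rewrite setTI; congr measurable; apply/seteqP; split => z /=; rewrite in_itv.
Qed.

Definition low_spectrum : set (borelC R) := [set z : R[i] | complex.Re z < g /\ z != 0].

Lemma measurable_low_spectrum : measurable low_spectrum.
Proof.
apply: measurableI; first exact: measurable_Re_lt.
by apply: open_measurableC; exact: open_neq0.
Qed.

(** A spectral vector near z, with z nonzero and Re z < g, would be orthogonal to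
    the kernel of A and have a Rayleigh quotient below the gap. *)
Lemma pvm_low_spectrum x : E low_spectrum x = 0.
Proof.
apply: (pvm_local_zero pE (W := idfun)); [|exact: measurable_low_spectrum|].
  by exists 1 => y; rewrite mul1r.
move=> z [zg z0].
have nz : 0 < rnorm z.
  by rewrite lt_neqAle rnorm_ge0 andbT eq_sym; apply: contra_neq z0 => /rnorm_eq0.
have d0 : 0 < Num.min (rnorm z) (g - complex.Re z).
  by rewrite lt_min nz subr_gt0.
(* Small enough to keep the ball away from 0 and from the line Re w = g. *)
pose d := Num.min (rnorm z) (g - complex.Re z) / 2.
have {}d0 : 0 < d by rewrite divr_gt0.
have dz : d < rnorm z.
  have : Num.min (rnorm z) (g - complex.Re z) <= rnorm z by rewrite ge_min lexx.
  by rewrite /d; lra.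
have dg : complex.Re z + d < g.
  have : Num.min (rnorm z) (g - complex.Re z) <= g - complex.Re z.
    by rewrite ge_min lexx orbT.
  by move: d0; rewrite /d; lra.
exists d => // B mB Bd _ /=.
apply: contrapT => /eqP f0; have [y [Ay hy]] := op_near resE x mB Bd (ltW d0).
have orth k : op_ker A k -> hdot (E B x) k = 0.
  move=> Ak; have sk := (op_sym nA resE _ _).1 Ak.
  have := sk B mB (@subsetT _ _) z d (ltW d0) (fun w Bw => ltW (Bd w Bw)).
  rewrite linear0 sub0r rnormN rnormZ => h.
  suff Bk : E B k = 0 by rewrite (hdot_pvm1 pE)// Bk hdot0r.
  apply: rnorm_eq0; apply/eqP; rewrite eq_le rnorm_ge0 andbT.
  by move: h; rewrite -subr_le0 -mulrBl pmulr_rle0// subr_gt0.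
have [_ _ _ gE] := gapA.
have nf : 0 < rnorm (E B x) ^+ 2.
  rewrite exprn_gt0// lt_neqAle rnorm_ge0 andbT eq_sym.
  by apply: contra_neq f0 => /rnorm_eq0.
have : (g%:E <= (complex.Re (hdot (E B y) (E B x)) / rnorm (E B x) ^+ 2)%:E)%E.
  rewrite gE; apply: ereal_inf_lbound; exists (E B x, E B y) => //; split => //; split => //.
  exact/eqP.
rewrite lee_fin ler_pdivlMr// leNgt => /negP; apply.
have -> : E B y = (E B y - z *: E B x) + z *: E B x by rewrite subrK.
rewrite hdotDl hdotZl hdot_sqr [z * _]mulrC raddfD/= Re_mul_real.
have h1 := Re_hdot_le (E B y - z *: E B x) (E B x).
have h2 := ler_wpM2r (rnorm_ge0 (E B x)) hy.
have h3 : (complex.Re z + d) * rnorm (E B x) ^+ 2 < g * rnorm (E B x) ^+ 2.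
  by rewrite ltr_pM2r.
move: h1 h2 h3; set N := rnorm (E B x); set Q := complex.Re _; rewrite expr2; lra.
Qed.

(** The range of the projection for {0} lies in the kernel of A, and
    [semigroup_near_exp] with z = 0 and A x = 0 says that P t x = x. *)
Lemma fixed_kernel t x : 0 <= t -> P t (E [set 0 : R[i]] x) = E [set 0 : R[i]] x.
Proof.
move=> t0; have m0 := measurable_set0C; set k := E _ x.
have Ak : A (k, 0).
  apply/(op_sym nA resE) => B mB _ c r r0 h; rewrite linear0 sub0r rnormN rnormZ.
  have [B0|B0] := pselect (B (0 : R[i])).
    rewrite ler_wpM2r ?rnorm_ge0//; have := h _ B0.
    by rewrite sub0r rnormN.
  have -> : E B k = 0.
    rewrite /k -(pvmI pE)//; have -> : B `&` [set 0 : R[i]] = set0.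
      by apply/seteqP; split => // w [Bw w0]; apply: B0; rewrite -w0.
    by rewrite (pvm0 pE).
  by rewrite rnorm0 !mulr0.
have := semigroup_near_exp cP gP Ak (lexx 0 : 0 <= complex.Re (0 : R[i])) t0.
rewrite scale0r subr0 rnorm0 !mulr0 oppr0 cexp0 scale1r => h.
apply/eqP; rewrite -subr_eq0; apply/eqP/rnorm_eq0/eqP.
by rewrite eq_le h rnorm_ge0.
Qed.

Definition high_spectrum : set (borelC R) :=
  spectrum A `&` [set z : R[i] | g <= complex.Re z].

Lemma measurable_high_spectrum : measurable high_spectrum.
Proof.
apply: measurableI => //.
have -> : [set z : R[i] | g <= complex.Re z] = ~` [set z : R[i] | complex.Re z < g].
  by apply/seteqP; split => z /=; rewrite leNgt => /negP.
by apply: measurableC; exact: measurable_Re_lt.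
Qed.

Lemma pvm_high_spectrum x : E [set 0 : R[i]] x = 0 -> E high_spectrum x = x.
Proof.
move=> x0; have m0 := measurable_set0C.
have mR := measurable_Re_lt; have mL := measurable_low_spectrum.
have g0 : 0 < g by case: gapA.
have h1 : E [set z : R[i] | complex.Re z < g] x = 0.
  have -> : [set z : R[i] | complex.Re z < g] = low_spectrum `|` [set 0 : R[i]].
    apply/seteqP; split => z /=.
      by move=> zg; have [->|z0] := eqVneq z 0; [right|left].
    by move=> [[]//|->].
  rewrite (pvmU pE)//; first by rewrite pvm_low_spectrum x0 addr0.
  by apply/seteqP; split => // z [[_ /= z0] z00]; rewrite z00 eqxx in z0.
rewrite /high_spectrum (pvmI pE)//; last first.
  have -> : [set z : R[i] | g <= complex.Re z] = ~` [set z : R[i] | complex.Re z < g].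
    by apply/seteqP; split => z /=; rewrite leNgt => /negP.
  exact: measurableC.
have -> : [set z : R[i] | g <= complex.Re z] = ~` [set z : R[i] | complex.Re z < g].
  by apply/seteqP; split => z /=; rewrite leNgt => /negP.
by rewrite (pvm_setC pE x mR) h1 subr0 (pvm_spectrum nA resE).
Qed.

End normal_semigroup.

(** * Decay of the intertwined semigroup *)

Section intertwining.
Variables (R : realType) (H Ht : hilbertType R).
Variables (P : R -> {linear H -> H}) (Pt : R -> {linear Ht -> Ht}).
Variables (A : set (Ht * Ht)) (E : set (borelC R) -> {linear Ht -> Ht}) (g : R).
Variables (Lam : {linear Ht -> H}) (Lamt : {linear H -> Ht}).
Hypothesis csP : contraction_semigroup P.
Hypothesis csPt : contraction_semigroup Pt.
Hypothesis genPt : exp_semigroup Pt A.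
Hypothesis nA : normal_op A.
Hypothesis gapA : spectral_gap A g.
Hypothesis resE : resolution_of_identity A E.
Hypothesis bLam : bounded_op Lam.
Hypothesis bLamt : bounded_op Lamt.
Hypothesis dLam : dense (range Lam).
Hypothesis intLam : forall t x, 0 <= t -> P t (Lam x) = Lam (Pt t x).
Hypothesis intLamt : forall t x, 0 <= t -> Pt t (Lamt x) = Lamt (P t x).

Let pE : projection_valued_measure E := resE.1.
Let mS : measurable (spectrum A : set (borelC R)) := measurable_spectrum nA resE.
Let ES := pvm_spectrum nA resE.

Lemma multiplier_sym (m : R[i] -> R[i]) : Linfty (spectrum A) m ->
  multiplier_for Lam Lamt A E m ->
  forall x, symbol E m (spectrum A) x (Lamt (Lam x)).
Proof. by move=> Lm mul x; apply: (op_integral_sym pE mS Lm); exact: mul. Qed.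

(** With f = Lam h, moving Lam to the other side of the inner product turns the
    measure <F f, k> into <E h, Lam^* k>, against which exp(- t z) integrates to
    <Pt t h, Lam^* k> = <P t f, k>. *)
Lemma intertwined_semigroup_integral t f : 0 <= t -> range Lam f ->
  op_integral (intertwined_measure Lam E) (spectrum A)
    (fun z => cexp (- (t%:C%C * z))) f (P t f).
Proof.
move=> t0 rf k; rewrite /intertwined_measure.
have := pseudo_inverseK bLam rf; set h := pseudo_inverse Lam f => hf.
have [k' kk'] := adjoint_ex bLam k.
rewrite -{1}hf intLam// kk'.
have -> : (fun B => hdot (Lam (E B h)) k) = (fun B => hdot (E B h) k').
  by apply/funext => B; rewrite kk'.
have := sym_op_integral pE mS (Linfty_exp gapA t0)
  (sym_semigroup nA resE csPt genPt gapA h t0).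
by rewrite ES; exact.
Qed.

Lemma dense_linear_eq (K : hilbertType R) (S T : {linear H -> K}) :
  bounded_op S -> bounded_op T ->
  (forall x, S (Lam x) = T (Lam x)) -> forall f, S f = T f.
Proof.
move=> /bounded_op_ge0[M M0 SM] /bounded_op_ge0[N N0 TN] ST f.
apply/eqP; rewrite -subr_eq0; apply/eqP/rnorm_eq0/eqP.
rewrite eq_le rnorm_ge0 andbT.
apply: (@le_add_epsM _ _ _ (M + N)) => [|e e0 _]; first exact: addr_ge0.
have [_ [x _ <-] xf] := denseP dLam f e0.
have -> : S f - T f = S (f - Lam x) - T (f - Lam x).
    by rewrite [S (_ - _)]linearB [T (_ - _)]linearB/= ST opprB addrA subrK.
apply: le_trans (rnormB _ _) _; rewrite add0r mulrDr.
by apply: lerD; [apply: le_trans (SM _) _|apply: le_trans (TN _) _];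
  rewrite mulrC ler_wpM2r// ltW.
Qed.

(** Dividing the exponential by m turns the semigroup into the product of
    the two intertwining operators with a function of A in the middle. *)
Lemma semigroup_factorization (m : R[i] -> R[i]) t : Linfty (spectrum A) m ->
  multiplier_for Lam Lamt A E m -> 0 <= t ->
  (forall z, spectrum A z -> m z <> 0) ->
  Linfty (spectrum A) (fun z => cexp (- (t%:C%C * z)) / m z) ->
  exists2 N : {linear Ht -> Ht},
    forall x, symbol E (fun z => cexp (- (t%:C%C * z)) / m z) (spectrum A) x (N x) &
    forall f, P t f = Lam (N (Lamt f)).
Proof.
move=> Lm mul t0 m0 Lq.
have [N bN NE] := op_integral_ex pE mS Lq.
have sN x := op_integral_sym pE mS Lq (NE x).
exists N => //.
apply: (@dense_linear_eq _ (P t) (Lam \o N \o Lamt)).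
- exact: semigroup_bounded.
- exact: bounded_op_comp (bounded_op_comp bLamt bN) bLam.
move=> x /=; rewrite intLam//; congr (Lam _).
have h := sym_comp pE mS Lm Lq (multiplier_sym Lm mul x) (sN _).
have {}h : symbol E (fun z => cexp (- (t%:C%C * z))) (spectrum A) x (N (Lamt (Lam x))).
  apply: sym_ext h => z Sz; rewrite mulrCA divff ?mulr1//; exact/eqP/m0.
have [me _] := Linfty_exp gapA t0.
have := sym_uniq pE mS me (sym_semigroup nA resE csPt genPt gapA x t0) h.
by rewrite !ES.
Qed.

(** For k in the range of E {0} the functional <Lamt x, k> is represented by a
    vector l with <P t x, l> = <x, l>. As P t is a contraction, |P t l - l|^2 is at
    most 2 |l|^2 - 2 |l|^2, so that l is fixed, hence orthogonal to f - Pinf f. *)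
Lemma kernel_component f : E [set 0 : R[i]] (Lamt (f - Pinf P f)) = 0.
Proof.
have m0 := @measurable_set0C R.
have [_ orth] := Pinf_spec csP f.
apply: hdot_inj => k; rewrite hdot0l (pvm_adj pE)//.
have [l lE] := adjoint_ex bLamt (E [set 0 : R[i]] k).
rewrite lE; apply: orth => t t0.
have Pl x : hdot (P t x) l = hdot x l.
  rewrite -!lE -intLamt// -!(pvm_adj pE)//.
  by rewrite -(semigroup_pvm nA resE csPt genPt)// (fixed_kernel nA resE csPt genPt).
have [_ _ Pc _] := csP.
apply/eqP; rewrite -subr_eq0; apply/eqP/rnorm_eq0/eqP.
rewrite -sqrf_eq0 eq_le sqr_ge0 andbT rnormB_sqr Pl hdot_sqr/=.
have : rnorm (P t l) ^+ 2 <= rnorm l ^+ 2.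
  by rewrite ler_pXn2r ?nnegrE ?rnorm_ge0//; exact: Pc.
lra.
Qed.

Lemma rnorm_decay (m : R[i] -> R[i]) t (z : R[i]) : g <= complex.Re z ->
  rnorm (decay_multiplier Lam Lamt m g t z)
  = rnorm (cexp (- (t%:C%C * z)) / m z) * (opnorm Lam * opnorm Lamt).
Proof.
move=> gz; rewrite /decay_multiplier gz /normalized !rnormM !rnormV rnormM.
rewrite rnorm_real ger0_norm; first by rewrite invfM invrK !mulrA.
by rewrite invr_ge0 mulr_ge0// opnorm_ge0.
Qed.

Lemma semigroup_decay (m : R[i] -> R[i]) t f : Linfty (spectrum A) m ->
  multiplier_for Lam Lamt A E m -> 0 <= t ->
  (forall z, spectrum A z -> m z <> 0) ->
  Linfty (spectrum A) (fun z => cexp (- (t%:C%C * z)) / m z) ->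
  rnorm (P t f - Pinf P f) <=
    supnorm (spectrum A) (decay_multiplier Lam Lamt m g t) * rnorm (f - Pinf P f).
Proof.
move=> Lm mul t0 m0 Lq.
have [N sN PN] := semigroup_factorization Lm mul t0 m0 Lq.
have [fixP _] := Pinf_spec csP f.
have -> : P t f - Pinf P f = P t (f - Pinf P f) by rewrite linearB fixP.
set f' := f - _; set M := supnorm _ _.
pose a := opnorm Lam; pose b := opnorm Lamt.
have a0 : 0 <= a by exact: opnorm_ge0.
have b0 : 0 <= b by exact: opnorm_ge0.
pose q z := cexp (- (t%:C%C * z)) / m z.
have [mq [K qK]] := Lq.
have hub : has_ubound [set rnorm (decay_multiplier Lam Lamt m g t z) | z in spectrum A].
  exists (`|K| * (a * b)) => _ [z Sz <-].
  have [gz|gz] := leP g (complex.Re z).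
    rewrite rnorm_decay// ler_wpM2r ?mulr_ge0//; apply: le_trans (qK _ Sz) _; exact: ler_norm.
  by rewrite /decay_multiplier (leNgt g) gz/= rnorm0 !mulr_ge0.
have Mub z : spectrum A z -> rnorm (decay_multiplier Lam Lamt m g t z) <= M.
  by move=> Sz; apply: ub_le_sup => //; exists z.
have M0 : 0 <= M.
  have [[z Sz]|S0] := pselect (exists z, spectrum A z).
    exact: le_trans (rnorm_ge0 _) (Mub _ Sz).
  rewrite /M /supnorm sup_out// => -[[_ [z Sz _]] _]; apply: S0; by exists z.
pose u := Lamt f'; pose D := high_spectrum A g.
have mD : measurable D by exact: measurable_high_spectrum nA resE.
have Du : E D u = u by apply: (pvm_high_spectrum nA resE gapA); exact: kernel_component.
have Nu : E D (N u) = N u.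
  have := sym_uniq pE mS mq (sym_pvm pE mD mS (sN u)) (sN (E D u)).
  by rewrite !ES Du.
have ub : rnorm u <= b * rnorm f' by exact: opnorm_ub.
rewrite PN -/u; apply: le_trans (opnorm_ub bLam _) _; rewrite -/a.
(* If one of the norms is 0, the normalization of m divides by 0, but then
   Lam (N u) is 0. *)
have [ab0|ab0] := eqVneq (a * b) 0.
  have /eqP := ab0; rewrite mulf_eq0 => /orP[/eqP ->|/eqP b00].
    by rewrite mul0r mulr_ge0// rnorm_ge0.
  have -> : u = 0.
    by apply/rnorm_eq0/eqP; rewrite eq_le rnorm_ge0 andbT; rewrite b00 mul0r in ub.
  by rewrite linear0 rnorm0 mulr0 mulr_ge0// rnorm_ge0.
have ab : 0 < a * b by rewrite lt_neqAle eq_sym ab0 mulr_ge0.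
have qM z : D z -> rnorm (q z) <= M / (a * b).
  by move=> [Sz gz]; rewrite ler_pdivlMr// -rnorm_decay// Mub.
have SD : symbol E q D u (N u) by apply: symS (sN u); exact: subIsetl.
have Mab : 0 <= M / (a * b) by rewrite divr_ge0// ltW.
have := sym_le mD SD Mab qM; rewrite Nu Du => h.
apply: (@le_trans _ _ (a * (M / (a * b) * (b * rnorm f')))).
  by rewrite ler_wpM2l//; apply: le_trans h _; rewrite ler_wpM2l.
rewrite le_eqVlt; apply/orP; left; apply/eqP.
have := ab0; rewrite mulf_eq0 negb_or => /andP[a00 b00].
by field; rewrite a00 b00.
Qed.

Lemma rnorm_decay_gap (m : R[i] -> R[i]) t :
  rnorm (decay_multiplier Lam Lamt m g t g%:C%C)
  = (rnorm (normalized Lam Lamt m g%:C%C))^-1 * expR (- (g * t)).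
Proof.
rewrite /decay_multiplier/= lexx rnormM rnormV mulrC rnorm_cexp.
by rewrite Re_opp Re_mul_real/= [g * t]mulrC.
Qed.

End intertwining.

(** * Sums over disjoint pieces and sums of suprema *)

Section orthogonal_sums.
Variables (R : realType) (H : hilbertType R).
Variable E : set (borelC R) -> {linear H -> H}.
Hypothesis pE : projection_valued_measure E.
Variables (I : finType) (C : I -> set (borelC R)).
Hypothesis mC : forall i, measurable (C i).
Hypothesis dC : forall i j, i != j -> C i `&` C j = set0.

Lemma rnorm_orth_sum (y : I -> H) :
  rnorm (\sum_i E (C i) (y i)) ^+ 2 = \sum_i rnorm (E (C i) (y i)) ^+ 2.
Proof.
apply: complexI; rewrite -hdot_sqr hdot_suml rmorph_sum/=; apply: eq_bigr => i _.
rewrite -hdot_sqr [LHS]hdotC hdot_suml (bigD1 i)//= big1 ?addr0 -?hdotC// => j ji.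
by rewrite (pvm_orth pE)// dC.
Qed.

(** The sum s of the components satisfies |s|^2 = Re <s, y>, whence |s| <= |y|. *)
Lemma bessel (y : H) : \sum_i rnorm (E (C i) y) ^+ 2 <= rnorm y ^+ 2.
Proof.
have s2 := rnorm_orth_sum (fun=> y); rewrite -s2.
set s := \sum_i _ in s2 *.
have sy : rnorm s ^+ 2 = complex.Re (hdot s y).
  rewrite s2 hdot_suml raddf_sum/=; apply: eq_bigr => i _.
  by rewrite (rnorm_pvm_sqr pE).
have := Re_hdot_le s y; rewrite -sy.
have := rnorm_ge0 s; have := rnorm_ge0 y; set a := rnorm s; set b := rnorm y => b0 a0 h.
have [->|a1] := eqVneq a 0; first by rewrite expr0n sqr_ge0.
rewrite ler_pXn2r ?nnegrE// -(ler_pM2l (_ : 0 < a)) -?expr2//.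
by rewrite lt_neqAle eq_sym a1.
Qed.

Lemma rnorm_orth_sum_le (y : I -> H) (w : H) (r : R) : 0 <= r ->
  (forall i, rnorm (E (C i) (y i)) <= r * rnorm (E (C i) w)) ->
  rnorm (\sum_i E (C i) (y i)) <= r * rnorm w.
Proof.
move=> r0 h; rewrite -(ler_pXn2r (n := 2))// ?nnegrE ?mulr_ge0 ?rnorm_ge0//.
rewrite rnorm_orth_sum exprMn.
apply: (@le_trans _ _ (r ^+ 2 * \sum_i rnorm (E (C i) w) ^+ 2)).
  rewrite mulr_sumr; apply: ler_sum => i _; rewrite -exprMn.
  by rewrite ler_pXn2r ?nnegrE ?mulr_ge0 ?rnorm_ge0.
by rewrite ler_wpM2l ?sqr_ge0//; exact: bessel.
Qed.

End orthogonal_sums.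

Section suprema.
Local Open Scope ereal_scope.
Variable R : realType.

(** If a finite weighted sum is bounded for every choice of one element in each
    of the sets S i, then so is the weighted sum of their suprema. *)
Lemma sum_ereal_sup_le (I : finType) (c : I -> R) (S : I -> set \bar R) (M : R) :
  (forall i, (0 < c i)%R) -> (forall i, S i !=set0) ->
  (forall i x, S i x -> 0 <= x) ->
  (forall s : I -> \bar R, (forall i, S i (s i)) -> \sum_i (c i)%:E * s i <= M%:E) ->
  \sum_i (c i)%:E * ereal_sup (S i) <= M%:E.
Proof.
move=> c0 S0 Sge0 h.
have /choice[s0 Ss0] : forall i, exists x, S i x by move=> i; exact: S0.
have bnd i x : S i x -> x <= (M / c i)%:E.
  move=> Six; pose s j := if j == i then x else s0 j.
  have Ss j : S j (s j) by rewrite /s; case: eqP => [->|_].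
  have := h s Ss; rewrite (bigD1 i)//= /s eqxx => hs.
  have : (c i)%:E * x <= M%:E.
    apply: le_trans hs; rewrite leeDl// sume_ge0// => j _.
    by rewrite mule_ge0 ?lee_fin ?(ltW (c0 _))//; apply: Sge0 (Ss j).
  have := Sge0 _ _ Six; case: x {s Ss Six hs} => [r| |]//.
    by rewrite !lee_fin => _; rewrite ler_pdivlMr// mulrC.
  by rewrite gt0_muley ?lte_fin// leye_eq.
have sfin i : ereal_sup (S i) \is a fin_num.
  rewrite ge0_fin_numE; first by apply: (@le_lt_trans _ _ (M / c i)%:E);
    [apply: ge_ereal_sup => x; exact: bnd | exact: ltry].
  by apply: le_trans (Sge0 _ _ (Ss0 i)) _; exact: ereal_sup_ubound.
have -> : \sum_i (c i)%:E * ereal_sup (S i) = (\sum_i c i * fine (ereal_sup (S i)))%:E.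
  by rewrite -sumEFin; apply: eq_bigr => i _; rewrite EFinM fineK.
rewrite lee_fin.
have C0 : (0 <= \sum_i c i)%R by apply: sumr_ge0 => i _; exact: ltW.
apply: (le_add_epsM C0) => e e0 _.
have /choice[s hs] : forall i, exists x, S i x /\ ereal_sup (S i) - e%:E < x.
  by move=> i; have [x Sx xe] := ub_ereal_sup_adherent e0 (sfin i); exists x.
have Ss i : S i (s i) by case: (hs i).
have sF i : s i \is a fin_num.
  by rewrite ge0_fin_numE ?(Sge0 _ _ (Ss i))//; apply: le_lt_trans (bnd _ _ (Ss i)) (ltry _).
have := h s Ss.
have -> : \sum_i (c i)%:E * s i = (\sum_i c i * fine (s i))%:E.
  by rewrite -sumEFin; apply: eq_bigr => i _; rewrite EFinM fineK.
rewrite lee_fin => hM; apply: le_trans (lerD hM (lexx _)).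
rewrite mulr_sumr -big_split/=; apply: ler_sum => i _.
rewrite [(e * _)%R]mulrC -mulrDr ler_wpM2l ?(ltW (c0 _))//.
have [_] := hs i; rewrite lteBlDr// => /ltW hl.
by rewrite -lee_fin EFinD !fineK.
Qed.

End suprema.

(** * The variation of the intertwined measure *)

Section intertwined_variation.
Variables (R : realType) (H Ht : hilbertType R).
Variables (A : set (Ht * Ht)) (E : set (borelC R) -> {linear Ht -> Ht}).
Variables (Lam : {linear Ht -> H}) (Lamt : {linear H -> Ht}).
Hypothesis nA : normal_op A.
Hypothesis resE : resolution_of_identity A E.
Hypothesis bLam : bounded_op Lam.
Hypothesis bLamt : bounded_op Lamt.

Let pE : projection_valued_measure E := resE.1.
Let mS : measurable (spectrum A : set (borelC R)) := measurable_spectrum nA resE.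

Variables (m : R[i] -> R[i]) (h : Ht) (k : H).
Hypothesis Lm : Linfty (spectrum A) m.
Hypothesis mul : multiplier_for Lam Lamt A E m.
Let mu B := hdot (Lam (E B h)) k.
Let a := opnorm Lam.
Let b := opnorm Lamt.

Let a0 : 0 <= a. Proof. exact: opnorm_ge0. Qed.
Let b0 : 0 <= b. Proof. exact: opnorm_ge0. Qed.

(** With phases u i the left-hand side is <Lam w, k>, where w is the sum of the
    u i c i E (C i) h; replacing c i h by Lamt (Lam h) costs e |h| and makes w a
    contraction applied to Lamt (Lam h). *)
Lemma variation_fine (I : finType) (C : I -> set (borelC R)) (c : I -> R[i]) (e : R) :
  (forall i, measurable (C i)) -> (forall i j, i != j -> C i `&` C j = set0) ->
  (forall i, C i `<=` spectrum A) -> 0 <= e ->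
  (forall i z, C i z -> rnorm (m z - c i) <= e) ->
  \sum_i rnorm (c i) * rnorm (mu (C i))
    <= a * b * rnorm (Lam h) * rnorm k + e * (a * rnorm h * rnorm k).
Proof.
move=> mC dC CS e0 Ce.
have /choice[u uE] : forall i, exists u : R[i], rnorm u <= 1 /\
    u * (c i * mu (C i)) = (rnorm (c i * mu (C i)))%:C%C.
  by move=> i; have [u u1 uE] := phase_ex (c i * mu (C i)); exists u.
pose w := \sum_i E (C i) ((u i * c i) *: h).
pose w1 := \sum_i E (C i) (u i *: Lamt (Lam h)).
pose w2 := \sum_i E (C i) (u i *: (Lamt (Lam h) - c i *: h)).
have ww : w = w1 - w2.
  rewrite /w /w1 /w2 -sumrB; apply: eq_bigr => i _; rewrite -linearB -scalerBr.
  by rewrite opprB addrC subrK scalerA.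
have -> : \sum_i rnorm (c i) * rnorm (mu (C i)) = complex.Re (hdot (Lam w) k).
  rewrite /w linear_sum hdot_suml raddf_sum/=; apply: eq_bigr => i _.
  rewrite !linearZ/= hdotZl -mulrA -/(mu (C i)); have [_ ->] := uE i.
  by rewrite /= rnormM.
apply: le_trans (Re_hdot_le _ _) _.
have lw : rnorm (Lam w) <= a * (b * rnorm (Lam h) + e * rnorm h).
  apply: le_trans (opnorm_ub bLam _) _; rewrite ler_wpM2l// ww.
  apply: le_trans (rnormB _ _) _; apply: lerD.
    apply: (@le_trans _ _ (1 * rnorm (Lamt (Lam h)))).
      apply: (rnorm_orth_sum_le pE mC dC) => // i; rewrite linearZ rnormZ.
      by rewrite ler_wpM2r ?rnorm_ge0//; case: (uE i).
    by rewrite mul1r; exact: opnorm_ub.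
  apply: (rnorm_orth_sum_le pE mC dC) => // i; rewrite linearZ rnormZ.
  have [u1 _] := uE i; apply: (@le_trans _ _ (1 * (e * rnorm (E (C i) h)))); last by rewrite mul1r.
  apply: ler_pM; rewrite ?rnorm_ge0// linearB linearZ/=.
  exact: (multiplier_sym nA resE Lm mul) (Ce i).
have := ler_wpM2r (rnorm_ge0 k) lw; lra.
Qed.

(** Cut each C i along a partition of the spectrum into pieces where m is almost
    constant; finitely many pieces are handled by [variation_fine], and the
    measure of C i is the limit of its finite partial sums. *)
Lemma variation_finite (I : finType) (C : I -> set (borelC R)) (c : I -> R) :
  (forall i, measurable (C i)) -> (forall i j, i != j -> C i `&` C j = set0) ->
  (forall i, C i `<=` spectrum A) ->
  (forall i z, C i z -> c i <= rnorm (m z)) ->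
  \sum_i c i * rnorm (mu (C i)) <= a * b * rnorm (Lam h) * rnorm k.
Proof.
move=> mC dC CS cm.
have Q0 : 0 <= a * rnorm h * rnorm k by rewrite !mulr_ge0// rnorm_ge0.
apply: (le_add_epsM Q0) => e e0 _.
have [F [mF tF FS Fe]] := small_partition mS (@subset_refl _ (spectrum A)) mS Lm.1 e0.
pose G i (j : nat) := C i `&` F j.
have mG i j : measurable (G i j) by exact: measurableI.
have tG i : trivIset setT (G i) by apply: trivIset_setIl.
have GC i : \bigcup_j (G i j) = C i by rewrite -setI_bigcupr FS setIidl.
have /choice[p pE'] : forall ij : I * nat, exists p : R[i],
    (forall z, G ij.1 ij.2 z -> rnorm (m z - p) <= e) /\
    c ij.1 * rnorm (mu (G ij.1 ij.2)) <= rnorm p * rnorm (mu (G ij.1 ij.2)).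
  move=> [i j] /=; have [->|/set0P[z Gz]] := eqVneq (G i j) set0.
    by exists 0; split => //; rewrite /mu (pvm0 pE) linear0 hdot0l rnorm0 !mulr0.
  exists (m z); split.
    by move=> v Gv; apply/ltW/(Fe j); [case: Gv|case: Gz].
  by rewrite ler_wpM2r ?rnorm_ge0//; apply: cm; case: Gz.
pose v i J := \sum_(j < J) mu (G i j).
have vmu i : v i @ \oo --> (mu (C i) : R[i]^o).
  apply/rcvgP.
  have := bounded_cvg bLam (@pvm_series _ _ _ pE _ h (mG i) (tG i)).
  rewrite GC => /rcvgP hl.
  apply: (@squeeze_cvgr _ _ _ _ (cst 0)
     (fun n => rnorm ((Lam \o series (fun j => E (G i j) h)) n - Lam (E (C i) h)) * rnorm k)).
  - apply: nearW => n /=; rewrite rnorm_ge0/=.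
    have -> : v i n - mu (C i) = hdot (Lam (series (fun j => E (G i j) h) n) - Lam (E (C i) h)) k.
      by rewrite hdotBl /v /mu /series/= linear_sum hdot_suml big_mkord.
    exact: hdot_le.
  - exact: cvg_cst.
  - by rewrite -(mul0r (rnorm k)); apply: cvgMl.
have bound J : \sum_i c i * rnorm (v i J)
    <= a * b * rnorm (Lam h) * rnorm k + e * (a * rnorm h * rnorm k).
  pose D (ij : I * 'I_J) := G ij.1 ij.2.
  apply: le_trans (@variation_fine _ D (fun ij => p (ij.1, nat_of_ord ij.2)) e _ _ _ (ltW e0) _).
  - rewrite -(pair_bigA _ (fun (i : I) (j : 'I_J) => rnorm (p (i, nat_of_ord j)) * rnorm (mu (G i j))))/=.
    apply: ler_sum => i _.
    have [ci|ci] := leP 0 (c i).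
      apply: (@le_trans _ _ (\sum_(j < J) c i * rnorm (mu (G i j)))).
        by rewrite -mulr_sumr ler_wpM2l//; exact: rnorm_sum.
      by apply: ler_sum => j _; case: (pE' (i, nat_of_ord j)).
    apply: (@le_trans _ _ 0).
      by rewrite mulr_le0_ge0 ?rnorm_ge0// ltW.
    by apply: sumr_ge0 => j _; rewrite mulr_ge0 ?rnorm_ge0.
  - by move=> ij; exact: mG.
  - move=> [i j] [i' j'] ne; rewrite /D /G/= setIACA.
    have [ii|ii] := eqVneq i i'; last by rewrite dC// set0I.
    have jj : (j : nat) != j'.
      by apply: contra_neq ne => /val_inj ->; rewrite ii.
    by move/trivIsetP : tF => /(_ j j' Logic.I Logic.I jj) ->; rewrite setI0.
  - by move=> [i j] z [/CS].
  - by move=> [i j] z Dz; case: (pE' (i, nat_of_ord j)) => + _; exact.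
apply: (@le_cst_lim _ (fun J => \sum_i c i * rnorm (v i J))); last exact: bound.
have cvgi i : (fun J => c i * rnorm (v i J)) @ \oo --> c i * rnorm (mu (C i)); last first.
  elim: (index_enum I) => [|i r IH].
    by under eq_fun do rewrite big_nil; rewrite big_nil; exact: cvg_cst.
  under eq_fun do rewrite big_cons; rewrite big_cons; apply: cvgD => //.
apply: cvgMr.
move/rcvgP : (vmu i) => vi0.
apply/cvgrPdist_lt => d d0; move/cvgrPdist_lt : vi0 => /(_ _ d0); apply: filterS => n.
rewrite sub0r normrN ger0_norm ?rnorm_ge0//; apply: le_lt_trans.
have := rnormD (v i n - mu (C i)) (mu (C i)); rewrite subrK.
have := rnormD (mu (C i) - v i n) (v i n); rewrite subrK (rdistC (mu (C i))).
by rewrite ler_norml; move: (rnorm _) (rnorm _) (rnorm _) => x y z; lra.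
Qed.

(** When one of the norms is 0 the normalized multiplier is 0, which forces the
    terms on the left to be nonpositive. *)
Lemma variation_normalized (I : finType) (C : I -> set (borelC R)) (c : I -> R) :
  (forall i, measurable (C i)) -> (forall i j, i != j -> C i `&` C j = set0) ->
  (forall i, C i `<=` spectrum A) ->
  (forall i z, C i z -> c i <= rnorm (normalized Lam Lamt m z)) ->
  \sum_i c i * rnorm (mu (C i)) <= rnorm (Lam h) * rnorm k.
Proof.
move=> mC dC CS cm.
have ab0 : 0 <= opnorm Lam * opnorm Lamt by rewrite mulr_ge0// opnorm_ge0.
have nE z : rnorm (normalized Lam Lamt m z) = rnorm (m z) / (opnorm Lam * opnorm Lamt).
  by rewrite /normalized rnormM rnorm_real ger0_norm// invr_ge0.
have [ab|ab] := eqVneq (opnorm Lam * opnorm Lamt) 0.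
  apply: (@le_trans _ _ 0); last by rewrite mulr_ge0// rnorm_ge0.
  apply: sumr_le0 => i _; have [->|/set0P[z Cz]] := eqVneq (C i) set0.
    by rewrite /mu (pvm0 pE) linear0 hdot0l rnorm0 mulr0.
  rewrite mulr_le0_ge0 ?rnorm_ge0//; have := cm _ _ Cz.
  by rewrite nE ab invr0 mulr0.
have {}ab0 : 0 < opnorm Lam * opnorm Lamt by rewrite lt_neqAle eq_sym ab.
rewrite -(ler_pM2l ab0) mulr_sumr.
have H1 := variation_finite (c := fun i => opnorm Lam * opnorm Lamt * c i) mC dC CS.
rewrite [leRHS]mulrA.
apply: le_trans (H1 _); first by apply: ler_sum => i _; rewrite mulrA.
by move=> i z /cm; rewrite nE ler_pdivlMr// mulrC.
Qed.

(** The variation of C i is the supremum of finite partial sums over partitions of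
    C i, and a choice of finite parts of partitions of all the C i is again a
    finite disjoint family. *)
Lemma variation_sum (I : finType) (C : I -> set (borelC R)) (c : I -> R) :
  (forall i, measurable (C i)) -> (forall i j, i != j -> C i `&` C j = set0) ->
  (forall i, C i `<=` spectrum A) -> (forall i, 0 < c i) ->
  (forall i z, C i z -> c i <= rnorm (normalized Lam Lamt m z)) ->
  (\sum_i (c i)%:E * cmeasure_variation mu (C i) <= (rnorm (Lam h) * rnorm k)%:E)%E.
Proof.
move=> mC dC CS c0 cm.
pose part i (B : (set (borelC R))^nat) :=
  [/\ forall j, measurable (B j), trivIset setT B & \bigcup_j B j = C i].
pose S i : set \bar R := [set x | exists B, part i B /\ exists K : nat,
  x = (\sum_(j < K) rnorm (mu (B j)))%:E].
apply: (@le_trans _ _ (\sum_i (c i)%:E * ereal_sup (S i))%E).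
  apply: lee_sum => i _; rewrite lee_wpmul2l ?lee_fin ?(ltW (c0 _))//.
  apply: ge_ereal_sup => _ [B pB <-]; apply: lime_le.
    by apply: is_cvg_nneseries => n _ _; rewrite lee_fin rnorm_ge0.
  apply: nearW => K; apply: ereal_sup_ubound; exists B; split => //; exists K.
  by rewrite -sumEFin big_mkord.
apply: sum_ereal_sup_le => //.
- move=> i; exists 0%E; exists (fun n => if n is 0%N then C i else set0); split.
    split.
    + by case => [|n] //; exact: measurable0.
    + apply/trivIsetP => -[|n] [|n'] // _ _ _; rewrite ?setI0 ?set0I//.
    + by apply/seteqP; split => [z [[|n] _]//|z Cz]; exists 0%N.
  by exists 0%N; rewrite big_ord0.
- by move=> i _ [B [_ [K ->]]]; rewrite lee_fin sumr_ge0// => j _; exact: rnorm_ge0.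
move=> s /choice[B hB].
have /choice[K hK] : forall i, exists K : nat, s i = (\sum_(j < K) rnorm (mu (B i j)))%:E.
  by move=> i; have [_ [K]] := hB i; exists K.
pose N := \max_i K i.
have -> : (\sum_i (c i)%:E * s i = (\sum_i c i * (\sum_(j < K i) rnorm (mu (B i j))))%:E)%E.
  by rewrite -sumEFin; apply: eq_bigr => i _; rewrite hK EFinM.
rewrite lee_fin.
pose D (ij : I * 'I_N) := B ij.1 ij.2.
apply: le_trans (@variation_normalized _ D (fun ij => c ij.1) _ _ _ _).
- rewrite -(pair_bigA _ (fun (i : I) (j : 'I_N) => c i * rnorm (mu (B i j))))/=.
  apply: ler_sum => i _; rewrite -mulr_sumr ler_wpM2l ?(ltW (c0 _))//.
  have KN : (K i <= N)%N by exact: leq_bigmax.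
  rewrite -(big_mkord xpredT (fun j => rnorm (mu (B i j)))).
  rewrite -(big_mkord xpredT (fun j => rnorm (mu (B i j)))).
  rewrite [leRHS](big_cat_nat (leq0n (K i)) KN)//= lerDl sumr_ge0// => j _; exact: rnorm_ge0.
- by move=> [i j]; have [[mB _ _] _] := hB i; exact: mB.
- move=> [i j] [i' j'] ne; rewrite /D/=.
  have [[_ tB BC] _] := hB i; have [[_ _ BC'] _] := hB i'.
  have [ii|ii] := eqVneq i i'.
    have jj : (j : nat) != j' by apply: contra_neq ne => /val_inj ->; rewrite ii.
    by move/trivIsetP : tB => /(_ j j' Logic.I Logic.I jj); rewrite ii.
  apply/seteqP; split => // z [zi zi']; rewrite -(dC _ _ ii); split.
    by rewrite -BC; exists j.
  by rewrite -BC'; exists j'.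
- move=> [i j] z Dz; have [[_ _ BC] _] := hB i; apply: (CS i).
  by rewrite -BC; exists j.
- move=> [i j] z Dz; have [[_ _ BC] _] := hB i; apply: cm.
  by rewrite -BC; exists j.
Qed.

Import HBNNSimple.

Lemma variation_set0 : cmeasure_variation mu set0 = 0%E.
Proof.
apply/eqP; rewrite eq_le; apply/andP; split.
  apply: ge_ereal_sup => _ [B [_ _ B0] <-].
  rewrite eseries0// => i _ _; have -> : B i = set0.
    by apply/seteqP; split => // z Bz; rewrite -B0; exists i.
  by rewrite /mu (pvm0 pE) linear0 hdot0l rnorm0.
apply: ereal_sup_ubound; exists (fun=> set0).
  split => //; first by apply/trivIsetP => i j _ _ _; rewrite setI0.
  by apply/seteqP; split => // z [].
rewrite eseries0// => i _ _.
by rewrite /mu (pvm0 pE) linear0 hdot0l rnorm0.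
Qed.

(** The integral is the supremum of the sums attached to the simple functions below
    the integrand. The positive values of such a function are taken on disjoint
    subsets of the spectrum, so that [variation_sum] bounds each of these sums. *)
Theorem variation_integral :
  (\int[cmeasure_variation mu]_(z in spectrum A)
     (rnorm (normalized Lam Lamt m z))%:E <= (rnorm (Lam h) * rnorm k)%:E)%E.
Proof.
rewrite /integral; set f := _ \_ _.
have sint (s : {nnsfun (borelC R) >-> R}) : (forall z, (s z)%:E <= f z)%E ->
    (0 <= sintegral (cmeasure_variation mu) s <= (rnorm (Lam h) * rnorm k)%:E)%E.
  move=> sf.
  have finr : finite_set (range s) by exact: fimfunP.
  have /finite_seqP[q qE] := finr.
  pose r := [seq x <- undup q | 0 < x].
  have ur : uniq r by rewrite filter_uniq// undup_uniq.
  have -> : sintegral (cmeasure_variation mu) s =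
      (\sum_(i < size r) (r`_i)%:E * cmeasure_variation mu (s @^-1` [set r`_i]))%E.
    rewrite /sintegral (@fsbigE _ _ _ _ _ r)//; first last.
    move=> x _ xr; have [x0|x0] := leP x 0; last first.
      have -> : s @^-1` [set x] = set0.
        apply/seteqP; split => // z /= sz; move: xr; rewrite mem_filter x0/= mem_undup.
        by move=> /negP; apply; have : range s x by [exists z]; rewrite qE.
      by rewrite variation_set0 mule0.
    have [->|x00] := eqVneq x 0; first by rewrite mul0e.
    have -> : s @^-1` [set x] = set0.
      apply/seteqP; split => // z /= sz; have : 0 <= s z by exact: fun_ge0.
      by rewrite sz leNgt lt_neqAle x00 x0.
    by rewrite variation_set0 mule0.
    under eq_bigl do rewrite in_setT; by rewrite (big_nth 0) big_mkord.
  have rp (i : 'I_(size r)) : 0 < r`_i.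
    by have := mem_nth 0 (ltn_ord i); rewrite mem_filter => /andP[].
  have hS (i : 'I_(size r)) z : (s @^-1` [set r`_i]) z ->
      spectrum A z /\ r`_i <= rnorm (normalized Lam Lamt m z).
    move=> /= sz; have := sf z; rewrite sz /f /patch; case: ifPn => [/set_mem Sz|_].
      by rewrite lee_fin.
    by rewrite lee_fin leNgt rp.
  apply/andP; split.
    apply: sume_ge0 => i _; rewrite mule_ge0 ?lee_fin ?(ltW (rp _))//.
    apply: (@le_trans _ _ (\sum_(0 <= j <oo)
      (rnorm (mu ((fun n => if n is 0%N then s @^-1` [set r`_i] else set0) j)))%:E)%E).
      by apply: nneseries_ge0 => j _ _; rewrite lee_fin rnorm_ge0.
    apply: ereal_sup_ubound; exists (fun n => if n is 0%N then s @^-1` [set r`_i] else set0) => //.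
    split.
    + by case => [|n] //; exact: measurable0.
    + apply/trivIsetP => -[|n] [|n'] // _ _ _; rewrite ?setI0 ?set0I//.
    + by apply/seteqP; split => [z [[|n] _]//|z Cz]; exists 0%N.
  apply: variation_sum => //.
  - move=> i j ij; apply/seteqP; split => // z [/= zi zj].
    by move: ij; rewrite -(inj_eq val_inj)/= -(nth_uniq 0 (ltn_ord i) (ltn_ord j) ur) -zi zj eqxx.
  - by move=> i z /hS[].
  - by move=> i z /hS[].
have f0 z : (0 <= f z)%E.
  by rewrite /f /patch; case: ifPn => // _; rewrite lee_fin rnorm_ge0.
apply: (@le_trans _ _ (ereal_sup [set sintegral (cmeasure_variation mu) s |
    s in [set s : {nnsfun (borelC R) >-> R} | forall x, ((s x)%:E <= f^\+ x)%E]] - 0)%E).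
  apply: leeB => //.
  have /andP[s0 _] := sint nnsfun0 (fun z => f0 z).
  apply: le_trans s0 _; apply: ereal_sup_ubound; exists nnsfun0 => // z.
  exact: funeneg_ge0.
rewrite sube0; apply: ge_ereal_sup => _ [s /= sf <-].
have [|_ //] := andP (sint s _).
move=> z; apply: le_trans (sf z) _; rewrite funeposE.
by rewrite ge_max lexx f0.
Qed.

End intertwined_variation.

(** * Simple spectrum: operators commuting with E are functions of A *)

Section bounded_density.
Variable R : realType.
Local Notation mC := {finite_measure set (borelC R) -> \bar R}.

(** A Radon-Nikodym derivative of nu exceeds K + 1 only on a null set, since nu
    is at most K mu there; truncating it does not change its integrals. *)
Lemma bounded_density (nu : set (borelC R) -> R) (m : mC) (K : R) :
  representable nu -> 0 <= K ->
  (forall B, measurable B -> `|nu B| <= K * fine (m B)) ->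
  exists f : borelC R -> R, [/\ measurable_fun setT f,
    forall z, `|f z| <= K + 1 &
    forall B, measurable B -> nu B = \int[m]_(z in B) f z].
Proof.
move=> [m1 [m2 nuE]] K0 nuK.
have [c cE] := charge_ex nuE.
have cm : c `<< m.
  apply/null_content_dominatesP => B mB mB0; rewrite cE//.
  have := nuK B mB; rewrite mB0/= mulr0 normr_le0 => /eqP ->//.
pose F := Radon_Nikodym c m.
have Ffin z : F z \is a fin_num by exact: Radon_Nikodym_fin_num.
have Fint : m.-integrable setT F by exact: Radon_Nikodym_integrable.
pose f1 z := fine (F z).
have f1E : EFin \o f1 = F by apply/funext => z /=; rewrite /f1 fineK.
have if1 B : measurable B -> m.-integrable B (EFin \o f1).
  by move=> mB; rewrite f1E; apply: integrableS Fint.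
have nuf1 B : measurable B -> nu B = \int[m]_(z in B) f1 z.
  move=> mB; apply: EFin_inj; rewrite -cE// (Radon_Nikodym_integral cm mB).
  rewrite /Rintegral fineK; last by apply: integrable_fin_num => //; exact: if1.
  by apply: eq_integral => z _; rewrite /f1 fineK.
have mf1 : measurable_fun setT f1.
  by apply/measurable_EFinP; rewrite f1E; exact: measurable_int Fint.
have mM B : measurable B -> fine (m B) = 0 -> m B = 0%E.
  by move=> mB B0; rewrite -[LHS]fineK ?fin_num_measure// B0.
pose N1 : set (borelC R) := f1 @^-1` `]K + 1, +oo[.
pose N2 : set (borelC R) := f1 @^-1` `]-oo, - (K + 1)[.
have mN1 : measurable N1 by rewrite -[N1]setTI; exact: mf1.
have mN2 : measurable N2 by rewrite -[N2]setTI; exact: mf1.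
have icst k B : measurable B -> m.-integrable B (EFin \o cst k).
  by move=> mB; apply: bounded_integrable => //; split; [exact: measurable_cst|exists `|k|].
have N10 : m N1 = 0%E.
  apply: mM => //; have h1 : (K + 1) * fine (m N1) <= nu N1.
    rewrite nuf1// -Rintegral_cst//; apply: le_Rintegral => //.
    + exact: icst.
    + exact: if1.
    + by move=> z; rewrite /N1/= in_itv/= andbT => /ltW.
  have := nuK _ mN1; have := ler_norm (nu N1); have : 0 <= fine (m N1) by exact: fine_ge0.
  lra.
have N20 : m N2 = 0%E.
  apply: mM => //; have h1 : nu N2 <= - (K + 1) * fine (m N2).
    rewrite nuf1// -Rintegral_cst//; apply: le_Rintegral => //.
    + exact: if1.
    + exact: icst.
    + by move=> z; rewrite /N2/= in_itv/= => /ltW.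
  have := nuK _ mN2; have := ler_norm (- nu N2); rewrite normrN.
  have : 0 <= fine (m N2) by exact: fine_ge0.
  lra.
pose M := N1 `|` N2.
have mMs : measurable M by exact: measurableU.
have M0 : m M = 0%E.
  apply/eqP; rewrite eq_le measure_ge0 andbT.
  have h : (m M <= m N1 + m N2)%E by exact: measureU2.
  by apply: le_trans h _; rewrite N10 N20 adde0.
exists (fun z => Num.max (- (K + 1)) (Num.min (f1 z) (K + 1))); split.
- apply: measurable_maxr; first exact: measurable_cst.
  by apply: measurable_minr => //; exact: measurable_cst.
- move=> z; rewrite ler_norml le_max lexx/= ge_max ge_min lexx orbT andbT; lra.
- move=> B mB; rewrite nuf1// /Rintegral.
  have fi : m.-integrable B (EFin \o (fun z => Num.max (- (K + 1)) (Num.min (f1 z) (K + 1)))).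
    apply: bounded_integrable => //; split.
      apply: measurable_funTS; apply: measurable_maxr; first exact: measurable_cst.
      by apply: measurable_minr => //; exact: measurable_cst.
    exists (K + 1) => z _.
    by rewrite ler_norml le_max lexx/= ge_max ge_min lexx orbT andbT; lra.
  rewrite (negligible_integral mMs mB (if1 B mB) M0).
  rewrite [in RHS](negligible_integral mMs mB fi M0).
  congr fine; apply: eq_integral => z /set_mem[Bz nM] /=; congr EFin.
  have h1 : f1 z <= K + 1.
    by rewrite leNgt; apply/negP => h; apply: nM; left; rewrite /N1/= in_itv/= andbT.
  have h2 : - (K + 1) <= f1 z.
    by rewrite leNgt; apply/negP => h; apply: nM; right; rewrite /N2/= in_itv/=.
  by rewrite min_l// max_r.
Qed.

End bounded_density.

Section normal_operator.
Variables (R : realType) (H : hilbertType R).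
Variables (A : set (H * H)) (E : set (borelC R) -> {linear H -> H}).
Hypothesis nA : normal_op A.
Hypothesis resE : resolution_of_identity A E.
Implicit Types (B C D : set (borelC R)) (x y : H).

Let pE : projection_valued_measure E := resE.1.

(** On a bounded set A is close to multiplication by z, and pairing with it shows
    that the adjoint is close to multiplication by the conjugate of z. *)
Lemma sym_conj_adjoint x y : adjoint A (x, y) ->
  symbol E (fun z => Num.conj z) setT x y.
Proof.
move=> /= xy; rewrite -bigcup_disc.
apply: (sym_cover pE) => [n|n]; first exact: measurable_disc.
move=> B mB Bn c r r0 h.
have Br z : B z -> rnorm (z : R[i]) <= n.+1%:R by move=> /Bn; exact: rnorm_disc.
apply: rnorm_le_hdot; first by rewrite mulr_ge0// rnorm_ge0.
move=> w; have [v [sv Av]] := op_bounded_dom resE w mB Br.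
rewrite hdotC rnorm_conj.
have -> : hdot w (E B y - c *: E B x) = hdot (E B v - Num.conj c *: E B w) (E B x).
  rewrite hdotBr hdotZr hdotBl hdotZl -!(pvm_adj pE)// !(pvm_idem pE)//; congr (_ - _).
  by rewrite -(xy _ _ Av).
apply: le_trans (hdot_le _ _) _; rewrite mulrAC; apply: ler_wpM2r; first exact: rnorm_ge0.
have := sv B mB (@subset_refl _ B) (Num.conj c) r r0.
have hc z : B z -> rnorm (id z - Num.conj c) <= r.
  by move=> Bz; rewrite -rnorm_conj rmorphB/= conjCK; exact: h.
move=> /(_ hc) h1; apply: le_trans h1 _.
by rewrite ler_wpM2l//; exact: (rnorm_pvm_le pE).
Qed.

Section cyclic_vector.
Variable v : H.

(** This is the closed linear span of the vectors E B v, described as the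
    annihilator of its annihilator. *)
Definition cyclic_space : set H :=
  [set x | forall u, (forall B, measurable B -> hdot (E B v) u = 0) -> hdot x u = 0].

Lemma cyclic_space_pvm x B : measurable B -> cyclic_space x -> cyclic_space (E B x).
Proof.
move=> mB Zx u hu; rewrite (pvm_adj pE)//; apply: Zx => C mC.
by rewrite -(pvm_adj pE)// -(pvmI pE)// hu//; exact: measurableI.
Qed.

(** If u is orthogonal to all E B v, the measure <E B x, u> vanishes for x in the
    cyclic space, and on a bounded set <y, u> is an integral against it. *)
Lemma cyclic_space_sym phi x y : measurable_fun setT (phi : borelC R -> borelC R) ->
  (forall n z, disc n z -> rnorm (phi z) <= n.+1%:R) ->
  symbol E phi setT x y -> cyclic_space x -> cyclic_space y.
Proof.
move=> mphi phin xy Zx u hu.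
pose F := seqDU (@disc R).
have mF i : measurable (F i).
  by apply: measurableD; [|apply: bigsetU_measurable => ? _]; exact: measurable_disc.
have tF : trivIset setT F by exact: trivIset_seqDU.
have FT : \bigcup_i F i = setT by rewrite -seqDU_bigcup_eq bigcup_disc.
have Fu i : hdot (E (F i) y) u = 0.
  have LF : Linfty (F i) phi.
    split; first exact: measurable_funTS.
    by exists i.+1%:R => z Fz; apply: phin; exact: subset_seqDU Fz.
  have := sym_op_integral pE (mF i) LF (symS (@subsetT _ _) xy) u => ->.
  apply/rnorm_eq0/eqP; rewrite eq_le rnorm_ge0 andbT.
  have [mFi [M FM]] := LF.
  have FM' z : F i z -> rnorm (phi z) <= `|M|.
    by move=> Fz; apply: le_trans (FM _ Fz) _; exact: ler_norm.
  have := complex_integral_le (pvm_crepresentable pE x u) (mF i) mFi (normr_ge0 M) FM' (K := 0).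
  rewrite mulr0; apply => B mB _.
  by rewrite (cyclic_space_pvm mB Zx hu) rnorm0.
have Fy := @pvm_series _ _ _ pE _ y mF tF; rewrite FT (pvmT pE) in Fy.
move/rcvgP : Fy => Fy.
apply/rnorm_eq0/eqP; rewrite eq_le rnorm_ge0 andbT.
apply: (@le_add_epsM _ _ _ (rnorm u)) => [|e e0 _]; first exact: rnorm_ge0.
move/cvgrPdist_lt : Fy => /(_ e e0)[N _ /(_ N (leqnn _))].
rewrite /= sub0r normrN ger0_norm ?rnorm_ge0// rdistC => h.
have -> : hdot y u = hdot (y - series (fun i => E (F i) y) N) u.
  rewrite hdotBl /series/= hdot_suml big1 ?subr0// => i _; exact: Fu.
apply: le_trans (hdot_le _ _) _; rewrite add0r.
by rewrite ler_wpM2r ?rnorm_ge0// ltW.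
Qed.

Lemma cyclic_space_op_pow (G : set (H * H)) k x y :
  (forall a b, G (a, b) -> cyclic_space a -> cyclic_space b) ->
  op_pow G k (x, y) -> cyclic_space x -> cyclic_space y.
Proof.
move=> GZ; elim: k x y => [|k IH] x y; first by rewrite /op_pow /graph/= => ->.
move=> h Zx; have [z xz zy] : exists2 z, op_pow G k (x, z) & G (z, y) by exact: h.
by apply: GZ zy _; exact: IH xz Zx.
Qed.

Hypothesis cyc : closure (lin_span
      [set w | exists k l,
         (op_pow (adjoint A) k \; op_pow A l)%relation (v, w)]) = setT.

(** A and its adjoint map the cyclic space of v for E to itself, so that it
    contains the dense span of the vectors obtained from v. *)
Lemma cyclic_total u : (forall B, measurable B -> hdot (E B v) u = 0) -> u = 0.
Proof.
move=> hu.
have AZ a b : A (a, b) -> cyclic_space a -> cyclic_space b.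
  move=> /(op_sym nA resE) ab; apply: (cyclic_space_sym _ _ ab).
    exact: measurable_id.
  by move=> n z; exact: rnorm_disc.
have AZ' a b : adjoint A (a, b) -> cyclic_space a -> cyclic_space b.
  move=> /sym_conj_adjoint ab; apply: (cyclic_space_sym _ _ ab).
    apply: (@lipschitz_measurable _ _ _ 1) => // z w _ _.
    by rewrite mul1r -rmorphB rnorm_conj.
  by move=> n z; rewrite rnorm_conj; exact: rnorm_disc.
have Zv : cyclic_space v by move=> w hw; rewrite -(pvmT pE v); exact: hw.
have Su w : lin_span [set w | exists k l,
    (op_pow (adjoint A) k \; op_pow A l)%relation (v, w)] w -> hdot w u = 0.
  move=> [n [a [f [fS ->]]]]; rewrite hdot_suml big1// => i _; rewrite hdotZl.
  have [k [l [z /= vz zf]]] := fS i.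
  have Zz := cyclic_space_op_pow AZ vz Zv.
  by rewrite (cyclic_space_op_pow AZ' zf Zz hu) mulr0.
have : closure (lin_span [set w | exists k l,
    (op_pow (adjoint A) k \; op_pow A l)%relation (v, w)]) u by rewrite cyc.
move=> /closureP cu; apply: rnorm_eq0; apply/eqP; rewrite eq_le rnorm_ge0 andbT.
apply: (@le_add_epsM _ _ _ 1) => // e e0 _; rewrite add0r mulr1.
have [w Sw uw] := cu _ e0.
have : rnorm u ^+ 2 <= rnorm (u - w) * rnorm u.
  have <- : complex.Re (hdot (u - w) u) = rnorm u ^+ 2.
    by rewrite hdotBl (Su w Sw) subr0 hdot_sqr.
  exact: Re_hdot_le.
have [->|u0] := eqVneq (rnorm u) 0; first by rewrite (ltW e0).
rewrite expr2 ler_pM2r; last by rewrite lt_neqAle eq_sym u0 rnorm_ge0.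
by move=> h; apply: le_trans h (ltW uw).
Qed.

(** An operator commuting with the spectral measure acts on the vectors E B v as
    the density of B |-> <T (E B v), v> with respect to |E B v|^2; since the
    E B v are total, this density is the function of A equal to T. *)
Lemma commutant_multiplier (T : {linear H -> H}) : bounded_op T ->
  (forall B x, measurable B -> T (E B x) = E B (T x)) ->
  exists m : R[i] -> R[i], Linfty (spectrum A) m /\
    forall x, op_integral (fun B => E B) (spectrum A) m x (T x).
Proof.
move=> bT TE.
have mS := measurable_spectrum nA resE; have ES := pvm_spectrum nA resE.
have [M M0 TM] := bounded_op_ge0 bT.
pose mv : {finite_measure set (borelC R) -> \bar R} := pvm_measure pE v.
pose mz : {finite_measure set (borelC R) -> \bar R} := pvm_measure pE 0.
have mvE B : measurable B -> fine (mv B) = rnorm (E B v) ^+ 2.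
  by move=> mB; transitivity (fine (pvm_measure pE v B)) => //; rewrite pvm_measureE.
have mzE B : measurable B -> fine (mz B) = 0.
  move=> mB; transitivity (fine (pvm_measure pE 0 B)) => //.
  by rewrite pvm_measureE//= linear0 rnorm0 expr0n.
have nuM B : measurable B -> rnorm (hdot (E B (T v)) v) <= M * fine (mv B).
  move=> mB; rewrite mvE// (hdot_pvm1 pE)// -TE// expr2 mulrA.
  by apply: le_trans (hdot_le _ _) _; rewrite ler_wpM2r ?rnorm_ge0.
have [rRe rIm] := pvm_crepresentable pE (T v) v.
have [f [mf fM nuf]] := bounded_density rRe M0
  (fun B mB => le_trans (Re_le_rnorm _) (nuM B mB)).
have [f' [mf' fM' nuf']] := bounded_density rIm M0
  (fun B mB => le_trans (Im_le_rnorm _) (nuM B mB)).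
pose m (z : R[i]) := (f z +i* f' z)%C.
have Lm : Linfty (spectrum A) m.
  split.
    by apply: measurable_funC => /=; apply: measurable_funTS.
  exists ((M + 1) + (M + 1)) => z _; apply: le_trans (rnorm_le_ReIm _) _.
  by apply: lerD; [exact: fM|exact: fM'].
exists m; split => //.
have [T' bT' T'E] := op_integral_ex pE mS Lm.
have sT' x := op_integral_sym pE mS Lm (T'E x).
have T'C B x : measurable B -> T' (E B x) = E B (T' x).
  move=> mB; have := sym_uniq pE mS Lm.1 (sT' (E B x)) (sym_pvm pE mB mS (sT' x)).
  by rewrite !ES.
have repRe : represents (fun B => complex.Re (hdot (E B v) v)) mv mz.
  by move=> B mB; rewrite mvE// mzE// subr0 (rnorm_pvm_sqr pE).
have repIm : represents (fun B => complex.Im (hdot (E B v) v)) mz mz.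
  by move=> B mB; rewrite subrr (hdot_pvm1 pE)// hdot_sqr.
have diag X : measurable X -> hdot (T' (E X v)) v = hdot (T (E X v)) v.
  move=> mX; rewrite T'E.
  pose SX : set (borelC R) := spectrum A `&` X.
  have mSX : measurable SX by exact: measurableI.
  have LSX : Linfty SX m by apply: LinftyS Lm => //; exact: subIsetl.
  rewrite (pint_restr pE (x := v) (g := v) (D := spectrum A) (B := X))//; last 2 first.
  - by move=> C mC; rewrite -(pvmI pE).
  - by case: Lm.
  have bf : bounded_on SX f.
    by split; [exact: measurable_funTS|exists (M + 1) => z _; exact: fM].
  have bf' : bounded_on SX f'.
    by split; [exact: measurable_funTS|exists (M + 1) => z _; exact: fM'].
  have I0 (q : borelC R -> R) : bounded_on SX q ->
      \int[mz]_(z in SX) q z = 0.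
    move=> [mq [K qK]]; apply/eqP; rewrite -normr_le0.
    by apply: le_trans (Rintegral_le_norm mz mSX mq qK) _; rewrite mzE// mulr0.
  rewrite -/SX /complex_integral /=.
  rewrite !(signed_integralE repRe)// !(signed_integralE repIm)// !I0//.
  rewrite !subr0 addr0 -nuf// -nuf'//.
  have -> : SX = X `&` spectrum A by exact: setIC.
  rewrite (pvmI pE)// ES TE//; by case: (hdot _ _).
have EW X : measurable X -> T (E X v) = T' (E X v).
  move=> mX; apply/eqP; rewrite -subr_eq0; apply/eqP; apply: cyclic_total => Y mY.
  apply: hdotC0; rewrite -(pvm_adj pE)// linearB/= -TE// -T'C// hdotBl -(pvmI pE)//.
  by rewrite diag ?subrr//; exact: measurableI.
move=> x; have -> // : T x = T' x.
apply: hdot_inj => w; have [u uE] := adjoint_ex bT w; have [u' uE'] := adjoint_ex bT' w.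
rewrite uE uE'; suff -> : u = u' by []; apply/eqP; rewrite -subr_eq0; apply/eqP.
by apply: cyclic_total => B mB; rewrite hdotBr -uE -uE' EW// subrr.
Qed.

End cyclic_vector.

End normal_operator.

(** * The theorem *)

Theorem theorem2p2 (R : realType) (H Ht : hilbertType R)
    (P : R -> {linear H -> H}) (Pt : R -> {linear Ht -> Ht})
    (A : set (Ht * Ht)) (E : set (borelC R) -> {linear Ht -> Ht}) (gam1 : R)
    (Lam : {linear Ht -> H}) (Lamt : {linear H -> Ht})
    (sepH : separable_space H) (sepHt : separable_space Ht)
    (csP : contraction_semigroup P) (csPt : contraction_semigroup Pt)
    (genPt : exp_semigroup Pt A) (nA : normal_op A)
    (gapA : spectral_gap A gam1) (resE : resolution_of_identity A E)
    (bLam : bounded_op Lam) (bLamt : bounded_op Lamt)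
    (dLam : dense (range Lam)) (dLamt : dense (range Lamt))
    (intLam : forall t x, 0 <= t -> P t (Lam x) = Lam (Pt t x))
    (intLamt : forall t x, 0 <= t -> Pt t (Lamt x) = Lamt (P t x))
    (invE : forall B : set (borelC R), measurable B ->
      E B @` closure (op_ran (adjoint (graph Lam))) `<=`
        closure (op_ran (adjoint (graph Lam)))) :
  [/\
    forall m : R[i] -> R[i],
      Linfty (spectrum A) m -> multiplier_for Lam Lamt A E m ->
      forall f g : H, range Lam f ->
        (\int[cmeasure_variation
                (fun B => hdot (intertwined_measure Lam E B f) g)]_(z in spectrum A)
           (rnorm (normalized Lam Lamt m z))%:E
         <= (rnorm f * rnorm g)%:E)%E,
    simple_spectrum A ->
      exists m : R[i] -> R[i],
        Linfty (spectrum A) m /\ multiplier_for Lam Lamt A E m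
  & forall (m : R[i] -> R[i]) (Tm : R),
      Linfty (spectrum A) m -> multiplier_for Lam Lamt A E m ->
      0 < Tm ->
      (forall z, spectrum A z -> m z <> 0) ->
      (forall t, Tm < t ->
        Linfty (spectrum A) (fun z => cexp (- (t%:C%C * z)) / m z)) ->
      forall t, Tm < t ->
      [/\ exists S : {linear H -> H},
            bounded_op S /\
            forall f, range Lam f ->
              op_integral (intertwined_measure Lam E) (spectrum A)
                (fun z => cexp (- (t%:C%C * z))) f (S f),
          forall f, rnorm (P t f - Pinf P f) <=
            supnorm (spectrum A) (decay_multiplier Lam Lamt m gam1 t)
              * rnorm (f - Pinf P f)
        & spectrum A gam1%:C%C ->
          rnorm (decay_multiplier Lam Lamt m gam1 t gam1%:C%C) =
            supnorm (spectrum A) (decay_multiplier Lam Lamt m gam1 t) ->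
          forall f, rnorm (P t f - Pinf P f) <=
            (rnorm (normalized Lam Lamt m gam1%:C%C))^-1 * expR (- (gam1 * t))
              * rnorm (f - Pinf P f)]].
Proof.
split.
- move=> m Lm mul f k rf; have hf := pseudo_inverseK bLam rf.
  have := variation_integral nA resE bLam bLamt (pseudo_inverse Lam f) k Lm mul.
  by rewrite hf.
- move=> [v [_ cyc]].
  apply: (commutant_multiplier nA resE cyc (T := Lamt \o Lam)).
    exact: bounded_op_comp.
  move=> B x mB; apply: (commuting_pvm nA resE genPt) => //.
    exact: bounded_op_comp.
  by move=> t y t0 /=; rewrite -intLam// -intLamt.
- move=> m Tm Lm mul Tm0 m0 Lq t Tt.
  have t0 : 0 <= t by rewrite ltW// (lt_trans Tm0).
  have decay f := semigroup_decay csP csPt genPt nA gapA resE bLam bLamt dLam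
    intLam intLamt f Lm mul t0 m0 (Lq t Tt).
  split.
  + exists (P t); split; first exact: semigroup_bounded.
    by move=> f; apply: (intertwined_semigroup_integral csPt genPt nA gapA resE).
  + exact: decay.
  + move=> Sg sup f; apply: le_trans (decay f) _.
    by rewrite -sup (rnorm_decay_gap).
Qed.
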